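(* Any two piecewise constant volume forms $\Omega_1$ and $\Omega_2$ on a closed oriented PL manifold $P$, with identical total volume, are PL equivalent.
   Context: A polyhedron is the body $|K|$ (union of the simplices) of a simplicial complex $K$ (a locally finite collection of closed affine simplices in some $\mathbb{R}^N$, closed under faces, any two meeting in a common face or not at all); $K$ is then a triangulation of it. A PL manifold of dimension $n$ is a polyhedron $P$ such that for some (equivalently any) triangulation $K$ of $P$ the star of each simplex admits a PL embedding onto a PL ball in $\mathbb{R}^n$. A PL homeomorphism $h:K'\to K''$ between simplicial complexes is a homeomorphism $|K'|\to|K''|$ whose restriction to each simplex of $K'$ is an affine map onto a simplex of $K''$. A piecewise constant volume form on $P$ ($\dim P=n$) is, for some triangulation $K$ of $P$, a collection $\Omega=(\Omega_\sigma)$ indexed by the $n$-simplices of $K$, where $\Omega_\sigma$ is a nonzero constant $n$-form on $\sigma$ (constant in affine coordinates), such that the $\Omega_\sigma$ together induce an orientation of $P$. It induces a piecewise constant form, denoted the same way, on each subdivision of $K$. The total volume is $\int_P\Omega=\sum_\sigma\int_\sigma\Omega_\sigma$, with respect to the orientation of $P$. Two such forms are PL equivalent if there exist two triangulations $K'$ and $K''$ of $P$ (subdividing triangulations on which the forms are defined) and a PL homeomorphism $h:K'\to K''$ such that $h^*\Omega_1=\Omega_2$, where pullback is taken simplex by simplex.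
   Formalization: The closed oriented PL manifold P is additionally assumed connected; without this the claim fails, e.g. on two disjoint polygonal circles with component volumes (1,3) and (2,2). *)

(* Defs.v *)
(* R^N is the type ['rV[R]_N] of row vectors, with its product topology. *)
From HB Require Import structures.
From mathcomp Require Import all_boot all_order all_algebra finmap.
From mathcomp Require Import all_classical all_reals all_analysis.

Set Implicit Arguments.
Unset Strict Implicit.
Unset Printing Implicit Defensive.

Import Order.TTheory GRing.Theory Num.Theory.
Import numFieldNormedType.Exports.

Local Open Scope classical_set_scope.
Local Open Scope ring_scope.

(* A simplex is represented by its finite set of vertices, so that its faces
   are the nonempty subsets; [hull s] is the corresponding closed point set. *)
Definition hull (R : realType) (N : nat) (s : {fset 'rV[R]_N}) :
    set 'rV[R]_N :=
  [set x | exists a : 'rV[R]_N -> R,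
    [/\ forall v, v \in s -> 0 <= a v,
        \sum_(v <- s) a v = 1 &
        x = \sum_(v <- s) a v *: v]].

Definition affinely_independent (R : realType) (N : nat)
    (s : {fset 'rV[R]_N}) : Prop :=
  forall a : 'rV[R]_N -> R,
    \sum_(v <- s) a v = 0 -> \sum_(v <- s) a v *: v = 0 ->
    forall v, v \in s -> a v = 0.

Definition is_simplex (R : realType) (N : nat) (n : nat)
    (s : {fset 'rV[R]_N}) : Prop :=
  affinely_independent s /\ #|` s| = n.+1.

Definition body (R : realType) (N : nat) (K : set {fset 'rV[R]_N}) :
    set 'rV[R]_N :=
  \bigcup_(s in K) hull s.

Record simplicial_complex (R : realType) (N : nat)
    (K : set {fset 'rV[R]_N}) : Prop := {
  complex_simplex : forall s, K s -> exists n, is_simplex n s;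
  complex_face : forall s t, K s -> (t `<=` s)%fset -> t != fset0 -> K t;
  complex_meet : forall s t, K s -> K t ->
    hull s `&` hull t = set0 \/
    exists r, [/\ K r, (r `<=` s)%fset, (r `<=` t)%fset &
                  hull s `&` hull t = hull r];
  complex_locally_finite : forall x, body K x ->
    exists2 U : set ('rV[R]_N), nbhs x U & finite_set [set s | K s /\ hull s `&` U !=set0] }.

Definition triangulation (R : realType) (N : nat) (P : set 'rV[R]_N)
    (K : set {fset 'rV[R]_N}) : Prop :=
  simplicial_complex K /\ body K = P.

Definition subdivides (R : realType) (N : nat)
    (K' K : set {fset 'rV[R]_N}) : Prop :=
  [/\ simplicial_complex K', body K' = body K &
      forall s, K' s -> exists2 t, K t & hull s `<=` hull t].

Definition n_simplices (R : realType) (N : nat) (n : nat)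
    (K : set {fset 'rV[R]_N}) : set {fset 'rV[R]_N} :=
  [set s | K s /\ is_simplex n s].

Definition affine_with (R : realType) (N m : nat) (h : 'rV[R]_N -> 'rV[R]_m)
    (s : {fset 'rV[R]_N}) (A : 'M[R]_(N, m)) : Prop :=
  exists b : 'rV[R]_m, forall x, hull s x -> h x = x *m A + b.

Definition homeomorphism_between (R : realType) (N m : nat)
    (X : set 'rV[R]_N) (Y : set 'rV[R]_m) (h : 'rV[R]_N -> 'rV[R]_m) : Prop :=
  set_bij X Y h /\
  exists g : 'rV[R]_m -> 'rV[R]_N,
    [/\ {in X, cancel h g}, {within X, continuous h} &
        {within Y, continuous g}].

Definition pl_homeo (R : realType) (N m : nat) (K : set {fset 'rV[R]_N})
    (L : set {fset 'rV[R]_m}) (h : 'rV[R]_N -> 'rV[R]_m) : Prop :=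
  homeomorphism_between (body K) (body L) h /\
  forall s, K s ->
    (exists A, affine_with h s A) /\ exists2 t, L t & h @` hull s = hull t.

Definition polyhedra_homeo (R : realType) (N m : nat) (X : set 'rV[R]_N)
    (Y : set 'rV[R]_m) (h : 'rV[R]_N -> 'rV[R]_m) : Prop :=
  exists K L, [/\ triangulation X K, triangulation Y L & pl_homeo K L h].

Definition cube (R : realType) (n : nat) : set 'rV[R]_n :=
  [set x | forall i, 0 <= x ord0 i <= 1].

Definition pl_ball (R : realType) (n : nat) (B : set 'rV[R]_n) : Prop :=
  exists h, polyhedra_homeo (@cube R n) B h.

Definition star (R : realType) (N : nat) (K : set {fset 'rV[R]_N})
    (s : {fset 'rV[R]_N}) : set 'rV[R]_N :=
  \bigcup_(t in [set t | K t /\ (s `<=` t)%fset]) hull t.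

Definition pl_manifold (R : realType) (N n : nat) (P : set 'rV[R]_N) : Prop :=
  exists2 K, triangulation P K &
    forall s, K s ->
      exists (B : set 'rV[R]_n) h,
        pl_ball B /\ polyhedra_homeo (star K s) B h.

(* Interior points have a chart onto a polyhedron Y of R^n sending them to the
   topological interior of Y; by invariance of domain the remaining points are
   those that every chart of the manifold sends to the boundary. *)
Definition pl_boundary (R : realType) (N n : nat) (P : set 'rV[R]_N) :
    set 'rV[R]_N :=
  [set x | P x /\
    ~ exists (X : set 'rV[R]_N) (Y : set 'rV[R]_n) h,
        [/\ X `<=` P, within P (nbhs x) X, polyhedra_homeo X Y h &
            interior Y (h x)]].

Definition closed_pl_manifold (R : realType) (N n : nat)
    (P : set 'rV[R]_N) : Prop :=
  [/\ pl_manifold n P, compact P & pl_boundary n P = set0].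

Definition tangent (R : realType) (N : nat) (s : {fset 'rV[R]_N}) :
    {vspace 'rV[R]_N} :=
  <<[seq x - y | x <- s, y <- s]>>%VS.

(* The rows of an n x N matrix encode an n-tuple of vectors of R^N. *)
Definition rows_in (R : realType) (N n : nat) (D : {vspace 'rV[R]_N})
    (M : 'M[R]_(n, N)) : Prop :=
  forall i, row i M \in D.

Definition frame (R : realType) (N n : nat) (D : {vspace 'rV[R]_N})
    (M : 'M[R]_(n, N)) : Prop :=
  basis_of D [seq row i M | i <- enum 'I_n].

(* [w] restricts to an alternating n-linear form on [D]; its values on tuples
   of vectors that are not in [D] are irrelevant. *)
Definition nform_on (R : realType) (N n : nat) (D : {vspace 'rV[R]_N})
    (w : 'M[R]_(n, N) -> R) : Prop :=
  (forall (i : 'I_n) (M A B : 'M[R]_(n, N)) (b c : R),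
      rows_in D M -> rows_in D A -> rows_in D B ->
      row i M = b *: row i A + c *: row i B ->
      row' i A = row' i M -> row' i B = row' i M ->
      w M = b * w A + c * w B) /\
  (forall (i j : 'I_n) (M : 'M[R]_(n, N)), rows_in D M ->
      i != j -> row i M = row j M -> w M = 0).

Definition nonzero_on (R : realType) (N n : nat) (D : {vspace 'rV[R]_N})
    (w : 'M[R]_(n, N) -> R) : Prop :=
  exists2 M, rows_in D M & w M != 0.

(* An orientation of the n-dimensional space [D] as a sign on its frames. *)
Definition space_orientation (R : realType) (N n : nat)
    (D : {vspace 'rV[R]_N}) (o : 'M[R]_(n, N) -> R) : Prop :=
  forall M, frame D M ->
    (o M = 1 \/ o M = -1) /\
    forall A : 'M[R]_n, A \in unitmx -> o (A *m M) = Num.sg (\det A) * o M.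

Definition edges_from (R : realType) (N n : nat) (a : 'rV[R]_N)
    (X : 'M[R]_(n, N)) : 'M[R]_(n, N) :=
  \matrix_(i < n) (row i X - a).

Definition simplex_in (R : realType) (N n : nat) (P : set 'rV[R]_N)
    (s : {fset 'rV[R]_N}) : Prop :=
  is_simplex n s /\ hull s `<=` P.

(* An orientation of a PL n-manifold [P], independently of any triangulation:
   all affine n-simplices contained in [P] are oriented, compatibly with
   inclusion, and so that two of them meeting exactly in a common
   (n-1)-face r induce opposite orientations on r. For the last point the rows
   of X are the vertices of r, in any order: the orientations of (a, X) and
   (b, X) as ordered simplices induce the same orientation on r. *)
Record pl_orientation (R : realType) (N n : nat) (P : set 'rV[R]_N)
    (o : {fset 'rV[R]_N} -> 'M[R]_(n, N) -> R) : Prop := {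
  orientation_simplex : forall s, simplex_in n P s ->
    space_orientation (tangent s) (o s);
  orientation_sub : forall s t, simplex_in n P s -> simplex_in n P t ->
    hull s `<=` hull t ->
    forall M, frame (tangent s) M -> o s M = o t M;
  orientation_coherent : forall (a b : 'rV[R]_N) (X : 'M[R]_(n, N)),
    (0 < n)%N ->
    let r := [fset row i X | i in 'I_n]%fset in
    let s := (a |` r)%fset in
    let t := (b |` r)%fset in
    simplex_in n P s -> simplex_in n P t -> hull s `&` hull t = hull r ->
    o s (edges_from a X) = - o t (edges_from b X) }.

Record pc_form (R : realType) (N n : nat) := PCForm {
  support_complex : set {fset 'rV[R]_N};
  form_on : {fset 'rV[R]_N} -> 'M[R]_(n, N) -> R }.

Definition induces_orientation (R : realType) (N n : nat) (W : pc_form R N n)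
    (o : {fset 'rV[R]_N} -> 'M[R]_(n, N) -> R) : Prop :=
  forall s, n_simplices n (support_complex W) s ->
    forall M, frame (tangent s) M -> o s M = Num.sg (form_on W s M).

Definition pc_volume_form (R : realType) (N n : nat) (P : set 'rV[R]_N)
    (W : pc_form R N n) : Prop :=
  [/\ triangulation P (support_complex W),
      forall s, n_simplices n (support_complex W) s ->
        nform_on (tangent s) (form_on W s) /\
        nonzero_on (tangent s) (form_on W s) &
      exists o, pl_orientation P o /\ induces_orientation W o].

(* The integral of a constant n-form w over the n-simplex with vertices
   v_0, ..., v_n is w(v_1 - v_0, ..., v_n - v_0) / n! if these edges are
   positively oriented and the opposite otherwise; this does not depend on the
   order in which the vertices are enumerated. *)
Definition simplex_integral (R : realType) (N n : nat)
    (o w : 'M[R]_(n, N) -> R) (s : {fset 'rV[R]_N}) : R :=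
  let E := \matrix_(i < n) (nth 0 s i.+1 - nth 0 s 0) in
  o E * w E / n`!%:R.

Definition total_volume (R : realType) (N n : nat)
    (o : {fset 'rV[R]_N} -> 'M[R]_(n, N) -> R) (W : pc_form R N n) : R :=
  \sum_(s \in n_simplices n (support_complex W))
    simplex_integral (o s) (form_on W s) s.

Definition carrier (R : realType) (N n : nat) (K : set {fset 'rV[R]_N})
    (t : {fset 'rV[R]_N}) : {fset 'rV[R]_N} :=
  xget fset0 [set s | n_simplices n K s /\ hull t `<=` hull s].

Definition induced_form (R : realType) (N n : nat)
    (K' : set {fset 'rV[R]_N}) (W : pc_form R N n) : pc_form R N n :=
  PCForm K' (fun t => form_on W (carrier n (support_complex W) t)).

(* Only the values of the chosen matrix on tangent vectors matter; these are
   determined by [h]. *)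
Definition linear_part (R : realType) (N m : nat) (h : 'rV[R]_N -> 'rV[R]_m)
    (s : {fset 'rV[R]_N}) : 'M[R]_(N, m) :=
  xget 0 [set A | affine_with h s A].

Definition image_simplex (R : realType) (N m : nat) (h : 'rV[R]_N -> 'rV[R]_m)
    (s : {fset 'rV[R]_N}) : {fset 'rV[R]_m} :=
  [fset h v | v in s]%fset.

(* [W] lives on the target complex K'' of h : K' -> K''. *)
Definition pullback (R : realType) (N m n : nat) (K' : set {fset 'rV[R]_N})
    (h : 'rV[R]_N -> 'rV[R]_m) (W : pc_form R m n) : pc_form R N n :=
  PCForm K' (fun s M => form_on W (image_simplex h s) (M *m linear_part h s)).

Definition same_form (R : realType) (N n : nat) (W W' : pc_form R N n) : Prop :=
  support_complex W = support_complex W' /\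
  forall s, n_simplices n (support_complex W) s ->
    forall M, rows_in (tangent s) M -> form_on W s M = form_on W' s M.

Definition pl_equivalent (R : realType) (N n : nat)
    (W1 W2 : pc_form R N n) : Prop :=
  exists (K' K'' : set {fset 'rV[R]_N}) (h : 'rV[R]_N -> 'rV[R]_N),
    [/\ subdivides K' (support_complex W2),
        subdivides K'' (support_complex W1),
        pl_homeo K' K'' h &
        same_form (pullback K' h (induced_form K'' W1)) (induced_form K' W2)].

(* Main.v *)
(* After passing to a common subdivision K, the two forms are w and c w for a
   positive weight c, constant on each n-simplex, because both orientations
   agree: their relative sign is locally constant on the connected manifold and
   the total volumes are equal. So only the volumes of the n-simplices of K
   differ, and it suffices to move an amount of volume from one n-simplex to
   another while keeping all volumes positive.

   For n-simplices a r and b r sharing a facet r with barycenter m, star K at m,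
   and consider the path a, m, b. Subdividing the edge [m, b] at a point y or
   the edge [a, m] at a point x gives isomorphic complexes; the simplicial
   isomorphism y -> m -> x slides volume across r and is the identity elsewhere.
   A suitable choice of x and y realises any admissible transfer, by a
   computation with alternating forms. An orientation leaves at most two cofaces
   on each facet, and the absence of boundary makes the dual graph of K
   connected: two classes of n-simplices that share no facet meet only in
   codimension two, hence can be joined by a generic segment in a chart that
   avoids their intersection. Transfers therefore reach every pair of simplices.

   Compositions of PL maps are handled through finite covers by convex
   polyhedra, which are turned into triangulations by cutting along hyperplanes
   only at the end. That the total volume does not change under subdivision is
   proved by induction on the dimension: coning over the boundary, the
   contributions of the interior facets cancel. *)

Require Import Defs.
From HB Require Import structures.
From mathcomp Require Import all_boot all_order all_algebra fingroup perm finmap.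
From mathcomp Require Import all_classical all_reals all_analysis.
From mathcomp Require Import ring lra zify.

Set Implicit Arguments.
Unset Strict Implicit.
Unset Printing Implicit Defensive.

Import Order.TTheory GRing.Theory Num.Theory.
Import numFieldNormedType.Exports.

Local Open Scope classical_set_scope.
Local Open Scope ring_scope.

(** * Barycentric coordinates *)

(** The definitions speak of locally finite triangulations, of integrals given by a formula and of
    boundary points seen through charts, while the construction needs finite combinatorics.
    Compactness makes every triangulation finite, and a finite complex is then encoded by one
    property: the barycentric coordinates of a point, extended by zero, do not depend on the simplex
    used to compute them. Subdivisions, images and simplicial maps are all controlled through this
    uniqueness. Volumes are compared without any measure, through determinants of matrices of
    barycentric coordinates, so that adding up the pieces of a simplex becomes linear algebra plus a
    count of cofaces. A transfer across a facet has no free parameter: the two outer pieces of the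
    path dictate the positions of x and y, and the middle piece then matches exactly because an
    orientation gives opposite signs to the two sides of the facet. Dimension zero has no facets to
    move volume across and is settled separately. *)

Section Barycentric.
Context (R : realType) (N : nat).
Local Notation T := 'rV[R]_N.
Implicit Types (s t r : {fset T}) (a b : T -> R) (x : T) (K L : set {fset T}).

(* Coordinates are normalised to vanish off [s], so that coordinates with
   respect to different simplices of a complex can be compared as functions. *)
Definition bary s a x :=
  [/\ forall v, 0 <= a v, forall v, v \notin s -> a v = 0,
      \sum_(v <- s) a v = 1 & x = \sum_(v <- s) a v *: v].

Definition inner s x := exists2 a, bary s a x & forall v, v \in s -> 0 < a v.

Lemma hull_bary s x : hull s x <-> exists a, bary s a x.
Proof.
split=> [[a [a0 a1 ->]]|[a [a0 _ a1 ->]]]; last by exists a; split.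
exists (fun v => if v \in s then a v else 0); split.
- by move=> v; case: ifP => // /a0.
- by move=> v /negbTE ->.
- by rewrite -a1; apply: eq_big_seq => v ->.
- by apply: eq_big_seq => v ->.
Qed.

Lemma big_fset_sup (V : nmodType) s t (F : T -> V) : (s `<=` t)%fset ->
  (forall v, v \notin s -> F v = 0) -> \sum_(v <- s) F v = \sum_(v <- t) F v.
Proof. by move=> st F0; apply: big_fset_incl => // v _ /F0. Qed.

Lemma bary_sup s t a x : (s `<=` t)%fset -> bary s a x -> bary t a x.
Proof.
move=> st [a0 as0 a1 ->]; split=> //.
- by move=> v vt; apply: as0; apply: contra vt; apply/fsubsetP.
- by rewrite -a1; apply/esym/big_fset_sup.
- by apply: big_fset_sup => // v /as0 ->; rewrite scale0r.
Qed.

Lemma bary_restrict s t a x : (forall v, a v != 0 -> v \in s) ->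
  bary t a x -> bary s a x.
Proof.
move=> sa; have a0 v : v \notin s -> a v = 0.
  by move=> vs; apply/eqP; apply: contraNT vs => /sa.
move=> /(bary_sup (fsubsetUr s t)) [ap _ a1 ax]; split=> //.
- by rewrite -a1; apply: big_fset_sup; rewrite ?fsubsetUl.
- rewrite ax; apply/esym; apply: big_fset_sup; rewrite ?fsubsetUl //.
  by move=> v /a0 ->; rewrite scale0r.
Qed.

Lemma hull_sub s t : (s `<=` t)%fset -> hull s `<=` hull t.
Proof.
by move=> st x /hull_bary[a /(bary_sup st) ?]; apply/hull_bary; exists a.
Qed.

Lemma bary_vertex s v : v \in s -> bary s (fun u => (u == v)%:R) v.
Proof.
move=> vs; have vs1 : ([fset v] `<=` s)%fset by rewrite fsub1set.
apply: (bary_sup vs1); split.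
- by move=> u.
- by move=> u; rewrite inE => /negbTE ->.
- by rewrite big_seq_fset1 eqxx.
- by rewrite big_seq_fset1 eqxx scale1r.
Qed.

Lemma hull_vertex s v : v \in s -> hull s v.
Proof. by move=> vs; apply/hull_bary; eexists; exact: bary_vertex. Qed.

Lemma bary_exn0 s a x : bary s a x -> exists2 v, v \in s & 0 < a v.
Proof.
move=> [a0 _ a1 _]; apply: contrapT => h.
suff : \sum_(v <- s) a v = 0 by rewrite a1 => /eqP; rewrite oner_eq0.
rewrite big1_seq // => v /andP[_ vs]; apply/eqP; apply: contrapT => /negP av.
by apply: h; exists v => //; rewrite lt_neqAle eq_sym av a0.
Qed.

(** Coordinates of coordinates multiply like matrices. The explicit function, not only membership in
    the hull, is what stellar subdivision and coordinate matrices rely on. *)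
Lemma bary_comb s t (c : T -> R) (B : T -> T -> R) x : bary t c x ->
  (forall u, u \in t -> bary s (B u) u) ->
  bary s (fun v => \sum_(u <- t) c u * B u v) x.
Proof.
move=> [c0 _ c1 cx] Bs; split.
- move=> v; rewrite big_seq; apply: sumr_ge0 => u ut.
  by rewrite mulr_ge0 //; case: (Bs u ut).
- move=> v vs; rewrite big1_seq // => u /andP[_ ut].
  by case: (Bs u ut) => _ -> //; rewrite mulr0.
- rewrite exchange_big /= -c1; apply: eq_big_seq => u ut.
  by rewrite -mulr_sumr; case: (Bs u ut) => _ _ -> _; rewrite mulr1.
- under eq_bigr do rewrite scaler_suml.
  rewrite exchange_big /= cx; apply: eq_big_seq => u ut.
  case: (Bs u ut) => _ _ _ ux; transitivity (c u *: \sum_(v <- s) B u v *: v).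
    by rewrite -ux.
  rewrite scaler_sumr; by apply: eq_bigr => v _; rewrite scalerA.
Qed.

Lemma hull_convex s t : (forall v, v \in t -> hull s v) -> hull t `<=` hull s.
Proof.
move=> h x /hull_bary[c cx].
have /choice[B Bs] : forall u, exists a, u \in t -> bary s a u.
  move=> u; case: (boolP (u \in t)) => [/h/hull_bary[a ?]|_]; first by exists a.
  by exists (fun=> 0).
apply/hull_bary; eexists; exact: (bary_comb cx Bs).
Qed.

Definition barycenter s : T := \sum_(v <- s) (#|` s|%:R)^-1 *: v.

Lemma bary_barycenter s : s != fset0 ->
  bary s (fun v => if v \in s then (#|` s|%:R)^-1 else 0) (barycenter s).
Proof.
move=> s0; have c0 : (#|` s|%:R : R) != 0 by rewrite pnatr_eq0 cardfs_eq0.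
split.
- by move=> v; case: ifP => // _; rewrite invr_ge0 ler0n.
- by move=> v /negbTE ->.
- rewrite (eq_big_seq (fun=> (#|` s|%:R)^-1)); last by move=> v ->.
  by rewrite big_const_seq count_predT iter_addr_0 -(mulr_natr _^-1) mulVf.
- by apply: eq_big_seq => v ->.
Qed.

Lemma inner_barycenter s : s != fset0 -> inner s (barycenter s).
Proof.
move=> s0; eexists; first exact: bary_barycenter.
by move=> v /= ->; rewrite invr_gt0 ltr0n lt0n cardfs_eq0.
Qed.

(** [geo_uniq] does the work of two axioms: for [s = t] it is affine independence, and for different
    simplices it forces two hulls to meet exactly in the hull of their common vertices. *)
Record geo K : Prop := {
  geo_fin : finite_set K;
  geo_neq0 : forall s, K s -> s != fset0;
  geo_face : forall s t, K s -> (t `<=` s)%fset -> t != fset0 -> K t;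
  geo_uniq : forall s t a b x, K s -> K t -> bary s a x -> bary t b x -> a = b }.

Definition indep s := forall a b x, bary s a x -> bary s b x -> a = b.

(** Two coordinate functions of one point differ by an affine relation. Conversely, a small multiple
    of an affine relation can be added to the coordinates of the barycenter, which are all positive,
    and uniqueness kills it. *)
Lemma affinely_indepP s : affinely_independent s <->  indep s.
Proof.
split=> [sI a b x [a0 as0 a1 ax] [b0 bs0 b1 bx]|sI a a0 ax v vs].
  apply/funext => v; have [vs|vs] := boolP (v \in s); last by rewrite as0 ?bs0.
  apply/eqP; rewrite -subr_eq0; apply/eqP/(sI (fun v => a v - b v)) => //.
    by rewrite sumrB a1 b1 subrr.
  by under eq_bigr do rewrite scalerBl; rewrite sumrB -ax -bx subrr.
have s0 : s != fset0 by apply/fset0Pn; exists v.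
have cs0 : (0 : R) < #|` s|%:R by rewrite ltr0n lt0n cardfs_eq0.
pose c u := if u \in s then (#|` s|%:R)^-1 else 0 : R.
(* [M] dominates every [|a u|], so the perturbation [e * a u] is bounded by the common coordinate of
   the barycenter and no coordinate becomes negative; the summand 1 keeps [M] positive. *)
pose M := 1 + \sum_(u <- s) `|a u|.
have M0 : 0 < M by rewrite ltr_pwDl // sumr_ge0.
pose e := (#|` s|%:R)^-1 / M.
have e0 : 0 < e by rewrite divr_gt0 // invr_gt0.
have Bc := bary_barycenter s0; have [c0 cs c1 cx] := Bc.
pose c' u := if u \in s then c u + e * a u else 0.
have c'E u : u \in s -> c' u = c u + e * a u by rewrite /c' => ->.
have Bc' : bary s c' (barycenter s).
  split.
  - move=> u; rewrite /c'; case: ifP => // us; rewrite /c us.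
    have : `|a u| <= M.
      rewrite /M (big_fsetD1 u) //= addrCA lerDl addr_ge0 // sumr_ge0 //.
    rewrite -(ler_pM2l e0) /e mulfVK ?gt_eqF // -/e.
    have := ler_norm (- (e * a u)); rewrite normrN normrM (gtr0_norm e0).
    by lra.
  - by move=> u; rewrite /c' => /negbTE ->.
  - rewrite (eq_big_seq _ c'E) big_split /= c1 -mulr_sumr a0.
    by rewrite mulr0 addr0.
  - rewrite (eq_big_seq (fun u => c u *: u + e *: (a u *: u))); last first.
      by move=> u us; rewrite c'E // scalerDl scalerA.
    by rewrite big_split /= -cx -scaler_sumr ax scaler0 addr0.
have /(congr1 (fun f => f v)) := sI _ _ _ Bc Bc'.
rewrite c'E // /c vs => h; have /eqP : e * a v = 0 by lra.
by rewrite mulf_eq0 (gt_eqF e0) => /eqP.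
Qed.

Lemma geo_indep K s : geo K -> K s -> indep s.
Proof. by move=> gK Ks a b x; exact: (geo_uniq gK Ks Ks). Qed.

Lemma geo_inner_sub K s t x : geo K -> K s -> K t -> inner s x -> hull t x ->
  (s `<=` t)%fset.
Proof.
move=> gK Ks Kt [a ax ap] /hull_bary[b bx].
have ab := geo_uniq gK Ks Kt ax bx; apply/fsubsetP => v /ap.
by rewrite ab; case: bx => _ bt _ _; apply: contraLR => /bt ->; rewrite ltxx.
Qed.

Lemma bary_support s a x : bary s a x ->
  exists t, [/\ (t `<=` s)%fset, t != fset0, bary t a x &
                forall v, v \in t -> 0 < a v].
Proof.
move=> sx; have [a0 as0 _ _] := sx; exists [fset v in s | 0 < a v]%fset.
have memt v : 0 < a v -> v \in [fset v in s | 0 < a v]%fset.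
  move=> av; rewrite !inE /= av andbT; apply: contraLR av => /as0 ->.
  by rewrite ltxx.
split.
- by apply: fset_sub.
- have [v vs av] := bary_exn0 sx; apply/fset0Pn; exists v; exact: memt.
- apply: bary_restrict sx => v av; apply: memt.
  by rewrite lt_neqAle eq_sym av a0.
- by move=> v; rewrite !inE => /andP[].
Qed.

Lemma geo_support K s x : geo K -> K s -> hull s x ->
  exists t, [/\ K t, (t `<=` s)%fset & inner t x].
Proof.
move=> gK Ks /hull_bary[a /bary_support[t [ts t0 tx tp]]].
by exists t; split; [exact: geo_face gK _ _ Ks ts t0|done|exists a].
Qed.

Lemma geo_meet K s t x : geo K -> K s -> K t -> hull s x -> hull t x ->
  hull (s `&` t)%fset x.
Proof.
move=> gK Ks Kt /hull_bary[a sx] /hull_bary[b tx].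
have ab := geo_uniq gK Ks Kt sx tx; rewrite -ab in tx.
apply/hull_bary; exists a; apply: (bary_restrict _ sx) => v av; rewrite inE.
have [_ as0 _ _] := sx; have [_ at0 _ _] := tx.
apply/andP; split; first by apply: contraNT av => /as0 ->.
by apply: contraNT av => /at0 ->.
Qed.

Lemma hull0 : hull (fset0 : {fset T}) = set0.
Proof.
apply/seteqP; split=> // x /hull_bary[a /bary_exn0[v]]; by rewrite inE.
Qed.

Lemma hull_neq0 s : s != fset0 -> hull s !=set0.
Proof. by case/fset0Pn => v vs; exists v; exact: hull_vertex. Qed.

Lemma geo_complex K : geo K -> simplicial_complex K.
Proof.
move=> gK; split.
- move=> s Ks; exists #|` s|.-1; split.
    by apply/affinely_indepP; exact: geo_indep gK Ks.
  by rewrite prednK // lt0n cardfs_eq0; exact: geo_neq0 gK _ Ks.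
- by move=> s t Ks; exact: geo_face.
- move=> s t Ks Kt; have [st0|st0] := eqVneq (s `&` t)%fset fset0.
    left; apply/seteqP; split=> // x [sx tx].
    by have := geo_meet gK Ks Kt sx tx; rewrite st0 hull0.
  right; exists (s `&` t)%fset; rewrite fsubsetIl fsubsetIr; split=> //.
    exact: geo_face gK _ _ Ks (fsubsetIl _ _) st0.
  apply/seteqP; split=> [x [sx tx]|x stx]; first exact: geo_meet gK Ks Kt sx tx.
  by split; apply: hull_sub stx; rewrite ?fsubsetIl ?fsubsetIr.
- move=> x _; exists setT; first exact: filterT.
  by apply: sub_finite_set (geo_fin gK) => s [].
Qed.

Lemma complex_geo K : finite_set K -> simplicial_complex K -> geo K.
Proof.
move=> fK cK; have sI s : K s -> indep s.
  by move=> /(complex_simplex cK)[n [/affinely_indepP]].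
split=> //.
- move=> s /(complex_simplex cK)[n [_ sn]]; by rewrite -cardfs_eq0 sn.
- exact: complex_face cK.
- move=> s t a b x Ks Kt sx tx.
  have stx : (hull s `&` hull t) x by split; apply/hull_bary; [exists a|exists b].
  case: (complex_meet cK Ks Kt) => [st0|[r [_ rs rt st]]].
    by move: stx; rewrite st0.
  move: stx; rewrite st => /hull_bary[c rx].
  have -> := sI _ Ks _ _ _ sx (bary_sup rs rx).
  by rewrite (sI _ Kt _ _ _ tx (bary_sup rt rx)).
Qed.

Definition refines K L := forall s, K s -> exists2 t, L t & hull s `<=` hull t.

Lemma refines_trans K L (M : set {fset T}) : refines K L -> refines L M -> refines K M.
Proof.
move=> KL LM s /KL[t /LM[u Mu tu] st]; exists u => //; exact: subset_trans st tu.
Qed.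

Lemma refines_refl K : refines K K.
Proof. by move=> s Ks; exists s. Qed.

End Barycentric.

(** * Affine functionals and polyhedra *)

Section Affine.
Context (R : realType) (N : nat).
Local Notation T := 'rV[R]_N.
Implicit Types (s t r : {fset T}) (a b : T -> R) (x : T) (K L : set {fset T}).

Lemma continuous_bigsum (V : normedModType R) (U : topologicalType) (I : Type)
    (l : seq I) (F : I -> U -> V) : (forall i, continuous (F i)) ->
  continuous (fun y => \sum_(i <- l) F i y).
Proof.
move=> cF; elim: l => [|i l IH] y.
  by under eq_fun do rewrite big_nil; exact: cvg_cst.
under eq_fun do rewrite big_cons.
by apply: cvgD; [exact: cF|exact: IH].
Qed.

Lemma amap_continuous m (A : 'M[R]_(N, m)) (b : 'rV[R]_m) :
  continuous (fun x : T => x *m A + b).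
Proof.
have -> : (fun x : T => x *m A + b) =
    (fun x : T => \sum_(j <- None :: map Some (index_enum 'I_N))
       (if j is Some i then x 0 i *: row i A else b)).
  by apply/funext => x; rewrite big_cons big_map mulmx_sum_row addrC.
apply: continuous_bigsum => -[j|]; last exact: cst_continuous.
have cj : continuous (fun x : T => x 0 j) by exact: coord_continuous.
by move=> x; exact: (cvgZr_tmp (cj x)).
Qed.

Definition afn : Type := ('cV[R]_N * R)%type.
Definition ev (f : afn) x : R := (x *m f.1) 0 0 + f.2.
Definition affine (F : T -> R) := exists f, ev f =1 F.

Lemma affine_cst k : affine (fun=> k).
Proof. by exists (0, k) => x; rewrite /ev mulmx0 mxE add0r. Qed.

Lemma affine_coord j : affine (fun x => x 0 j).
Proof.
exists (delta_mx j 0, 0) => x; rewrite /ev addr0 mxE (bigD1 j) //= mxE !eqxx mulr1.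
by rewrite big1 ?addr0 // => i /negbTE ij; rewrite mxE ij mulr0.
Qed.

Lemma affineD F G : affine F -> affine G -> affine (fun x => F x + G x).
Proof.
move=> [f fF] [g gG]; exists (f.1 + g.1, f.2 + g.2) => x.
by rewrite -fF -gG /ev mulmxDr mxE /= addrACA.
Qed.

Lemma affineZ k F : affine F -> affine (fun x => k * F x).
Proof.
move=> [f fF]; exists (k *: f.1, k * f.2) => x.
by rewrite -fF /ev -scalemxAr mxE /= mulrDr.
Qed.

Lemma affineN F : affine F -> affine (fun x => - F x).
Proof. by move=> /(affineZ (-1)) [f fF]; exists f => x; rewrite fF mulN1r. Qed.

Lemma affine_sum (I : Type) (l : seq I) (F : I -> T -> R) :
  (forall i, affine (F i)) -> affine (fun x => \sum_(i <- l) F i x).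
Proof.
move=> aF; elim: l => [|i l IH].
  by have [f fE] := affine_cst 0; exists f => x; rewrite fE big_nil.
by have [f fE] := affineD (aF i) IH; exists f => x; rewrite fE big_cons.
Qed.

Lemma ev_sum (l : seq T) (c : T -> R) f : \sum_(v <- l) c v = 1 ->
  ev f (\sum_(v <- l) c v *: v) = \sum_(v <- l) c v * ev f v.
Proof.
move=> c1; rewrite /ev mulmx_suml summxE -[f.2 in LHS]mul1r -c1 mulr_suml -big_split.
by apply: eq_bigr => v _; rewrite -scalemxAl mxE mulrDr.
Qed.

Lemma ev_bary f s a x : bary s a x -> ev f x = \sum_(v <- s) a v * ev f v.
Proof. by move=> [_ _ a1 ->]; exact: ev_sum. Qed.

Lemma ev_mix f k x y : ev f ((1 - k) *: x + k *: y) = (1 - k) * ev f x + k * ev f y.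
Proof.
rewrite /ev mulmxDl -!scalemxAl; move: (x *m f.1) (y *m f.1) => p q.
by rewrite !mxE; ring.
Qed.

Lemma ev_hull_ge0 f s : (forall v, v \in s -> 0 <= ev f v) ->
  forall x, hull s x -> 0 <= ev f x.
Proof.
move=> fs x /hull_bary[a sx]; rewrite (ev_bary f sx) big_seq.
by apply: sumr_ge0 => v vs; rewrite mulr_ge0 ?fs //; case: sx.
Qed.

Lemma affine_amap (A : 'M[R]_N) (b : T) f : affine (fun x => ev f (x *m A + b)).
Proof.
exists (A *m f.1, ev f b) => x; rewrite /ev /= mulmxA mulmxDl [in RHS]mxE.
by rewrite addrA.
Qed.

Definition opp_afn (f : afn) : afn := (- f.1, - f.2).

Lemma ev_opp f x : ev (opp_afn f) x = - ev f x.
Proof. by rewrite /ev mulmxN mxE opprD. Qed.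

Definition poly (fs : seq afn) : set T := [set x | forall f, f \in fs -> 0 <= ev f x].

Lemma poly_cat fs gs x : poly (fs ++ gs) x <-> poly fs x /\ poly gs x.
Proof.
split=> [h|[h1 h2] f]; last by rewrite mem_cat => /orP[/h1|/h2].
by split=> f ffs; apply: h; rewrite mem_cat ffs ?orbT.
Qed.

Lemma poly_eqs (I : finType) (F : I -> T -> R) : (forall i, affine (F i)) ->
  exists fs, poly fs = [set x | forall i, F i x = 0].
Proof.
move=> /choice[f fE]; pose fs := [seq f i | i <- enum I].
exists (fs ++ map opp_afn fs); apply/seteqP; split=> x.
  move=> /poly_cat[h1 h2] i.
  have fi : f i \in fs by rewrite map_f ?mem_enum.
  have := h1 _ fi; have := h2 _ (map_f opp_afn fi).
  by rewrite ev_opp fE oppr_ge0 => ? ?; apply/eqP; rewrite eq_le; apply/andP.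
move=> h; apply/poly_cat; split=> g.
  by move=> /mapP[i _ ->]; rewrite fE h.
by move=> /mapP[? /mapP[i _ ->] ->]; rewrite ev_opp fE h oppr0.
Qed.

Lemma indep_coords s : indep s -> exists l : T -> afn, forall c x,
  \sum_(v <- s) c v = 1 -> x = \sum_(v <- s) c v *: v ->
  forall v, v \in s -> ev (l v) x = c v.
Proof.
move=> /affinely_indepP sI.

have us : uniq s by exact: fset_uniq.
pose S : 'M[R]_(size s, N) := \matrix_(i < size s) s`_i.
pose M := row_mx S (const_mx 1 : 'cV_(size s)).
have sumE (V : nmodType) (F : T -> V) :
    \sum_(v <- s) F v = \sum_(i < size s) F s`_i by rewrite (big_nth 0) big_mkord.
have idx (i : 'I_(size s)) : index s`_i s = i by rewrite index_uniq.
have SE (u : 'rV_(size s)) (a : T -> R) : (forall i, u 0 i = a s`_i) ->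
    u *m S = \sum_(v <- s) a v *: v.
  move=> ua; rewrite mulmx_sum_row sumE.
  by apply: eq_bigr => i _; rewrite rowK ua.
have OE (u : 'rV_(size s)) (a : T -> R) : (forall i, u 0 i = a s`_i) ->
    u *m (const_mx 1 : 'cV_(size s)) = (\sum_(v <- s) a v)%:M.
  move=> ua; apply/rowP => j; rewrite !ord1 mxE sumE [RHS]mxE eqxx mulr1n.
  by apply: eq_bigr => i _; rewrite !mxE mulr1 ua.
have /row_freeP[B MB] : row_free M.
  apply: inj_row_free => u; rewrite mul_mx_row => /eqP; rewrite row_mx_eq0.
  move=> /andP[/eqP uS /eqP u1].
  pose a v := if insub (index v s) is Some i then u 0 i else 0.
  have aE i : u 0 i = a s`_i by rewrite /a idx valK.
  have a0 : \sum_(v <- s) a v = 0.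
    by move: u1; rewrite (OE _ _ aE) => /rowP/(_ 0); rewrite !mxE eqxx mulr1n.
  have ax : \sum_(v <- s) a v *: v = 0 by rewrite -(SE _ _ aE).
  apply/rowP => i; rewrite mxE aE; apply: sI a0 ax _ _.
  by apply: mem_nth.
exists (fun v => if insub (index v s) is Some i
  then (col i (usubmx B), dsubmx B 0 i) else (0, 0)) => c x c1 cx v vs.
have iv : (index v s < size s)%N by rewrite index_mem.
rewrite (insubT (fun k => (k < size s)%N) iv) /=; set i : 'I_(size s) := Sub _ _.
have -> : c v = (row_mx x 1%:M *m B) 0 i.
  have -> : row_mx x 1%:M = (\row_i c s`_i) *m M.
    rewrite mul_mx_row (SE _ c) ?(OE _ c) ?c1 -?cx // => j; by rewrite mxE.
  by rewrite -mulmxA MB mulmx1 mxE /= nth_index.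
rewrite -[B in RHS]vsubmxK mul_row_col mul1mx mxE /ev /=.
by rewrite colE mulmxA -colE !mxE.
Qed.

Lemma indep_coords_bary s : indep s -> exists l : T -> afn,
  forall a x, bary s a x -> forall v, v \in s -> ev (l v) x = a v.
Proof.
move=> /indep_coords[l lE]; exists l => a x [_ _ a1 ax]; exact: lE.
Qed.

Lemma hull_poly s : indep s -> exists fs, poly fs = hull s.
Proof.
move=> sI; have [l lE] := indep_coords_bary sI.
(* The equations say that [x] is the combination of the vertices with weights [ev (l v) x] and that
   these sum to 1; they cut out the affine span of [s]. The inequalities added below then cut out
   the hull. *)
pose F (i : option 'I_N) x := if i is Some j then x 0 j - \sum_(v <- s) v 0 j * ev (l v) x
  else \sum_(v <- s) ev (l v) x - 1.
have aF i : affine (F i).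
  case: i => [j|] /=; (apply: affineD; last first).
  - apply: affineN; apply: affine_sum => v; apply: affineZ; by exists (l v).
  - exact: affine_coord.
  - by apply: affineN; exact: affine_cst.
  - by apply: affine_sum => v; exists (l v).
have [fs fsE] := poly_eqs aF.
exists (fs ++ [seq l v | v <- s]); apply/seteqP; split=> x.
  move=> /poly_cat[]; rewrite fsE => /= h1 h2.
  exists (fun v => ev (l v) x); split.
  - by move=> v vs; apply: h2; exact: map_f.
  - by have /= := h1 None; lra.
  - apply/rowP => j; have /= := h1 (Some j) => /eqP; rewrite subr_eq0 => /eqP ->.
    rewrite summxE; apply: eq_bigr => v _; by rewrite mxE mulrC.
move=> /hull_bary[a sx]; have [a0 _ a1 ax] := sx; apply/poly_cat; split.
  rewrite fsE => -[j|] /=; last first.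
    rewrite (eq_big_seq a); last by move=> v; exact: lE.
    by rewrite a1 subrr.
  rewrite {1}ax summxE -sumrB big1_seq // => v /andP[_ vs].
  by rewrite mxE (lE _ _ sx) // mulrC subrr.
by move=> f /mapP[v vs ->]; rewrite (lE _ _ sx).
Qed.

Lemma indep_amap s (w : T -> T) : indep s -> exists (A : 'M[R]_N) (b : T),
  forall a x, bary s a x -> x *m A + b = \sum_(v <- s) a v *: w v.
Proof.
move=> /indep_coords_bary[l lE].
exists (\sum_(v <- s) (l v).1 *m w v), (\sum_(v <- s) (l v).2 *: w v) => a x sx.
rewrite mulmx_sumr -big_split; apply: eq_big_seq => v vs /=.
rewrite -(lE _ _ sx) // /ev scalerDl; congr (_ + _).
by rewrite mulmxA -mul_scalar_mx -mx11_scalar.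
Qed.

Lemma ev_continuous f : continuous (ev f).
Proof.
have cg : continuous (fun x : T => x *m f.1 + const_mx f.2 : 'rV[R]_1).
  exact: amap_continuous.
have ch : continuous (fun y : 'rV[R]_1 => y 0 0) by exact: coord_continuous.
have -> : ev f = (fun y : 'rV[R]_1 => y 0 0) \o (fun x => x *m f.1 + const_mx f.2).
  by apply/funext => x; rewrite /ev /= [RHS]mxE [const_mx _ _ _]mxE.
by move=> x; apply: continuous_comp; [exact: cg|exact: ch].
Qed.

Lemma poly_closed fs : closed (poly fs).
Proof.
have -> : poly fs = \bigcap_(f in [set f | f \in fs]) (ev f @^-1` [set y | 0 <= y]).
  by apply/seteqP; split=> x h f; exact: h.
apply: closed_bigI => f _; apply: preimage_closed; last exact: closed_ge.
by move=> x _; exact: ev_continuous.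
Qed.

Lemma hull_closed s : indep s -> closed (hull s).
Proof. by move=> /hull_poly[fs <-]; exact: poly_closed. Qed.

End Affine.

(** * Stellar subdivision and common refinements *)

Section Stellar.
Context (R : realType) (N : nat).
Local Notation T := 'rV[R]_N.
Implicit Types (s t r : {fset T}) (a b : T -> R) (x w : T) (K L : set {fset T}).

(* The stellar subdivision at a point [w] of the relative interior of [s]. *)
Definition star_at K s w : set {fset T} :=
  [set t | ~~ (s `<=` t)%fset /\ (K t \/ w \in t /\ K ((t `\ w) `|` s)%fset)].

Section Star.
Context (K : set {fset T}) (s : {fset T}) (w : T).
Hypotheses (gK : geo K) (Ks : K s) (sw : inner s w) (s2 : (1 < #|` s|)%N).

(** The support of [w] is all of [s], at least two vertices, whereas the support of a vertex is a
    single point. *)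
Lemma star_new t : K t -> w \notin t.
Proof.
move=> Kt; apply/negP => wt; case: sw => c cw cp.
have cE := geo_uniq gK Ks Kt cw (bary_vertex wt).
have sub : (s `<=` [fset w])%fset.
  by apply/fsubsetP => v /cp; rewrite cE inE; case: eqP => //; rewrite ltxx.
by have := fsubset_leq_card sub; rewrite cardfs1; lia.
Qed.

Let c := xget (fun=> 0 : R) [set a | bary s a w].

Let cw : bary s c w.
Proof.
by rewrite /c; case: sw => a aw _; exact: (@xgetPex _ _ [set a | bary s a w] (ex_intro _ a aw)).
Qed.

Let cp v : v \in s -> 0 < c v.
Proof. by case: sw => a aw ap; rewrite (geo_uniq gK Ks Ks cw aw); exact: ap. Qed.

Let cN v : v \notin s -> c v = 0. Proof. by case: cw => _ h _ _; exact: h. Qed.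

(** Coordinates before the subdivision: the weight of [w] is redistributed over [s] according to the
    coordinates [c] of [w]. *)
Let old a v := if v == w then 0 else a v + a w * c v.

Let ws : w \notin s. Proof. exact: star_new. Qed.

Let old_bary t a x : star_at K s w t -> bary t a x ->
  exists2 u, K u & bary u (old a) x.
Proof.
move=> [_ [Kt|[wt Ku]]] tx.
  exists t => //; have [_ at0 _ _] := tx.
  suff -> : old a = a by [].
  apply/funext => v; rewrite /old (at0 w) ?star_new // mul0r addr0.
  by case: eqP => // ->; rewrite at0 ?star_new.
exists ((t `\ w) `|` s)%fset => //.
pose D (u : T) : T -> R := if u == w then c else fun v => (v == u)%:R.
have /(bary_comb tx) : forall u, u \in t -> bary ((t `\ w) `|` s)%fset (D u) u.
  move=> u ut; rewrite /D; case: (eqVneq u w) => [->|uw].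
    by apply: bary_sup cw; rewrite fsubsetUr.
  by apply: bary_vertex; rewrite !inE uw ut.
suff -> : (fun v => \sum_(u <- t) a u * D u v) = old a by [].
apply/funext => v; rewrite (big_fsetD1 w) //= /D eqxx addrC /old.
rewrite (eq_big_seq (fun u => a u * (v == u)%:R)); last first.
  by move=> u; rewrite !inE => /andP[/negbTE -> _].
have [->|vw] := eqVneq v w.
  rewrite cN // mulr0 addr0 big1_seq // => u /andP[_].
  by rewrite !inE eq_sym => /andP[/negbTE -> _]; rewrite mulr0.
congr (_ + _); have [vt|vt] := boolP (v \in t).
  rewrite (big_fsetD1 v) ?inE ?vw //= eqxx mulr1 big1_seq ?addr0 // => u.
  by rewrite !inE eq_sym => /andP[_ /andP[/negbTE -> _]]; rewrite mulr0.
have [_ -> // _ _] := tx; rewrite big1_seq // => u; rewrite !inE => /andP[_ /andP[_ ut]].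
by case: eqP => [vu|_]; [rewrite vu ut in vt|rewrite mulr0].
Qed.

(* The old coordinates determine the new ones: the weight of [w] is the
   largest multiple of [w] that can be split off. *)
Let old_inj t1 t2 a b x : star_at K s w t1 -> star_at K s w t2 ->
  bary t1 a x -> bary t2 b x -> a = b.
Proof.
have half t t' a' b' : star_at K s w t' -> bary t a' x -> bary t' b' x ->
    old a' = old b' -> a' w <= b' w.
  move=> [/fsubsetPn[v vs vt'] _] [a0 _ _ _] [b0 bt' _ _].
  move=> /(congr1 (fun f => f v)); rewrite /old (negbTE (_ : v != w)); last first.
    by apply: contraNneq ws => <-.
  by rewrite (bt' v) // add0r => e; rewrite -(ler_pM2r (cp vs)) -e lerDr.
move=> h1 h2 t1x t2x; have [u1 Ku1 o1] := old_bary h1 t1x.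
have [u2 Ku2 o2] := old_bary h2 t2x; have e := geo_uniq gK Ku1 Ku2 o1 o2.
have ew : a w = b w.
  by apply/eqP; rewrite eq_le (half _ _ _ _ h2 t1x t2x e) (half _ _ _ _ h1 t2x t1x) ?e.
apply/funext => v; have := congr1 (fun f => f v) e; rewrite /old.
by case: eqP => [->|_] //; rewrite ew => /addIr.
Qed.

Lemma geo_star : geo (star_at K s w).
Proof.
split.
- have fU : finite_set (K `|` [set fset0]).
    by rewrite finite_setU; split; [exact: geo_fin|exact: finite_set1].
  apply: (@sub_finite_set _ _ ((K `|` [set fset0]) `|` (fun t => w |` t)%fset @` (K `|` [set fset0]))).
    move=> t [st [Kt|[wt Ku]]]; first by left; left.
    right; exists (t `\ w)%fset; last by rewrite fsetD1K.
    have [->|t0] := eqVneq (t `\ w)%fset fset0; first by right.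
    by left; apply: (geo_face gK Ku _ t0); rewrite fsubsetUl.
  by rewrite finite_setU; split => //; exact: finite_image.
- move=> t [_ [Kt|[wt _]]]; first exact: geo_neq0 gK _ Kt.
  by apply/fset0Pn; exists w.
- move=> t u [st Kt] ut u0; split.
    by apply: contra st => /fsubset_trans; apply.
  case: Kt => [Kt|[wt Kt]]; first by left; exact: geo_face gK _ _ Kt ut u0.
  have [wu|wu] := boolP (w \in u).
    right; split=> //; apply: (geo_face gK Kt); first by rewrite fsetSU // fsetSD.
    by apply: contraNneq (geo_neq0 gK Ks) => h; rewrite -fsubset0 -h fsubsetUr.
  left; apply: (geo_face gK Kt) => //; apply/fsubsetP => v vu.
  rewrite !inE (fsubsetP ut) // andbT; apply/orP; left.
  by apply: contraNneq wu => <-.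
- move=> t1 t2 a b x; exact: old_inj.
Qed.

Lemma star_refines : refines (star_at K s w) K.
Proof.
move=> t [_ [Kt|[wt Ku]]]; first by exists t.
exists ((t `\ w) `|` s)%fset => //; apply: hull_convex => v vt.
have [->|vw] := eqVneq v w; last by apply: hull_vertex; rewrite !inE vw vt.
by apply: (hull_sub (fsubsetUr _ _)); apply/hull_bary; exists c.
Qed.

Lemma body_star : body (star_at K s w) = body K.
Proof.
apply/seteqP; split=> x [t]; first by move=> /star_refines[u Ku tu] /tu ux; exists u.
move=> Kt tx; have [st|st] := boolP (s `<=` t)%fset; last first.
  by exists t => //; split=> //; left.
have /hull_bary[a ax] := tx; have [a0 at0 a1 axE] := ax.
(* The minimal ratio [l] is the largest multiple of [w] that can be split off from [x] with all
   weights staying nonnegative. The weight of [v0] drops to 0, so [x] lies in the new simplex that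
   omits [v0]. *)
have [v0 v0s vmin] : exists2 v0, v0 \in s & forall v, v \in s -> a v0 / c v0 <= a v / c v.
  have /fset0Pn[v1 v1s] := geo_neq0 gK Ks.
  have [/= v0 _ vm] := @arg_minP _ R s [` v1s]%fset xpredT (fun v => a (val v) / c (val v)) isT.
  by exists (val v0); [exact: valP|move=> v vs; exact: (vm [` vs]%fset)].
set l := a v0 / c v0 in vmin.
have l0 : 0 <= l by rewrite divr_ge0 // ltW // cp.
pose b v := if v == w then l else a v - l * c v.
have wt : w \notin t by exact: star_new.
have v0w : v0 != w by apply: contraNneq ws => <-.
have v0t : v0 \in t by exact: (fsubsetP st).
have bw : b w = l by rewrite /b eqxx.
have bE v : v != w -> b v = a v - l * c v by rewrite /b => /negbTE ->.
have ct : bary t c w by exact: (bary_sup st).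
have [_ ct0 c1 cx] := ct.
have bb : bary (w |` t)%fset b x.
  split.
  - move=> v; rewrite /b; case: eqP => // _; have [vs|vs] := boolP (v \in s).
      by rewrite subr_ge0 -ler_pdivlMr ?cp // vmin.
    by rewrite cN // mulr0 subr0.
  - move=> v; rewrite !inE negb_or => /andP[vw vt].
    by rewrite bE // at0 // ct0 // mulr0 subr0.
  - rewrite big_fsetU1 //= bw (eq_big_seq (fun v => a v - l * c v)); last first.
      by move=> v vt; rewrite bE //; apply: contraNneq wt => <-.
    by rewrite sumrB -mulr_sumr a1 c1 mulr1 addrCA subrr addr0.
  - rewrite big_fsetU1 //= bw (eq_big_seq (fun v => a v *: v - l *: (c v *: v))); last first.
      move=> v vt; rewrite bE ?scalerBl ?scalerA //.
      by apply: contraNneq wt => <-.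
    by rewrite sumrB -scaler_sumr -axE -cx addrCA subrr addr0.
exists (w |` (t `\ v0))%fset.
  split; first by apply/fsubsetPn; exists v0; rewrite // !inE eqxx (negbTE v0w).
  right; rewrite !inE eqxx; split=> //.
  suff -> : ((w |` t `\ v0) `\ w `|` s)%fset = t by [].
  apply/fsetP => v; rewrite !inE; have [->|vw] := eqVneq v w.
    by rewrite (negbTE wt) (negbTE ws).
  have [->|vv] := eqVneq v v0; first by rewrite v0s v0t.
  by rewrite /=; case: (boolP (v \in s)) => [/(fsubsetP st) ->|]; rewrite ?orbT ?orbF.
apply/hull_bary; exists b; apply: (bary_restrict _ bb) => v.
rewrite !inE; have [//|vw] := eqVneq v w; rewrite bE //=.
have [->|vv] := eqVneq v v0.
  by rewrite /l divfK ?subrr ?eqxx // gt_eqF // cp.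
apply: contraNT => vt; rewrite at0 ?ct0 ?mulr0 ?subr0 //; exact: vt.
Qed.

End Star.

Lemma inner2 (u v : T) (k : R) : 0 < k -> k < 1 -> u != v ->
  inner [fset u; v]%fset ((1 - k) *: u + k *: v).
Proof.
move=> k0 k1 uv; have vu : v != u by rewrite eq_sym.
exists (fun z => if z == u then 1 - k else if z == v then k else 0).
  split.
  - by move=> z; case: ifP => _; [lra|case: ifP => _ //; exact: ltW].
  - by move=> z; rewrite !inE negb_or => /andP[/negbTE -> /negbTE ->].
  - by rewrite big_fsetU1 ?inE //= big_seq_fset1 eqxx (negbTE vu) eqxx; lra.
  - by rewrite big_fsetU1 ?inE //= big_seq_fset1 eqxx (negbTE vu) eqxx.
by move=> z; rewrite !inE => /orP[/eqP ->|/eqP ->]; rewrite ?eqxx ?(negbTE vu) ?eqxx //; lra.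
Qed.

Definition crossing (f : afn R N) K : set {fset T} :=
  [set e | K e /\ exists u v, [/\ e = [fset u; v]%fset, ev f u < 0 & 0 < ev f v]].

Lemma no_crossing f K : geo K -> (forall e, ~ crossing f K e) -> forall s, K s ->
  (forall x, hull s x -> 0 <= ev f x) \/ (forall x, hull s x -> ev f x <= 0).
Proof.
move=> gK noe s Ks; have [[u us fu]|nneg] := pselect (exists2 v, v \in s & ev f v < 0).
  right=> x /(@ev_hull_ge0 _ _ (opp_afn f)); rewrite ev_opp oppr_ge0; apply => v vs.
  rewrite ev_opp oppr_ge0 leNgt; apply/negP => fv.
  apply: (noe [fset u; v]%fset); split; last by exists u, v.
  apply: (geo_face gK Ks); last by apply/fset0Pn; exists u; rewrite !inE eqxx.
  by apply/fsubsetP => z; rewrite !inE => /orP[/eqP ->|/eqP ->].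
left; apply: ev_hull_ge0 => v vs; rewrite leNgt; apply/negP => fv.
by apply: nneg; exists v.
Qed.

(** Starring a crossing edge at the zero of [f] removes that edge, and no new edge crosses because
    [f] vanishes at the new vertex; so the number of crossing edges drops. *)
Lemma cut_one f K : geo K -> exists L, [/\ geo L, body L = body K, refines L K &
  forall s, L s -> (forall x, hull s x -> 0 <= ev f x) \/ (forall x, hull s x -> ev f x <= 0)].
Proof.
suff main (n : nat) (X : {fset {fset T}}) : (#|` X| <= n)%N -> forall K, geo K ->
    crossing f K `<=` [set` X] -> exists L, [/\ geo L, body L = body K, refines L K &
    forall s, L s -> (forall x, hull s x -> 0 <= ev f x) \/ (forall x, hull s x -> ev f x <= 0)].
  move=> gK; have fc : finite_set (crossing f K).
    by apply: sub_finite_set (geo_fin gK) => e [].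
  apply: (main _ (fset_set (crossing f K)) (leqnn _) K gK) => e.
  by rewrite /= in_fset_set // inE.
elim: n X => [|n IH] X Xn {}K gK cX.
  exists K; split=> //; [exact: refines_refl|apply: no_crossing => // e ce].
  by have := cX _ ce; rewrite /= (cardfs0_eq (eqP (_ : #|` X| == 0%N))) ?inE //; lia.
have [[e ce]|noe] := pselect (exists e, crossing f K e); last first.
  exists K; split=> //; [exact: refines_refl|apply: no_crossing => // e ce].
  by apply: noe; exists e.
have [Ke [u [v [eE fu fv]]]] := ce.
have uv : u != v by apply: contraTneq fu => ->; rewrite -leNgt ltW.
(* Solves [(1 - k) * ev f u + k * ev f v = 0]. *)
pose k := - ev f u / (ev f v - ev f u).
have d0 : 0 < ev f v - ev f u by lra.
have k0 : 0 < k by rewrite divr_gt0 // oppr_gt0.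
have k1 : k < 1 by rewrite ltr_pdivrMr // mul1r; lra.
set w := (1 - k) *: u + k *: v.
have ew : inner e w by rewrite eE; exact: inner2.
have e2 : (1 < #|` e|)%N by rewrite eE cardfs2 uv.
have fw : ev f w = 0.
  by rewrite ev_mix /k; field; rewrite gt_eqF.
have [L [gL bL rL sL]] : exists L, [/\ geo L, body L = body (star_at K e w),
    refines L (star_at K e w) & forall s, L s -> (forall x, hull s x -> 0 <= ev f x) \/
    (forall x, hull s x -> ev f x <= 0)].
  apply: (IH (X `\ e)%fset).
  - have eX : e \in X by exact: (cX _ ce).
    by move: Xn; rewrite (cardfsD1 e X) eX add1n ltnS.
  - exact: geo_star.
  - move=> d [[ed Kd] [u' [v' [dE fu' fv']]]]; rewrite /= !inE.
    apply/andP; split; first by apply: contraNneq ed => ->.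
    apply: cX; split; last by exists u', v'.
    case: Kd => // -[wd _]; move: wd; rewrite dE !inE => /orP[] /eqP e'.
      by move: fu'; rewrite -e' fw ltxx.
    by move: fv'; rewrite -e' fw ltxx.
exists L; split=> //; first by rewrite bL body_star.
by apply: (refines_trans rL); exact: star_refines.
Qed.

Lemma cut_many (fs : seq (afn R N)) K : geo K ->
  exists L, [/\ geo L, body L = body K, refines L K & forall s f, L s -> f \in fs ->
    (forall x, hull s x -> 0 <= ev f x) \/ (forall x, hull s x -> ev f x <= 0)].
Proof.
move=> gK; elim: fs => [|f fs [L [gL bL rL sL]]].
  by exists K; split=> //; exact: refines_refl.
have [M [gM bM rM sM]] := cut_one f gL.
exists M; split=> //; [by rewrite bM|exact: refines_trans rM rL|].
move=> s g Ms; rewrite inE => /predU1P[->|gfs]; first exact: sM.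
have [t Lt st] := rM _ Ms.
by case: (sL _ _ Lt gfs) => h; [left|right] => x /st; exact: h.
Qed.

(** All vertices enter an inner point with positive weight. If [f] is nonpositive on [s] and
    nonnegative at such a point, no vertex can have a negative value. *)
Lemma one_sided_inner s f x : inner s x -> 0 <= ev f x ->
  (forall y, hull s y -> 0 <= ev f y) \/ (forall y, hull s y -> ev f y <= 0) ->
  forall y, hull s y -> 0 <= ev f y.
Proof.
move=> [a sx ap] fx [//|neg].
have vneg v : v \in s -> ev f v <= 0 by move=> vs; apply: neg; exact: hull_vertex.
apply: ev_hull_ge0 => v vs; rewrite leNgt; apply/negP => fv.
suff : ev f x < 0 by rewrite ltNge fx.
rewrite (ev_bary f sx) (big_fsetD1 v) //= -[ltRHS]addr0.
apply: ltr_leD; first by rewrite pmulr_rlt0 // ap.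
rewrite big_seq; apply: sumr_le0 => u; rewrite !inE => /andP[_ us].
by rewrite pmulr_rle0 ?ap // vneg.
Qed.

(** Once every functional of every polyhedron has constant sign on each simplex, the polyhedron that
    contains the barycenter contains the whole simplex. *)
Lemma cut_cover (ps : seq (seq (afn R N))) K : geo K ->
  (forall x, body K x -> exists2 p, p \in ps & poly p x) ->
  exists L, [/\ geo L, body L = body K, refines L K &
    forall s, L s -> exists2 p, p \in ps & hull s `<=` poly p].
Proof.
move=> gK cov; have [L [gL bL rL sL]] := cut_many (flatten ps) gK.
exists L; split=> // s Ls; have sb := inner_barycenter (geo_neq0 gL Ls).
have bb : body K (barycenter s).
  rewrite -bL; exists s => //; case: sb => a ? _; by apply/hull_bary; exists a.
have [p pps pb] := cov _ bb; exists p => // x sx f fp.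
apply: (one_sided_inner sb (pb _ fp)) => //.
by apply: sL => //; apply/flattenP; exists p.
Qed.

Lemma finite_polys K : geo K -> exists ps : seq (seq (afn R N)),
  (forall s, K s -> exists2 p, p \in ps & poly p = hull s) /\
  (forall p, p \in ps -> exists2 s, K s & poly p = hull s).
Proof.
move=> gK; have /choice[F FE] : forall s, exists fs, K s -> poly fs = hull s.
  move=> s; have [Ks|?] := pselect (K s); last by exists [::].
  by have [fs fsE] := hull_poly (geo_indep gK Ks); exists fs.
have mK s : (s \in fset_set K) <-> K s by rewrite in_fset_set ?inE //; exact: geo_fin.
exists [seq F s | s <- fset_set K]; split.
  by move=> s Ks; exists (F s); [apply/map_f/mK|exact: FE].
by move=> p /mapP[s /mK Ks ->]; exists s => //; exact: FE.
Qed.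

Lemma common_refinement K1 K2 : geo K1 -> geo K2 -> body K1 = body K2 ->
  exists L, [/\ geo L, body L = body K1, refines L K1 & refines L K2].
Proof.
move=> g1 g2 b12; have [ps [ps1 ps2]] := finite_polys g2.
have [|L [gL bL rL sL]] := @cut_cover ps K1 g1.
  move=> x; rewrite b12 => -[s Ks sx]; have [p pps pE] := ps1 _ Ks.
  by exists p => //; rewrite pE.
exists L; split=> // s /sL[p /ps2[t Kt pE]]; rewrite pE => st; by exists t.
Qed.

End Stellar.

(** * Alternating forms on ordered simplices *)

Lemma row_row_perm (R : Type) (m n : nat) (s : {perm 'I_m}) (A : 'M[R]_(m, n)) i :
  row i (row_perm s A) = row (s i) A.
Proof. by apply/rowP => j; rewrite !mxE. Qed.

Section Alternating.
Context (R : realType) (N n : nat) (D : {vspace 'rV[R]_N}) (w : 'M[R]_(n, N) -> R).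
Hypothesis wD : nform_on D w.
Implicit Types (X M : 'M[R]_(n, N)) (u : 'rV[R]_N).

Definition setrow (i : 'I_n) u X : 'M[R]_(n, N) :=
  \matrix_(k < n) (if k == i then u else row k X).

Lemma row_setrow i u X k : row k (setrow i u X) = if k == i then u else row k X.
Proof. by rewrite rowK. Qed.

Lemma row'_setrow i u X : row' i (setrow i u X) = row' i X.
Proof.
apply/matrixP => k j; rewrite !mxE eq_sym (negbTE (neq_lift i k)).
by rewrite mxE.
Qed.

Lemma rows_in_setrow i u X : rows_in D X -> u \in D -> rows_in D (setrow i u X).
Proof. by move=> XD uD k; rewrite row_setrow; case: eqP. Qed.

Lemma setrow_id i X : setrow i (row i X) X = X.
Proof. by apply/row_matrixP => k; rewrite row_setrow; case: eqP => [->|]. Qed.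

Lemma form_lin i X (b c : R) u v : rows_in D X -> u \in D -> v \in D ->
  w (setrow i (b *: u + c *: v) X) = b * w (setrow i u X) + c * w (setrow i v X).
Proof.
move=> XD uD vD; apply: (wD.1 i); rewrite ?row'_setrow //; try exact: rows_in_setrow.
  by apply: rows_in_setrow => //; rewrite memvD ?memvZ.
by rewrite !row_setrow !eqxx.
Qed.

Lemma form_add i X u v : rows_in D X -> u \in D -> v \in D ->
  w (setrow i (u + v) X) = w (setrow i u X) + w (setrow i v X).
Proof. by move=> *; have := @form_lin i X 1 1 u v; rewrite !scale1r !mul1r; apply. Qed.

Lemma form_sum (I : eqType) (l : seq I) (c : I -> R) (f : I -> 'rV[R]_N) i X :
  rows_in D X -> (forall k, k \in l -> f k \in D) ->
  w (setrow i (\sum_(k <- l) c k *: f k) X) = \sum_(k <- l) c k * w (setrow i (f k) X).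
Proof.
move=> XD; elim: l => [|k l IH] fD.
  rewrite !big_nil; have := @form_lin i X 0 0 0 0 XD (mem0v _) (mem0v _).
  by rewrite !scale0r !mul0r !addr0.
have sD : \sum_(j <- l) c j *: f j \in D.
  by rewrite big_seq; apply: memv_suml => j jl; rewrite memvZ // fD // inE jl orbT.
rewrite !big_cons -[X in _ + X]scale1r form_lin ?mul1r ?IH //.
  by move=> j jl; rewrite fD // inE jl orbT.
by rewrite fD // inE eqxx.
Qed.

Lemma form_eq0 i j X : rows_in D X -> i != j -> row i X = row j X -> w X = 0.
Proof. exact: wD.2. Qed.

Lemma form_xrow i j X : rows_in D X -> i != j -> w (xrow i j X) = - w X.
Proof.
move=> XD ij; have ji : j != i by rewrite eq_sym.
have rD k : row k X \in D by exact: XD.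
pose Y u v := setrow i u (setrow j v X).
have YD u v : u \in D -> v \in D -> rows_in D (Y u v) by move=> *; do 2!apply: rows_in_setrow => //.
have Y0 u : u \in D -> w (Y u u) = 0.
  by move=> uD; apply: (@form_eq0 i j) => //; [exact: YD|rewrite /Y !row_setrow eqxx (negbTE ji) eqxx].
have Yl u v v' : u \in D -> v \in D -> v' \in D -> w (Y (v + v') u) = w (Y v u) + w (Y v' u).
  by move=> *; apply: form_add => //; exact: rows_in_setrow.
have Yc u v : Y u v = setrow j v (setrow i u X).
  apply/row_matrixP => k; rewrite !row_setrow; case: eqP => // ->.
  by rewrite (negbTE ij).
have Yr u v v' : u \in D -> v \in D -> v' \in D -> w (Y u (v + v')) = w (Y u v) + w (Y u v').
  by move=> *; rewrite !Yc; apply: form_add => //; exact: rows_in_setrow.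
have XY : w X = w (Y (row i X) (row j X)) by rewrite /Y setrow_id setrow_id.
have xY : xrow i j X = Y (row j X) (row i X).
  apply/row_matrixP => k; rewrite !row_setrow /xrow row_row_perm.
  case: eqP => [->|/eqP ki]; first by rewrite tpermL.
  case: eqP => [->|/eqP kj]; first by rewrite tpermR.
  by rewrite tpermD // eq_sym.
have sD : row i X + row j X \in D by rewrite memvD.
have := Y0 _ sD; rewrite Yl // !Yr // !Y0 // add0r addr0 xY XY => /eqP.
by rewrite addrC addr_eq0 => /eqP.
Qed.

Lemma form_row_perm (s : {perm 'I_n}) X : rows_in D X -> w (row_perm s X) = (-1) ^+ s * w X.
Proof.
case: (prod_tpermP s) => ts -> {s} dts XD; elim: ts dts => [|[i j] ts IH] /=.
  by rewrite big_nil row_perm1 odd_perm1 mul1r.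
move=> /andP[ij dts]; rewrite big_cons row_permM.
rewrite -/(xrow i j _) form_xrow //; last by move=> k; rewrite row_row_perm.
rewrite IH // odd_mul_tperm /= in ij *.
by rewrite ij addTb signrN mulNr.
Qed.

(** Rows of [A] are replaced by unit vectors one at a time, form and determinant expanding in the
    same way; [k] counts the rows still arbitrary. At the end [A] either permutes the rows of [X] or
    repeats one of them. *)
Lemma form_mulmx (A : 'M[R]_n) X : rows_in D X -> w (A *m X) = \det A * w X.
Proof.
move=> XD; have AD (B : 'M[R]_n) : rows_in D (B *m X).
  by move=> i; rewrite row_mul mulmx_sum_row memv_suml // => k _; rewrite memvZ.
suff main k : (k <= n)%N -> forall A : 'M[R]_n,
    (forall i : 'I_n, (k <= i)%N -> exists j, row i A = delta_mx 0 j) ->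
    w (A *m X) = \det A * w X.
  by apply: (main n (leqnn n)) => i; rewrite leqNgt ltn_ord.
elim: k => [_ {}A AE|k IH kn {}A AE].
  have /choice[f fE] : forall i, exists j, row i A = delta_mx 0 j by move=> i; exact: AE.
  have [fI|] := boolP (injectiveb f).
    pose s := perm (injectiveP _ fI).
    have -> : A = perm_mx s.
      by apply/matrixP => i j; have /rowP/(_ j) := fE i; rewrite !mxE permE eqxx => ->; rewrite eq_sym.
    by rewrite -row_permE form_row_perm // det_perm.
  case/injectivePn => i [j ij fij].
  have rij : row i A = row j A by rewrite !fE fij.
  rewrite (@form_eq0 i j) //; last by rewrite !row_mul rij.
  rewrite (determinant_alternate ij) ?mul0r // => l.
  by move/rowP/(_ l): rij; rewrite !mxE.
pose i := Ordinal kn; pose B j := \matrix_l (if l == i then delta_mx 0 j else row l A).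
have rowB j l : row l (B j) = if l == i then delta_mx 0 j else row l A by rewrite rowK.
have BE j : w (B j *m X) = \det (B j) * w X.
  apply: IH => [|l]; first exact: ltnW.
  rewrite leq_eqVlt => /predU1P[kl|kl]; rewrite rowB.
    by exists j; rewrite (_ : l == i) //; apply/eqP/val_inj.
  case: eqP => [_|_]; [by exists j|exact: AE].
have wA : w (A *m X) = \sum_j A i j * w (B j *m X).
  have -> : A *m X = setrow i (\sum_j A i j *: row j X) (A *m X).
    rewrite -[LHS](setrow_id i) row_mul mulmx_sum_row.
    by congr (setrow _ _ _); apply: eq_bigr => j _; rewrite mxE.
  rewrite (@form_sum _ _ (fun j => A i j) (fun j => row j X)) //.
  apply: eq_bigr => j _; congr (_ * w _); apply/row_matrixP => l.
  rewrite row_setrow !row_mul rowB; case: eqP => // _; by rewrite -rowE.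
rewrite wA (expand_det_row _ i) mulr_suml; apply: eq_bigr => j _.
rewrite BE mulrA; congr (_ * _ * _); rewrite (expand_det_row _ i) (bigD1 j) //=.
have Bij q : B j i q = (q == j)%:R by rewrite mxE eqxx mxE eqxx.
rewrite big1 ?addr0 => [|q /negbTE qj]; last by rewrite Bij qj mul0r.
rewrite Bij eqxx mul1r /cofactor; congr (_ * \det _).
apply/matrixP => l q; rewrite !mxE eq_sym (negbTE (neq_lift i l)).
by rewrite mxE.
Qed.

End Alternating.

(** * Ordered simplices, their edge vectors and tangent spaces *)

Section OrderedSimplices.
Context (R : realType) (N : nat).
Local Notation T := 'rV[R]_N.
Implicit Types (s t r : {fset T}) (a b : T -> R) (x : T).

(* An ordered simplex is encoded by the matrix whose rows are its vertices. *)
Definition ordered m s (Q : 'M[R]_(m, N)) : Prop :=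
  (forall v, v \in s <-> exists i, row i Q = v) /\ injective (fun i => row i Q).

Definition edges n (Q : 'M[R]_(n.+1, N)) : 'M[R]_(n, N) :=
  \matrix_(i < n) (row (lift ord0 i) Q - row ord0 Q).

Lemma row_edges n (Q : 'M[R]_(n.+1, N)) i :
  row i (edges Q) = row (lift ord0 i) Q - row ord0 Q.
Proof. by rewrite rowK. Qed.

Lemma ordered_mem m s (Q : 'M[R]_(m, N)) i : ordered s Q -> row i Q \in s.
Proof. by move=> [h _]; apply/h; exists i. Qed.

Lemma ordered_perm_eq m s (Q : 'M[R]_(m, N)) : ordered s Q ->
  perm_eq s [seq row i Q | i <- enum 'I_m].
Proof.
move=> [h iQ]; apply: uniq_perm; first exact: fset_uniq.
  by rewrite map_inj_uniq // enum_uniq.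
move=> v; apply/idP/mapP => [/h[i <-]|[i _ ->]]; first by exists i; rewrite ?mem_enum.
by apply/h; exists i.
Qed.

Lemma ordered_sum (V : nmodType) m s (Q : 'M[R]_(m, N)) (F : T -> V) : ordered s Q ->
  \sum_(v <- s) F v = \sum_(i < m) F (row i Q).
Proof.
move=> /ordered_perm_eq h; rewrite (perm_big _ h) /= big_map.
by rewrite big_enum.
Qed.

Lemma ordered_card m s (Q : 'M[R]_(m, N)) : ordered s Q -> #|` s| = m.
Proof.
move=> /ordered_perm_eq/perm_size; rewrite size_map size_enum_ord => <-.
by [].
Qed.

Lemma ordered_nth m s : #|` s| = m -> ordered s (\matrix_(i < m) nth 0 s i).
Proof.
move=> sm; split=> [v|i j].
  split=> [vs|[i <-]]; last by rewrite rowK mem_nth // sm.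
  have vm : (index v s < m)%N by rewrite -sm index_mem.
  by exists (Ordinal vm); rewrite rowK /= nth_index.
rewrite !rowK => /eqP; rewrite nth_uniq ?fset_uniq ?sm // => /eqP ij.
exact: val_inj.
Qed.

Lemma ordered_row_perm m s (Q Q' : 'M[R]_(m, N)) : ordered s Q -> ordered s Q' ->
  exists p : {perm 'I_m}, Q' = row_perm p Q.
Proof.
move=> [h iQ] [h' iQ'].
have /choice[f fE] : forall i, exists j, row j Q = row i Q'.
  by move=> i; apply/h/h'; exists i.
have fI : injective f by move=> i j e; apply: iQ'; rewrite /= -!fE e.
by exists (perm fI); apply/row_matrixP => i; rewrite row_row_perm permE fE.
Qed.

Lemma bary_mulmx m s (Q : 'M[R]_(m, N)) a x : ordered s Q -> bary s a x ->
  x = (\row_i a (row i Q)) *m Q /\ \sum_i a (row i Q) = 1.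
Proof.
move=> sQ [_ _ a1 ->]; rewrite (ordered_sum _ sQ) mulmx_sum_row.
split; first by apply: eq_bigr => i _; rewrite mxE.
by rewrite -(ordered_sum a sQ).
Qed.

Definition row_stochastic m (C : 'M[R]_m) := forall i, \sum_j C i j = 1.

(* Adding all columns of [C] to the first and subtracting the first row from
   the others turns [C] into a block triangular matrix with corner [A]. *)
Lemma edges_mulmx n (C : 'M[R]_(n.+1)) (Q : 'M[R]_(n.+1, N)) : row_stochastic C ->
  exists2 A : 'M[R]_n, edges (C *m Q) = A *m edges Q & \det A = \det C.
Proof.
move=> C1; pose A : 'M[R]_n := \matrix_(i, j) (C (lift ord0 i) (lift ord0 j) - C ord0 (lift ord0 j)).
exists A.
  apply/row_matrixP => i; rewrite row_edges !row_mul !mulmx_sum_row.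
  rewrite !big_ord_recl /=.
  have CE k : C k ord0 = 1 - \sum_(j < n) C k (lift ord0 j).
    by rewrite -(C1 k) big_ord_recl addrK.
  rewrite !mxE !CE.
  under [X in _ + X - _]eq_bigr do rewrite mxE.
  under [X in _ - (_ + X)]eq_bigr do rewrite mxE.
  under [RHS]eq_bigr do rewrite row_edges !mxE scalerBr scalerBl.
  rewrite sumrB -scaler_suml !sumrB scalerBl !scaler_suml.
  rewrite !scalerBl !scaler_suml scale1r.
  set X1 := \sum_(i0 < n) _ *: row _ _; set q := row ord0 Q.
  set X2 := \sum_(i0 < n) _ *: row _ _.
  set S1 := \sum_(i0 < n) _ ; set S2 := \sum_(i0 < n) _.
  by move: X1 X2 S1 S2 => X1 X2 S1 S2; apply/rowP => j; rewrite !mxE; ring.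
pose o : 'cV[R]_n := const_mx 1.
pose L : 'M[R]_(1 + n) := block_mx 1%:M 0 o 1%:M.
pose P : 'M[R]_(1 + n) := block_mx 1%:M 0 (- o) 1%:M.
pose C' : 'M[R]_(1 + n) := C.
have CE : P *m (C' *m L) = block_mx 1%:M (ursubmx C') 0 A.
  have rs k : C' k (lshift n 0) + \sum_(j < n) C' k (rshift 1 j) = 1.
    have := C1 k; rewrite big_ord_recl /=.
    by congr (C k _ + _ = 1); [exact: val_inj|apply: eq_bigr => j _; congr (C k _); exact: val_inj].
  have e1 : ulsubmx C' + ursubmx C' *m o = 1%:M.
    apply/matrixP => i j; rewrite !ord1 !mxE eqxx -(rs (lshift n 0)); congr (_ + _).
    by apply: eq_bigr => k _; rewrite !mxE mulr1.
  have e2 : dlsubmx C' + drsubmx C' *m o = o.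
    apply/matrixP => i j; rewrite !ord1 !mxE -[RHS](rs (rshift 1 i)); congr (_ + _).
    by apply: eq_bigr => k _; rewrite !mxE mulr1.
  rewrite -[C' in LHS]submxK /L mulmx_block !mulmx1 !mulmx0 !add0r e1 e2 /P mulmx_block.
  rewrite !mul1mx !mul0mx !addr0 mulmx1 addNr; congr block_mx.
  apply/matrixP => i j; rewrite !mxE big_ord1 !mxE addrC mulN1r.
  by congr (C _ _ - C _ _); exact: val_inj.
have := congr1 determinant CE; rewrite !det_mulmx /L /P det_ublock !det_lblock !det1.
by rewrite !mul1r mulr1 => <-.
Qed.

(** Cramer's rule: in the expansion along row [i] the terms with [k != i] have two equal rows. *)
Lemma det_replace m (X : 'M[R]_m) (c : 'I_m -> R) i :
  \det (setrow i (\sum_k c k *: row k X) X) = c i * \det X.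
Proof.
have wD : nform_on fullv (fun X : 'M[R]_m => \det X).
  split=> [j M A B b d _ _ _|j k M _ jk e]; first exact: determinant_multilinear.
  by apply: (determinant_alternate jk) => l; move/rowP/(_ l): e; rewrite !mxE.
have XD : rows_in fullv X by move=> j; rewrite memvf.
rewrite (form_sum wD) ?memvf //.
rewrite (bigD1 i) //= setrow_id big1 ?addr0 // => k ki.
rewrite (determinant_alternate ki) ?mulr0 // => l.
by rewrite !mxE eqxx (negbTE ki).
Qed.

Lemma indep_edges_free n s (Q : 'M[R]_(n.+1, N)) : indep s -> ordered s Q ->
  forall u : 'rV_n, u *m edges Q = 0 -> u = 0.
Proof.
move=> /affinely_indepP sI sQ u u0.
(* The first vertex receives minus the sum of the other weights, which turns a linear relation
   between edges into an affine relation between vertices. *)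
pose c (i : 'I_n.+1) := if unlift ord0 i is Some j then u 0 j else - \sum_j u 0 j.
have cl j : c (lift ord0 j) = u 0 j by rewrite /c liftK.
have c00 : c ord0 = - \sum_j u 0 j by rewrite /c unlift_none.
have c0 : \sum_i c i = 0.
  by rewrite big_ord_recl c00 (eq_bigr _ (fun j _ => cl j)) addNr.
have cQ : \sum_i c i *: row i Q = 0.
  rewrite -[RHS]u0 mulmx_sum_row big_ord_recl c00.
  rewrite [X in _ + X](eq_bigr (fun j => u 0 j *: row (lift ord0 j) Q)); last first.
    by move=> j _; rewrite cl.
  under [RHS]eq_bigr do rewrite row_edges scalerBr.
  by rewrite sumrB scaleNr scaler_suml addrC.
have [h iQ] := sQ.
pose a v := if pick (fun i => row i Q == v) is Some i then c i else 0.
have aE i : a (row i Q) = c i.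
  by rewrite /a; case: pickP => [j /eqP/iQ ->|/(_ i)]; rewrite ?eqxx.
have a0 v : v \in s -> a v = 0.
  apply: sI; rewrite (ordered_sum _ sQ); under eq_bigr do rewrite aE; done.
apply/rowP => j; rewrite mxE -(a0 _ (ordered_mem (lift ord0 j) sQ)) aE cl.
by [].
Qed.

Lemma edges_tangent n s (Q : 'M[R]_(n.+1, N)) : ordered s Q ->
  rows_in (tangent s) (edges Q).
Proof.
move=> sQ i; rewrite row_edges; apply: memv_span; apply: allpairs_f;
  exact: ordered_mem sQ.
Qed.

Lemma tangent_edges n s (Q : 'M[R]_(n.+1, N)) v : ordered s Q -> v \in tangent s ->
  exists u : 'rV_n, v = u *m edges Q.
Proof.
move=> sQ vs; pose X := [tuple row i (edges Q) | i < n].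
have XE (i : 'I_n) : X`_i = row i (edges Q) by rewrite -tnth_nth tnth_mktuple.
have EX i : row i (edges Q) \in <<X>>%VS.
  by apply: memv_span; apply/tnthP; exists i; rewrite tnth_mktuple.
have QX i : row i Q - row ord0 Q \in <<X>>%VS.
  case: (unliftP ord0 i) => [j ->|->]; last by rewrite subrr mem0v.
  by rewrite -row_edges.
have : v \in <<X>>%VS.
  move: v vs; apply/subvP/span_subvP => w /allpairsP[[y z] /= [/(sQ.1 _).1[i <-] /(sQ.1 _).1[j <-] ->]].
  rewrite -(subrK (row ord0 Q) (row i Q)) -addrA memvD //.
  by rewrite -opprB memvN.
move=> /coord_span ->; exists (\row_i coord X i v).
by rewrite mulmx_sum_row; apply: eq_bigr => i _; rewrite XE mxE.
Qed.

Lemma rows_tangent n m s (Q : 'M[R]_(n.+1, N)) (M : 'M[R]_(m, N)) : ordered s Q ->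
  rows_in (tangent s) M -> exists B : 'M[R]_(m, n), M = B *m edges Q.
Proof.
move=> sQ Ms; have /choice[f fE] : forall i, exists u : 'rV_n, row i M = u *m edges Q.
  by move=> i; exact: tangent_edges (Ms i).
by exists (\matrix_i f i); apply/row_matrixP => i; rewrite row_mul rowK.
Qed.

Lemma edges_frame n s (Q : 'M[R]_(n.+1, N)) : indep s -> ordered s Q ->
  frame (tangent s) (edges Q).
Proof.
move=> sI sQ; apply/andP; split.
  rewrite eqEsubv; apply/andP; split.
    by apply/span_subvP => v /mapP[i _ ->]; exact: edges_tangent.
  apply/subvP => v /(tangent_edges sQ)[u ->]; rewrite mulmx_sum_row.
  apply: memv_suml => i _; apply: memvZ; apply: memv_span.
  by apply: map_f; rewrite mem_enum.
pose X := [tuple row i (edges Q) | i < n].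
have -> : [seq row i (edges Q) | i <- enum 'I_n] = X by [].
apply/freeP => k k0 i.
suff /rowP/(_ i) : \row_j k j = 0 by rewrite !mxE.
apply: (indep_edges_free sI sQ); rewrite -[RHS]k0 mulmx_sum_row.
by apply: eq_bigr => j _; rewrite mxE -tnth_nth tnth_mktuple.
Qed.

Lemma dim_tangent n s (Q : 'M[R]_(n.+1, N)) : indep s -> ordered s Q ->
  \dim (tangent s) = n.
Proof.
move=> sI sQ; have /andP[/eqP <- /eqP ->] := edges_frame sI sQ.
by rewrite size_map size_enum_ord.
Qed.

Lemma tangent_sub_hull s t : hull t `<=` hull s -> (tangent t <= tangent s)%VS.
Proof.
move=> ts; apply/span_subvP => w /allpairsP[[y z] /= [yt zt ->]].
have /fset0Pn[v0 v0s] : s != fset0.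
  by have := ts _ (hull_vertex yt); case: eqP => // ->; rewrite hull0.
suff h v : v \in t -> v - v0 \in tangent s.
  by rewrite -(subrK v0 y) -addrA memvD ?h // -opprB memvN h.
move=> /hull_vertex/ts/hull_bary[a [_ _ a1 {1}->]].
rewrite -[v0]scale1r -a1 scaler_suml -sumrB big_seq.
apply: memv_suml => u us; rewrite -scalerBr memvZ //; apply: memv_span.
exact: allpairs_f.
Qed.

Lemma tangent_eq_hull n s t : is_simplex n s -> is_simplex n t ->
  hull t `<=` hull s -> tangent t = tangent s.
Proof.
move=> [/affinely_indepP sI sn] [/affinely_indepP tI tn] ts.
apply/eqP; rewrite eqEdim tangent_sub_hull //=.
by rewrite (dim_tangent sI (ordered_nth sn)) (dim_tangent tI (ordered_nth tn)).
Qed.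

(** With the rows of [C] read as barycentric coordinates of one ordered simplex relative to another,
    volumes change by the determinant of the coordinate matrix. *)
Lemma form_stochastic n s (Q : 'M[R]_(n.+1, N)) (C : 'M[R]_n.+1) w :
  rows_in (tangent s) (edges Q) -> nform_on (tangent s) w -> row_stochastic C ->
  w (edges (C *m Q)) = \det C * w (edges Q).
Proof. by move=> sQ ws /(edges_mulmx Q)[A -> <-]; exact: (form_mulmx ws). Qed.

(** The coefficient matrix is the identity with row [i] replaced by [c], and its determinant is
    [c i]. The volumes of the pieces of a subdivided facet star come from this formula. *)
Lemma form_replace n s (Q : 'M[R]_(n.+1, N)) w i (c : 'I_n.+1 -> R) :
  rows_in (tangent s) (edges Q) -> nform_on (tangent s) w -> \sum_k c k = 1 ->
  w (edges (setrow i (\sum_k c k *: row k Q) Q)) = c i * w (edges Q).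
Proof.
move=> sQ ws c1; pose C := setrow i (\row_k c k) 1%:M : 'M[R]_n.+1.
have -> : setrow i (\sum_k c k *: row k Q) Q = C *m Q.
  apply/row_matrixP => k; rewrite row_mul !row_setrow; case: eqP => // _.
    by rewrite mulmx_sum_row; apply: eq_bigr => j _; rewrite mxE.
  by rewrite -row_mul mul1mx.
rewrite (form_stochastic sQ ws); last first.
  move=> k; rewrite -[RHS](_ : \sum_j row k C 0 j = 1); first by apply: eq_bigr => j _; rewrite [RHS]mxE.
  rewrite row_setrow; case: eqP => _; first by rewrite -c1; apply: eq_bigr => j _; rewrite mxE.
  rewrite (bigD1 k) //= big1 => [|j /negbTE jk]; first by rewrite !mxE eqxx addr0.
  by rewrite !mxE eq_sym jk.
have -> : C = setrow i (\sum_k c k *: row k 1%:M) 1%:M.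
  congr setrow; rewrite -[LHS]mulmx1 mulmx_sum_row.
  by apply: eq_bigr => k _; rewrite mxE.
by rewrite det_replace det1 mulr1.
Qed.

Lemma form_edges_perm n s (Q : 'M[R]_(n.+1, N)) w (p : {perm 'I_n.+1}) :
  rows_in (tangent s) (edges Q) -> nform_on (tangent s) w ->
  w (edges (row_perm p Q)) = (-1) ^+ p * w (edges Q).
Proof.
move=> sQ ws; rewrite row_permE (form_stochastic sQ ws) ?det_perm // => i.
rewrite (bigD1 (p i)) //= !mxE eqxx big1 ?addr0 // => j.
by rewrite !mxE eq_sym => /negbTE ->.
Qed.

End OrderedSimplices.

(** * Affine images of complexes *)

Section AffineImages.
Context (R : realType) (N : nat).
Local Notation T := 'rV[R]_N.
Implicit Types (s t r : {fset T}) (a b : T -> R) (x : T) (h : T -> T).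

Definition affine_on h s := exists (A : 'M[R]_N) (b : T), forall x, hull s x -> h x = x *m A + b.

Definition inj_on (P : set T) h := forall x y, P x -> P y -> h x = h y -> x = y.

Lemma inj_on_sub (P Q : set T) h : P `<=` Q -> inj_on Q h -> inj_on P h.
Proof. by move=> PQ i x y /PQ Qx /PQ; exact: i. Qed.

Lemma affine_on_bary h s a x : affine_on h s -> bary s a x ->
  h x = \sum_(v <- s) a v *: h v.
Proof.
move=> [A [b hE]] sx; have [_ _ a1 xE] := sx.
rewrite hE; last by apply/hull_bary; exists a.
rewrite xE mulmx_suml -[b]scale1r -a1 scaler_suml -big_split /=.
by apply: eq_big_seq => v /hull_vertex/hE ->; rewrite scalerDr scalemxAl.
Qed.

Lemma imgP h s u : u \in image_simplex h s <-> exists2 v, v \in s & u = h v.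
Proof. by split=> [/imfsetP[v /= vs ->]|[v vs ->]]; [exists v|apply/imfsetP; exists v]. Qed.

Lemma img_sum (V : nmodType) h s (F : T -> V) : inj_on (hull s) h ->
  \sum_(u <- image_simplex h s) F u = \sum_(v <- s) F (h v).
Proof.
by move=> hI; rewrite big_imfset //= => u v us vs; apply: hI; exact: hull_vertex.
Qed.

Lemma img_bary h s a y : inj_on (hull s) h -> affine_on h s ->
  bary (image_simplex h s) a y ->
  exists2 x, bary s (fun v => if v \in s then a (h v) else 0) x & h x = y.
Proof.
move=> hI hA [a0 ai a1 yE]; exists (\sum_(v <- s) (if v \in s then a (h v) else 0) *: v).
  split=> //.
  - by move=> v; case: ifP.
  - by move=> v /negbTE ->.
  - by rewrite -a1 (img_sum _ hI); apply: eq_big_seq => v ->.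
rewrite yE (img_sum _ hI) (@affine_on_bary h s (fun v => if v \in s then a (h v) else 0)) //.
  by apply: eq_big_seq => v ->.
split=> //.
- by move=> v; case: ifP.
- by move=> v /negbTE ->.
- by rewrite -a1 (img_sum _ hI); apply: eq_big_seq => v ->.
Qed.

Lemma hull_img h s : inj_on (hull s) h -> affine_on h s ->
  hull (image_simplex h s) = h @` hull s.
Proof.
move=> hI hA; apply/seteqP; split=> [y /hull_bary[a /(img_bary hI hA)[x sx <-]]|_ [x sx <-]].
  by exists x => //; apply/hull_bary; eexists; exact: sx.
have /hull_bary[a ax] := sx; rewrite (affine_on_bary hA ax).
have [a0 as0 a1 _] := ax.
exists (fun u => \sum_(v <- s) a v * (u == h v)%:R).
have key (V : lmodType R) (F : T -> V) :
    \sum_(u <- image_simplex h s) (\sum_(v <- s) a v * (u == h v)%:R) *: F u =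
    \sum_(v <- s) a v *: F (h v).
  rewrite (img_sum _ hI); apply: eq_big_seq => v vs; congr (_ *: _).
  rewrite (big_fsetD1 v) //= eqxx mulr1 big1_seq ?addr0 // => u; rewrite in_fsetD1 => /andP[_ /andP[uv us]].
  case: eqP => [e|_]; last by rewrite mulr0.
  by case/eqP: uv; apply/esym/hI => //; exact: hull_vertex.
split=> //.
- move=> u _; rewrite big_seq; apply: sumr_ge0 => v vs; by rewrite mulr_ge0.
- have := key R^o (fun=> 1); rewrite -[RHS in _ -> _ = RHS]a1.
  under eq_bigr do rewrite /GRing.scale /= mulr1.
  by move=> ->; apply: eq_bigr => v _; rewrite /GRing.scale /= mulr1.
- by rewrite (key _ id).
Qed.

Lemma img_indep h s : inj_on (hull s) h -> affine_on h s -> indep s ->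
  indep (image_simplex h s).
Proof.
move=> hI hA sI a b y ya yb.
have [x xa hx] := img_bary hI hA ya; have [x' xb hx'] := img_bary hI hA yb.
have xx : x = x' by apply: hI; rewrite ?hx ?hx' //; apply/hull_bary; eexists; eassumption.
rewrite -xx in xb; have e := sI _ _ _ xa xb; apply/funext => u.
have [|us] := boolP (u \in image_simplex h s); last first.
  by have [_ -> // _ _] := ya; have [_ -> // _ _] := yb.
by move=> /imgP[v vs ->]; have := congr1 (fun f => f v) e; rewrite vs.
Qed.

Lemma card_img h s : inj_on (hull s) h -> #|` image_simplex h s| = #|` s|.
Proof. by move=> hI; apply: card_in_imfset => u v us vs; apply: hI; exact: hull_vertex. Qed.

Lemma img_simplex n h s : inj_on (hull s) h -> affine_on h s -> is_simplex n s ->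
  is_simplex n (image_simplex h s).
Proof.
move=> hI hA [/affinely_indepP sI sn]; split; last by rewrite card_img.
by apply/affinely_indepP; exact: img_indep.
Qed.

Lemma ordered_img m h s (Q : 'M[R]_(m, N)) : inj_on (hull s) h -> ordered s Q ->
  ordered (image_simplex h s) (\matrix_i h (row i Q)).
Proof.
move=> hI sQ; have [e iQ] := sQ; split=> [u|i j].
  split=> [/imgP[v /e[i <-] ->]|[i <-]]; first by exists i; rewrite rowK.
  by rewrite rowK; apply/imgP; exists (row i Q) => //; exact: ordered_mem sQ.
rewrite /= !rowK => hij; apply: iQ; apply: hI => //; apply: hull_vertex;
  exact: ordered_mem sQ.
Qed.

Lemma edges_img n h s (Q : 'M[R]_(n.+1, N)) (A : 'M[R]_N) (b : T) : ordered s Q ->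
  (forall x, hull s x -> h x = x *m A + b) ->
  edges (\matrix_i h (row i Q)) = edges Q *m A.
Proof.
move=> sQ hE; apply/row_matrixP => i; rewrite row_mul !row_edges !rowK.
rewrite !hE; try (by apply: hull_vertex; exact: ordered_mem sQ).
by rewrite mulmxBl opprD addrACA subrr addr0.
Qed.

Lemma img_tangent n h s (A : 'M[R]_N) (b : T) : is_simplex n s -> inj_on (hull s) h ->
  (forall x, hull s x -> h x = x *m A + b) ->
  forall M : 'M[R]_(n, N), rows_in (tangent s) M ->
    rows_in (tangent (image_simplex h s)) (M *m A).
Proof.
move=> [_ sn] hI hE M; have sQ := ordered_nth sn.
move=> /(rows_tangent sQ)[B ->]; rewrite -mulmxA -(edges_img sQ hE) => i.
rewrite row_mul mulmx_sum_row; apply: memv_suml => j _; apply: memvZ.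
exact: (edges_tangent (ordered_img hI sQ)).
Qed.

Lemma card_hull_sub s t : indep s -> indep t -> t != fset0 -> hull t `<=` hull s ->
  (#|` t| <= #|` s|)%N.
Proof.
move=> sI tI t0 ts; have s0 : s != fset0.
  have /fset0Pn[v vt] := t0; apply: contraPneq (ts _ (hull_vertex vt)) => ->.
  by rewrite hull0.
have [c cE] : exists c, #|` t| = c.+1.
  by exists #|` t|.-1; rewrite prednK // lt0n cardfs_eq0.
have [d dE] : exists d, #|` s| = d.+1.
  by exists #|` s|.-1; rewrite prednK // lt0n cardfs_eq0.
rewrite cE dE ltnS -(dim_tangent tI (ordered_nth cE)) -(dim_tangent sI (ordered_nth dE)).
by apply: dimvS; exact: tangent_sub_hull.
Qed.

(** The hulls meet in the hull of the common face, which contains an n-simplex and hence has at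
    least n+1 vertices, all that [s] and [s'] can have. With [s = s'] this shows that a simplex
    containing an n-simplex is n-dimensional. *)
Lemma hull_simplex_uniq n (K : set {fset T}) s s' t : geo K ->
  (forall s, K s -> (#|` s| <= n.+1)%N) -> is_simplex n t ->
  K s -> K s' -> hull t `<=` hull s -> hull t `<=` hull s' ->
  s = s' /\ is_simplex n s.
Proof.
move=> gK dK [/affinely_indepP tI tn] Ks Ks' ts ts'.
have t0 : t != fset0 by rewrite -cardfs_eq0 tn.
have tss : hull t `<=` hull (s `&` s')%fset.
  by move=> x tx; apply: (geo_meet gK) => //; [exact: ts|exact: ts'].
have ss0 : (s `&` s')%fset != fset0.
  have /fset0Pn[v vt] := t0; apply: contraPneq (tss _ (hull_vertex vt)) => ->.
  by rewrite hull0.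
have Kss : K (s `&` s')%fset by apply: (geo_face gK Ks) => //; exact: fsubsetIl.
have := card_hull_sub (geo_indep gK Kss) tI t0 tss; rewrite tn => nss.
have e u : K u -> (s `&` s' `<=` u)%fset -> (s `&` s')%fset = u.
  by move=> Ku su; apply/eqP; rewrite eqEfcard su (leq_trans (dK _ Ku)).
have es := e _ Ks (fsubsetIl _ _); have es' := e _ Ks' (fsubsetIr _ _).
split; first by rewrite -es.
split; first by apply/affinely_indepP; exact: geo_indep gK Ks.
by apply/eqP; rewrite eqn_leq dK // -es.
Qed.

Lemma affine_on_continuous h s : affine_on h s -> {within hull s, continuous h}.
Proof.
move=> [A [b hE]]; have e : {in hull s, (fun x => x *m A + b) =1 h} by move=> x /set_mem sx; rewrite hE.
apply: (subspace_eq_continuous e).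
by apply: continuous_subspaceT; exact: amap_continuous.
Qed.

Lemma glue_continuous (K : set {fset T}) h : geo K -> (forall s, K s -> affine_on h s) ->
  {within body K, continuous h}.
Proof.
move=> gK hA; have [X KX] := finite_fsetP.1 (geo_fin gK).
have memX s : s \in X -> K s by rewrite KX.
suff : closed (\bigcup_(s in [set` X]) hull s) /\
    {within \bigcup_(s in [set` X]) hull s, continuous h} by rewrite /body KX => -[].
elim/finSet_rect: X memX {KX} => X IH KX.
have [->|/fset0Pn[s sX]] := eqVneq X fset0.
  rewrite (_ : \bigcup_(s in _) _ = set0); last first.
    by apply/seteqP; split=> // x [s /=]; rewrite in_fset0.
  split; [exact: closed0|exact: continuous_subspace0].
have [|t|cl ct] := IH (X `\ s)%fset; first exact: fproperD1.
  by rewrite in_fsetD1 => /andP[_]; exact: KX.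
have -> : \bigcup_(t in [set` X]) hull t = hull s `|` \bigcup_(t in [set` (X `\ s)%fset]) hull t.
  apply/seteqP; split=> x.
    move=> [t tX tx]; have [<-|ts] := eqVneq t s; first by left.
    by right; exists t => //; rewrite /= in_fsetD1 ts.
  by move=> [sx|[t /=]]; [exists s|rewrite !inE => /andP[_ tX] tx; exists t].
have cs := hull_closed (geo_indep gK (KX _ sX)).
split; first exact: closedU.
apply: withinU_continuous => //; apply: affine_on_continuous; exact: hA (KX _ sX).
Qed.

End AffineImages.

(** * Equivalence of forms on a complex *)

Section Equivalence.
Context (R : realType) (N n : nat).
Local Notation T := 'rV[R]_N.
Implicit Types (s t r : {fset T}) (a b : T -> R) (x : T) (h : T -> T).
Implicit Types (K : set {fset T}) (F G H : {fset T} -> 'M[R]_(n, N) -> R).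

Definition bij_on (P : set T) h :=
  [/\ forall x, P x -> P (h x), inj_on P h & forall y, P y -> exists2 x, P x & h x = y].

Definition dim_le K := forall s, K s -> (#|` s| <= n.+1)%N.

(* Here [h] pulls [F] back to [G] and is affine on each polyhedron of the
   finite cover [ps] of the body of [K]. Unlike a triangulation, such a cover
   is easily refined, which makes composition of maps straightforward. *)
Definition pc_pullback K F G h (ps : seq (seq (afn R N))) : Prop :=
  (forall x, body K x -> exists2 p, p \in ps & poly p x) /\
  forall p, p \in ps -> exists (A : 'M[R]_N) (b : T) s t,
    [/\ K s, K t, forall x, poly p x -> h x = x *m A + b /\ hull t x /\ hull s (h x) &
      forall u, is_simplex n u -> hull u `<=` poly p ->
        forall M, rows_in (tangent u) M -> F s (M *m A) = G t M].

Definition pc_equiv K F G := exists h ps, bij_on (body K) h /\ pc_pullback K F G h ps.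

(** The pieces for the composite are the polyhedra [p] cut by the preimages of the [q] under [h2];
    such a preimage is again given by affine inequalities because [h2] is affine on [p]. *)
Lemma pc_equiv_trans K F G H : geo K -> dim_le K ->
  pc_equiv K F G -> pc_equiv K G H -> pc_equiv K F H.
Proof.
move=> gK dK [h1 [ps1 [[b1 i1 s1] [c1 p1]]]] [h2 [ps2 [[b2 i2 s2] [c2 p2]]]].
have /choice[f fE] : forall p, exists Ab : 'M[R]_N * T, p \in ps2 -> exists s t,
    [/\ K s, K t, forall x, poly p x -> h2 x = x *m Ab.1 + Ab.2 /\ hull t x /\ hull s (h2 x) &
      forall u, is_simplex n u -> hull u `<=` poly p ->
        forall M, rows_in (tangent u) M -> G s (M *m Ab.1) = H t M].
  move=> p; have [/p2[A [b h]]|_] := boolP (p \in ps2); last by exists (0, 0).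
  by exists (A, b).
have /choice[g gE] : forall q : 'M[R]_N * T * afn R N,
    exists k, forall x, ev k x = ev q.2 (x *m q.1.1 + q.1.2).
  by move=> [[A b] k]; have [k' ?] := affine_amap A b k; exists k'.
pose pull p q : seq (afn R N) := p ++ [seq g (f p, k) | k <- q].
have pullP p q x : p \in ps2 -> (poly (pull p q) x <-> poly p x /\ poly q (h2 x)).
  move=> pps; have [s [t [_ _ ph _]]] := fE _ pps; rewrite poly_cat.
  split=> -[px qx]; split=> // k.
    by move=> kq; have := qx _ (map_f _ kq); rewrite gE /= (ph _ px).1.
  by move=> /mapP[k' /qx + ->]; rewrite gE /= (ph _ px).1.
exists (h1 \o h2), [seq pull p q | p <- ps2, q <- ps1]; split.
  split=> [x /b2/b1 //|x y Px Py /= /i1 e|z /s1[y /s2[x Px <-] <-]]; last by exists x.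
  by apply: i2 => //; apply: e; exact: b2.
split=> [x Px|_ /allpairsP[[p q] /= [pps qps ->]]].
  have [p pps px] := c2 _ Px; have [q qps qx] := c1 _ (b2 _ Px).
  by exists (pull p q); [apply: allpairs_f|apply/pullP].
have [s2' [t2 [Ks2 Kt2 ph2 fm2]]] := fE _ pps.
have [A1 [bb1 [s1' [t1 [Ks1 Kt1 ph1 fm1]]]]] := p1 _ qps.
exists ((f p).1 *m A1), ((f p).2 *m A1 + bb1), s1', t2; split=> //.
  move=> x /(pullP _ _ _ pps)[/ph2[e2 [tx sx]] /ph1[e1 [_ s1x]]]; split=> //.
  by rewrite /= e1 e2 mulmxDl mulmxA addrA.
move=> u un up M Mu.
have up2 x : hull u x -> poly p x by move=> /up/(pullP _ _ _ pps)[].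
have up1 x : hull u x -> poly q (h2 x) by move=> /up/(pullP _ _ _ pps)[].
have uP : hull u `<=` body K by move=> x /up2/ph2[_ [tx _]]; exists t2.
have hI : inj_on (hull u) h2 by exact: inj_on_sub uP i2.
have hE x : hull u x -> h2 x = x *m (f p).1 + (f p).2 by move=> /up2/ph2[].
have hA : affine_on h2 u by exists (f p).1, (f p).2.
have un' := img_simplex hI hA un.
have hu := hull_img hI hA.
(* The image of [u] is an n-simplex lying both in the target simplex of [h2] and in the source
   simplex of [h1], so these coincide. Degenerate pieces contain no such [u] and impose no condition
   on the forms. *)
have e : s2' = t1.
  have [||//] := hull_simplex_uniq gK dK un' Ks2 Kt1.
  - by rewrite hu => _ [x /up2/ph2[_ [_ ?]] <-].
  - by rewrite hu => _ [x /up1/ph1[_ [? _]] <-].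
rewrite -(fm2 _ un up2 _ Mu) e mulmxA; apply: fm1 un' _ _ _.
  by rewrite hu => _ [x /up1 ? <-].
exact: (img_tangent un hI hE).
Qed.

Lemma geo_img K h : geo K -> inj_on (body K) h -> (forall s, K s -> affine_on h s) ->
  geo (image_simplex h @` K).
Proof.
move=> gK hI hA; have sI s : K s -> inj_on (hull s) h.
  by move=> Ks; apply: inj_on_sub hI => x sx; exists s.
split.
- exact/finite_image/geo_fin.
- move=> _ [s Ks <-]; rewrite -cardfs_eq0 card_img ?cardfs_eq0; last exact: sI.
  exact: geo_neq0 gK _ Ks.
- move=> _ t [s Ks <-] ts t0; pose t' := [fset v in s | h v \in t]%fset.
  have e : image_simplex h t' = t.
    apply/fsetP => u; apply/idP/idP.
      by move=> /imgP[v]; rewrite !inE => /andP[_ ?] ->.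
    move=> ut; have /imgP[v vs uE] := fsubsetP ts _ ut.
    by apply/imgP; exists v => //; rewrite !inE vs -uE ut.
  exists t' => //; apply: (geo_face gK Ks); first exact: fset_sub.
  by apply: contraNneq t0 => e0; rewrite -e e0 /image_simplex imfset0.
- move=> _ _ a b y [s Ks <-] [t Kt <-] ya yb.
  have [x xa hx] := img_bary (sI _ Ks) (hA _ Ks) ya.
  have [x' xb hx'] := img_bary (sI _ Kt) (hA _ Kt) yb.
  have hb s' c z : K s' -> bary s' c z -> body K z.
    by move=> Ks' ?; exists s' => //; apply/hull_bary; exists c.
  have xx : x = x' by apply: hI; rewrite ?hx ?hx' //; [exact: hb xa|exact: hb xb].
  rewrite -xx in xb; have e := geo_uniq gK Ks Kt xa xb.
  have half s1 t1 c d : K s1 -> K t1 -> bary (image_simplex h s1) c y ->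
      bary (image_simplex h t1) d y ->
      (fun v => if v \in s1 then c (h v) else 0) = (fun v => if v \in t1 then d (h v) else 0) ->
      forall u, u \in image_simplex h s1 -> c u = d u.
    move=> Ks1 Kt1 yc yd e' u us; have [v vs uE] := (imgP _ _ _).1 us.
    have := congr1 (fun f => f v) e'; rewrite vs -uE => ->.
    case: ifP => // /negP vt; have [_ d0 _ _] := yd; rewrite d0 //.
    apply/negP => /imgP[v' vt' uE']; apply: vt.
    suff -> : v = v' by [].
    apply: hI; [exists s1 => //|exists t1 => //|by rewrite -uE -uE']; exact: hull_vertex.
  apply/funext => u; have [us|us] := boolP (u \in image_simplex h s).
    exact: half ya yb e _ us.
  have [ut|ut] := boolP (u \in image_simplex h t).
    by apply/esym; exact: half yb ya (esym e) _ ut.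
  by have [_ a0 _ _] := ya; have [_ b0 _ _] := yb; rewrite a0 ?b0.
Qed.

Lemma body_img K h : bij_on (body K) h -> (forall s, K s -> affine_on h s) ->
  body (image_simplex h @` K) = body K.
Proof.
move=> [hb hI hs] hA; have sI s : K s -> inj_on (hull s) h.
  by move=> Ks; apply: inj_on_sub hI => x sx; exists s.
apply/seteqP; split=> [y [_ [s Ks <-]]|y /hs[x [s Ks sx] <-]].
  by rewrite (hull_img (sI _ Ks) (hA _ Ks)) => -[x sx <-]; apply: hb; exists s.
exists (image_simplex h s); first by exists s.
by rewrite (hull_img (sI _ Ks) (hA _ Ks)); exists x.
Qed.

Lemma geo_pl_homeo K h : geo K -> bij_on (body K) h -> (forall s, K s -> affine_on h s) ->
  pl_homeo K (image_simplex h @` K) h.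
Proof.
move=> gK hB hA; have [hb hI hs] := hB; have bE := body_img hB hA.
have sI s : K s -> inj_on (hull s) h.
  by move=> Ks; apply: inj_on_sub hI => x sx; exists s.
have gL := geo_img gK hI hA.
split; last first.
  move=> s Ks; have [A [b hE]] := hA _ Ks; split; first by exists A, b.
  exists (image_simplex h s); first by exists s.
  by rewrite (hull_img (sI _ Ks) (hA _ Ks)).
rewrite /homeomorphism_between bE.
have /choice[g gE] : forall y, exists x, body K y -> body K x /\ h x = y.
  move=> y; have [/hs[x Px xy]|] := pselect (body K y); first by exists x.
  by exists 0.
have gh x : body K x -> g (h x) = x.
  by move=> Px; have [Pg hg] := gE _ (hb _ Px); exact: hI.
split; first split.
- exact: hb.
- by move=> x y /set_mem Px /set_mem Py; exact: hI.
- by move=> y /hs[x Px <-]; exists x.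
exists g; split.
- by move=> x /set_mem; exact: gh.
- exact: glue_continuous.
- rewrite -bE; apply: glue_continuous => // _ [s Ks <-].
  have sI' := geo_indep gK Ks.
  have [A [b Ab]] := indep_amap g (img_indep (sI _ Ks) (hA _ Ks) sI').
  exists A, b => y /hull_bary[a ya]; rewrite (Ab _ _ ya).
  have [x xa <-] := img_bary (sI _ Ks) (hA _ Ks) ya.
  rewrite gh; last by exists s => //; apply/hull_bary; eexists; exact: xa.
  rewrite (img_sum _ (sI _ Ks)); have [_ _ _ {1}->] := xa.
  apply: eq_big_seq => v vs; rewrite vs gh //.
  by exists s => //; exact: hull_vertex.
Qed.

Lemma carrierE K s t : geo K -> dim_le K -> is_simplex n t -> K s ->
  hull t `<=` hull s -> carrier n K t = s.
Proof.
move=> gK dK tn Ks ts; have [_ sn] := hull_simplex_uniq gK dK tn Ks Ks ts ts.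
have [[Kc _] tc] : [set s | n_simplices n K s /\ hull t `<=` hull s] (carrier n K t).
  by apply: xgetPex; exists s.
by have [] := hull_simplex_uniq gK dK tn Kc Ks tc ts.
Qed.

(** After cutting [K] along the cover, [h] is affine on every simplex, and the target triangulation
    is the image complex. [F] and [G] are the two forms as induced on [K]. *)
Lemma pc_equiv_pl (W1 W2 : pc_form R N n) K F G :
  geo (support_complex W1) -> dim_le (support_complex W1) ->
  geo (support_complex W2) -> dim_le (support_complex W2) -> geo K -> dim_le K ->
  body (support_complex W1) = body K -> body (support_complex W2) = body K ->
  refines K (support_complex W1) -> refines K (support_complex W2) ->
  (forall s, n_simplices n K s -> forall M, rows_in (tangent s) M ->
    F s M = form_on W1 (carrier n (support_complex W1) s) M) ->
  (forall s, n_simplices n K s -> forall M, rows_in (tangent s) M ->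
    G s M = form_on W2 (carrier n (support_complex W2) s) M) ->
  pc_equiv K F G -> pl_equivalent W1 W2.
Proof.
set K1 := support_complex W1; set K2 := support_complex W2.
move=> g1 d1 g2 d2 gK dK b1 b2 r1 r2 F1 G2 [h [ps [hB [cov hp]]]].
have [hb hI hs] := hB.
have [L [gL bL rL sL]] := cut_cover gK cov.
rewrite -bL in hB hb hI hs.
have hA s : L s -> affine_on h s.
  move=> /sL[p /hp[A [b [s1 [t1 [_ _ ph _]]]]] sp]; exists A, b => x /sp/ph; by case.
have sI s : L s -> inj_on (hull s) h.
  by move=> Ls; apply: inj_on_sub hI => x sx; exists s.
have gL' := geo_img gL hI hA.
exists L, (image_simplex h @` L), h; split.
- split; [exact: geo_complex|by rewrite bL|exact: refines_trans rL r2].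
- split; [exact: geo_complex|by rewrite body_img // bL|].
  move=> _ [s Ls <-]; have [p /hp[A [b [s1 [t1 [Ks1 _ ph _]]]]] sp] := sL _ Ls.
  have [t Kt st] := r1 _ Ks1; exists t => //; apply: subset_trans st.
  by rewrite (hull_img (sI _ Ls) (hA _ Ls)) => _ [x /sp/ph[_ [_ ?]] <-].
- exact: geo_pl_homeo.
split=> // s [/= Ls sn] M Ms; rewrite -/K1 -/K2.
have [p /hp[A [b [s1 [t1 [Ks1 Kt1 ph fm]]]]] sp] := sL _ Ls.
have sI' := sI _ Ls; have hA' := hA _ Ls.
have in_ := img_simplex sI' hA' sn.
have i1 : hull (image_simplex h s) `<=` hull s1.
  by rewrite hull_img // => _ [x /sp/ph[_ [_ ?]] <-].
have it : hull s `<=` hull t1 by move=> x /sp/ph[_ []].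
have [_ s1n] := hull_simplex_uniq gK dK in_ Ks1 Ks1 i1 i1.
have [_ t1n] := hull_simplex_uniq gK dK sn Kt1 Kt1 it it.
have [u1 Ku1 su1] := r1 _ Ks1; have [u2 Ku2 su2] := r2 _ Kt1.
rewrite (carrierE g1 d1 in_ Ku1); last exact: subset_trans i1 su1.
rewrite (carrierE g2 d2 sn Ku2); last exact: subset_trans it su2.
have hE x : hull s x -> h x = x *m A + b by move=> /sp/ph[].
(* [linear_part] is an arbitrary choice, but any two matrices describing [h] on [s] agree on the
   edges of [s], hence on tangent vectors. *)
have MA : M *m linear_part h s = M *m A.
  have [c cE] : affine_with h s (linear_part h s).
    by apply: (@xgetPex _ 0 [set A | affine_with h s A]); exists A, b.
  have sQ := ordered_nth sn.2; have [B ->] := rows_tangent sQ Ms.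
  by rewrite -!mulmxA -(edges_img sQ cE) -(edges_img sQ hE).
have := fm _ sn sp _ Ms; rewrite F1 ?G2 //.
- by rewrite MA (carrierE g1 d1 s1n Ku1 su1) (carrierE g2 d2 t1n Ku2 su2).
- by rewrite -(tangent_eq_hull t1n sn it).
- by rewrite -(tangent_eq_hull s1n in_ i1); exact: (img_tangent sn sI' hE).
Qed.

End Equivalence.

(** * Simplicial isomorphisms as equivalences of forms *)

Section SimplicialIso.
Context (R : realType) (N n : nat).
Local Notation T := 'rV[R]_N.
Implicit Types (s t r : {fset T}) (a b : T -> R) (x : T) (h : T -> T).
Implicit Types (K L : set {fset T}) (F G H : {fset T} -> 'M[R]_(n, N) -> R).

Lemma hull_comb s t a x (f : T -> T) : bary s a x -> (forall v, v \in s -> hull t (f v)) ->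
  hull t (\sum_(v <- s) a v *: f v).
Proof.
move=> [a0 _ a1 _] h.
have /choice[B Bt] : forall v, exists c, v \in s -> bary t c (f v).
  move=> v; have [/h/hull_bary[c ?]|_] := boolP (v \in s); first by exists c.
  by exists (fun=> 0).
exists (fun u => \sum_(v <- s) a v * B v u); split.
- move=> u ut; rewrite big_seq; apply: sumr_ge0 => v vs.
  by rewrite mulr_ge0 //; case: (Bt v vs).
- rewrite exchange_big /= -a1; apply: eq_big_seq => v vs.
  by rewrite -mulr_sumr; case: (Bt v vs) => _ _ -> _; rewrite mulr1.
- under [RHS]eq_bigr do rewrite scaler_suml.
  rewrite exchange_big /=; apply: eq_big_seq => v vs.
  case: (Bt v vs) => _ _ _ ->; rewrite scaler_sumr.
  by apply: eq_bigr => u _; rewrite scalerA.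
Qed.

Lemma affine_on_comb h s t a x (f : T -> T) : affine_on h t -> bary s a x ->
  (forall v, v \in s -> hull t (f v)) ->
  h (\sum_(v <- s) a v *: f v) = \sum_(v <- s) a v *: h (f v).
Proof.
move=> [A [b hE]] sx ft; rewrite hE; last exact: hull_comb sx ft.
have [_ _ a1 _] := sx; rewrite mulmx_suml -[b]scale1r -a1 scaler_suml -big_split /=.
by apply: eq_big_seq => v /ft/hE ->; rewrite scalerDr scalemxAl.
Qed.

(** Uniqueness of coordinates makes the extension independent of the simplex chosen to contain a
    point. *)
Lemma simplicial_extension L (f : T -> T) : geo L -> exists h,
  forall s, L s -> affine_on h s /\ forall v, v \in s -> h v = f v.
Proof.
move=> gL; have /choice[c cE] : forall x, exists sa : {fset T} * (T -> R),
    body L x -> L sa.1 /\ bary sa.1 sa.2 x.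
  move=> x; have [[s Ls /hull_bary[a sx]]|?] := pselect (body L x); first by exists (s, a).
  by exists (fset0, fun=> 0).
pose h x := \sum_(v <- (c x).1) (c x).2 v *: f v.
have hE s a x : L s -> bary s a x -> h x = \sum_(v <- s) a v *: f v.
  move=> Ls sx; have [Lc cx] : L (c x).1 /\ bary (c x).1 (c x).2 x.
    by apply: cE; exists s => //; apply/hull_bary; exists a.
  have e := geo_uniq gL Lc Ls cx sx; rewrite /h e.
  rewrite (big_fset_sup (fsubsetUl _ s)); last first.
    by move=> v vc; have [_ c0 _ _] := cx; rewrite -e c0 // scale0r.
  apply/esym/big_fset_sup; first exact: fsubsetUr.
  by move=> v vs; have [_ s0 _ _] := sx; rewrite s0 // scale0r.
exists h => s Ls; split.
  have [A [b Ab]] := indep_amap f (geo_indep gL Ls); exists A, b.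
  by move=> x /hull_bary[a sx]; rewrite (Ab _ _ sx); exact: hE.
move=> v vs; rewrite (hE _ _ _ Ls (bary_vertex vs)) (big_fsetD1 v) //= eqxx scale1r.
rewrite big1_seq ?addr0 // => u; rewrite !inE => /andP[_ /andP[/negbTE -> _]].
by rewrite scale0r.
Qed.

Definition forms_on K F := forall s, n_simplices n K s -> nform_on (tangent s) (F s).

(** Mutually inverse vertex maps extend to mutually inverse piecewise affine maps. The forms are
    compared on one ordering of each n-simplex only, since an n-form on an n-dimensional space is
    determined by its value on one frame. *)
Lemma simplicial_pc_equiv K L' L'' F G (f g : T -> T) :
  geo K -> dim_le n K -> geo L' -> geo L'' -> body L' = body K -> body L'' = body K ->
  refines L' K -> refines L'' K -> forms_on K F -> forms_on K G ->
  (forall s, L' s -> L'' (image_simplex f s)) ->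
  (forall s, L'' s -> L' (image_simplex g s)) ->
  (forall s v, L' s -> v \in s -> g (f v) = v) ->
  (forall s v, L'' s -> v \in s -> f (g v) = v) ->
  (forall s s1 t1, L' s -> is_simplex n s -> is_simplex n (image_simplex f s) ->
     K s1 -> K t1 -> hull s `<=` hull t1 -> hull (image_simplex f s) `<=` hull s1 ->
     exists2 Q, ordered s Q &
       F s1 (edges (\matrix_i f (row i Q))) = G t1 (edges Q)) ->
  pc_equiv K F G.
Proof.
move=> gK dK g1 g2 b1 b2 r1 r2 Ff Gf fL gL gf fg fm.
have half M1 M2 (p q : T -> T) (hp hq : T -> T) :
    (forall s, M1 s -> affine_on hp s /\ forall v, v \in s -> hp v = p v) ->
    (forall s, M2 s -> affine_on hq s /\ forall v, v \in s -> hq v = q v) ->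
    (forall s, M1 s -> M2 (image_simplex p s)) ->
    (forall s v, M1 s -> v \in s -> q (p v) = v) ->
    forall s x, M1 s -> hull s x -> hull (image_simplex p s) (hp x) /\ hq (hp x) = x.
  move=> hpE hqE pM qp s x Ms /hull_bary[a sx].
  have [hpA hpv] := hpE _ Ms; have [hqA hqv] := hqE _ (pM _ Ms).
  have fh v : v \in s -> hull (image_simplex p s) (p v).
    by move=> vs; apply: hull_vertex; apply/imgP; exists v.
  have -> : hp x = \sum_(v <- s) a v *: p v.
    by rewrite (affine_on_bary hpA sx); apply: eq_big_seq => v /hpv ->.
  split; first exact: hull_comb sx fh.
  rewrite (affine_on_comb hqA sx fh); have [_ _ _ ->] := sx.
  apply: eq_big_seq => v vs; rewrite hqv ?(qp s) //.
  by apply/imgP; exists v.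
have [h hE] := simplicial_extension f g1; have [k kE] := simplicial_extension g g2.
have hk := half _ _ _ _ _ _ hE kE fL gf; have kh := half _ _ _ _ _ _ kE hE gL fg.
have hB : bij_on (body K) h.
  split.
  - by rewrite -{1}b1 -b2 => x [s Ls /(hk _ _ Ls)[? _]]; exists (image_simplex f s) => //; exact: fL.
  - rewrite -b1 => x y [s Ls sx] [t Lt ty] e.
    by rewrite -(hk _ _ Ls sx).2 e (hk _ _ Lt ty).2.
  - rewrite -{1}b2 -b1 => y [s Ls sy]; have [? ?] := kh _ _ Ls sy.
    by exists (k y) => //; exists (image_simplex g s) => //; exact: gL.
have [ps [ps1 ps2]] := finite_polys g1.
exists h, ps; split=> //; split.
  by rewrite -b1 => x [s Ls sx]; have [p pps pE] := ps1 _ Ls; exists p => //; rewrite pE.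
move=> p /ps2[s Ls pE]; have [[A [b hA]] hv] := hE _ Ls.
have [t1 Kt1 st1] := r1 _ Ls; have [s1 Ks1 ss1] := r2 _ (fL _ Ls).
exists A, b, s1, t1; rewrite pE; split=> //.
  move=> x sx; split; [exact: hA|split; [exact: st1|apply: ss1]].
  exact: (hk _ _ Ls sx).1.
move=> u un us M Mu; have [/affinely_indepP uI uc] := un.
have u0 : u != fset0 by rewrite -cardfs_eq0 uc.
have sI := geo_indep g1 Ls; have s0 := geo_neq0 g1 Ls.
(* [s] lies in a simplex of [K] and contains an n-simplex, which pins down its dimension. *)
have sn : is_simplex n s.
  split; first exact/affinely_indepP.
  apply/eqP; rewrite eqn_leq; apply/andP; split.
    apply: leq_trans (dK _ Kt1); apply: card_hull_sub => //; exact: geo_indep gK Kt1.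
  by rewrite -uc; exact: card_hull_sub.
have hI : inj_on (hull s) h.
  move=> x y sx sy e; by rewrite -(hk _ _ Ls sx).2 e (hk _ _ Ls sy).2.
have himg : image_simplex h s = image_simplex f s.
  by apply/fsetP => z; apply/idP/idP => /imgP[v vs ->]; apply/imgP; exists v; rewrite ?hv.
have fn : is_simplex n (image_simplex f s).
  by rewrite -himg; apply: img_simplex => //; exists A, b.
have [Q sQ QE] := fm _ _ _ Ls sn fn Ks1 Kt1 st1 ss1.
have hQ : edges (\matrix_i f (row i Q)) = edges Q *m A.
  rewrite -(edges_img sQ hA); congr edges; apply/row_matrixP => i; rewrite !rowK.
  by rewrite hv //; exact: ordered_mem sQ.
have [_ s1n] := hull_simplex_uniq gK dK fn Ks1 Ks1 ss1 ss1.
have [_ t1n] := hull_simplex_uniq gK dK sn Kt1 Kt1 st1 st1.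
rewrite (tangent_eq_hull sn un us) in Mu.
have [B ->] := rows_tangent sQ Mu.
rewrite -mulmxA -hQ (form_mulmx (Ff _ (conj Ks1 s1n))); last first.
  rewrite -(tangent_eq_hull s1n fn ss1) hQ; have := img_tangent sn hI hA (edges_tangent sQ).
  by rewrite himg.
rewrite (form_mulmx (Gf _ (conj Kt1 t1n))) ?QE //.
by rewrite -(tangent_eq_hull t1n sn st1); exact: edges_tangent.
Qed.

End SimplicialIso.

(** * Moving volume across a facet *)

Section FacetStar.
Context (R : realType) (N : nat).
Local Notation T := 'rV[R]_N.
Implicit Types (s t r f g : {fset T}) (v x y z : T).
Implicit Types (K L : set {fset T}).

Definition two_cofaces K r (a b : T) :=
  [/\ a \notin r, b \notin r, a != b & [/\ K (a |` r)%fset, K (b |` r)%fset &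
      forall t, K t -> (r `<=` t)%fset ->
        (t `<=` a |` r)%fset \/ (t `<=` b |` r)%fset]].

(* For a single vertex [r] the barycenter is already a vertex and nothing is
   subdivided. *)
Lemma facet_star K r a b : geo K -> r != fset0 -> two_cofaces K r a b ->
  let m := barycenter r in
  exists K0, [/\ geo K0, body K0 = body K, refines K0 K,
    forall t, K t -> ~~ (r `<=` t)%fset -> m \notin t &
    [/\ m != a, m != b, forall f, (f `<=` r)%fset -> ~~ (r `<=` f)%fset -> m \notin f &
    forall t, K0 t <-> (K t /\ ~~ (r `<=` t)%fset) \/
      exists c g, [/\ c = a \/ c = b, (g `<=` c |` r)%fset, ~~ (r `<=` g)%fset &
        t = (m |` g)%fset]]].
Proof.
move=> gK r0 [ar br ab [Ka Kb co]] m.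
have Kr : K r by apply: (geo_face gK Ka) => //; exact: fsubsetUr.
have co' t : K t -> (r `<=` t)%fset -> exists c, (c = a \/ c = b) /\ (t `<=` c |` r)%fset.
  by move=> Kt /(co _ Kt)[]; [exists a|exists b]; split=> //; [left|right].
have Kc c : c = a \/ c = b -> K (c |` r)%fset by case=> ->.
have [r1|r2] := eqVneq #|` r| 1%N.
  have /cardfs1P[v rv] : #|` r| == 1%N by rewrite r1.
  have mv : m = v by rewrite /m /barycenter r1 invr1 rv big_seq_fset1 scale1r.
  have rm t : (r `<=` t)%fset = (m \in t) by rewrite rv fsub1set mv.
  have mr : m \in r by rewrite -rm.
  exists K; split=> //; first exact: refines_refl.
    by move=> t _; rewrite rm.
  split.
  - by apply: contraNneq ar => <-.
  - by apply: contraNneq br => <-.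
  - by move=> f _; rewrite rm.
  move=> t; split=> [Kt|[[]//|[c [g [cab gc rg ->]]]]]; last first.
    apply: (geo_face gK (Kc _ cab)); last by apply/fset0Pn; exists m; rewrite !inE eqxx.
    by rewrite fsubUset gc fsub1set !inE mr orbT.
  have [rt|] := boolP (r `<=` t)%fset; last by left.
  right; have [c [cab tc]] := co' _ Kt rt; exists c, (t `\ m)%fset; split=> //.
  - by apply: fsubset_trans tc; exact: fsubsetDl.
  - by rewrite rm !inE eqxx.
  - by rewrite fsetD1K // -rm.
have r2' : (1 < #|` r|)%N by rewrite ltn_neqAle eq_sym r2 lt0n cardfs_eq0.
have rm : inner r m := inner_barycenter r0.
have fresh t : K t -> m \notin t by exact: (star_new gK Kr rm r2').
have mr : m \notin r by exact: fresh.
exists (star_at K r m); split.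
- exact: geo_star.
- exact: body_star.
- exact: star_refines.
- by move=> t Kt _; exact: fresh.
split.
- by apply: contraNneq (fresh _ Ka) => ->; rewrite !inE eqxx.
- by apply: contraNneq (fresh _ Kb) => ->; rewrite !inE eqxx.
- by move=> f fr _; apply: contra mr; apply/fsubsetP.
move=> t; split=> [[rt [Kt|[mt Ku]]]|[[Kt rt]|[c [g [cab gc rg ->]]]]].
- by left.
- right; have [c [cab tc]] := co' _ Ku (fsubsetUr _ _).
  exists c, (t `\ m)%fset; split=> //.
  + by apply: fsubset_trans tc; exact: fsubsetUl.
  + by apply: contra rt => /fsubset_trans; apply; exact: fsubsetDl.
  + by rewrite fsetD1K.
- by split=> //; left.
have mg : m \notin g.
  by apply: contra (fresh _ (Kc _ cab)); apply/fsubsetP.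
split.
  apply: contra rg => /fsubsetP h; apply/fsubsetP => z zr; have := h z zr.
  by rewrite !inE => /predU1P[zm|//]; rewrite -zm zr in mr.
right; rewrite !inE eqxx; split=> //; rewrite fsetU1K //.
apply: (geo_face gK (Kc _ cab)); first by rewrite fsubUset gc fsubsetUr.
by apply: contraNneq r0 => h; rewrite -fsubset0 -h fsubsetUr.
Qed.

Lemma nsub_fsetU1 r q f : q \notin r -> ~~ (r `<=` f)%fset -> ~~ (r `<=` q |` f)%fset.
Proof.
move=> qr; apply: contra => /fsubsetP h; apply/fsubsetP => z zr.
by have := h z zr; rewrite !inE => /predU1P[zq|//]; rewrite -zq zr in qr.
Qed.

(** * The star of a facet with one edge of its path subdivided *)

Section PathStar.
Context (K K0 : set {fset T}) (r : {fset T}) (m c d : T) (k : R).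
Hypotheses (gK0 : geo K0) (r0 : r != fset0) (cr : c \notin r) (dr : d \notin r) (cd : c != d).
Hypotheses (mc : m != c) (md : m != d) (k0 : 0 < k) (k1 : k < 1).
Hypothesis mK : forall t, K t -> ~~ (r `<=` t)%fset -> m \notin t.
Hypothesis mf : forall f, (f `<=` r)%fset -> ~~ (r `<=` f)%fset -> m \notin f.
Hypothesis K0E : forall t, K0 t <-> (K t /\ ~~ (r `<=` t)%fset) \/
  exists e g, [/\ e = c \/ e = d, (g `<=` e |` r)%fset, ~~ (r `<=` g)%fset &
    t = (m |` g)%fset].

Let y : T := (1 - k) *: m + k *: d.
Let e := [fset m; d]%fset.

(** The order inside each edge matters: it fixes the signs of the volumes compared later. *)
Definition on_path z1 z2 :=
  [\/ z1 = c /\ z2 = m, z1 = m /\ z2 = y | z1 = y /\ z2 = d].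

Let K0g q g : q = c \/ q = d -> (g `<=` q |` r)%fset -> ~~ (r `<=` g)%fset -> K0 (m |` g)%fset.
Proof. by move=> *; apply/K0E; right; exists q, g. Qed.

Let rU := @nsub_fsetU1 r.

Let r00 : ~~ (r `<=` fset0)%fset. Proof. by rewrite fsubset0. Qed.

Let Ke : K0 e.
Proof.
have -> : e = (m |` (d |` fset0))%fset by apply/fsetP => z; rewrite !inE orbF.
by apply: (K0g (or_intror erefl)); [rewrite fsetUS // fsub0set|exact: rU].
Qed.

Let ye : inner e y. Proof. exact: inner2. Qed.
Let e2 : (1 < #|` e|)%N. Proof. by rewrite cardfs2 md. Qed.

Lemma path_fresh t : K0 t -> y \notin t.
Proof. exact: star_new gK0 Ke ye e2 t. Qed.

Let ym : m != y.
Proof. by apply: contraNneq (path_fresh Ke) => <-; rewrite !inE eqxx. Qed.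
Let yd : d != y.
Proof. by apply: contraNneq (path_fresh Ke) => <-; rewrite !inE eqxx orbT. Qed.

Definition path_star := star_at K0 e y.

Lemma geo_path_star : geo path_star. Proof. exact: geo_star. Qed.
Lemma body_path_star : body path_star = body K0. Proof. exact: body_star. Qed.
Lemma path_star_refines : refines path_star K0. Proof. exact: star_refines. Qed.

Let sube t : (e `<=` t)%fset = (m \in t) && (d \in t).
Proof. by rewrite fsubUset !fsub1set. Qed.

Lemma path_star_old t : K t -> ~~ (r `<=` t)%fset -> path_star t.
Proof.
move=> Kt rt; split; first by rewrite sube (negbTE (mK Kt rt)).
by left; apply/K0E; left.
Qed.

Lemma path_star_on z1 z2 f : on_path z1 z2 -> (f `<=` r)%fset -> ~~ (r `<=` f)%fset ->
  path_star (z1 |` (z2 |` f))%fset.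
Proof.
move=> zz fr rf.
have df : d \notin f by apply: contra dr; apply/fsubsetP.
have Kd : K0 (m |` (d |` f))%fset by apply: (K0g (or_intror erefl)); [exact: fsetUS|exact: rU].
have ne : (m |` (d |` f))%fset != fset0 by apply/fset0Pn; exists m; rewrite !inE eqxx.
have dc : d != c by rewrite eq_sym.
have dm : d != m by rewrite eq_sym.
case: zz => -[-> ->]; split.
- by rewrite sube !inE (negbTE dc) (negbTE dm) (negbTE df) andbF.
- left; rewrite fsetUCA; apply: (K0g (or_introl erefl)); [exact: fsetUS|exact: rU].
- by rewrite sube !inE (negbTE yd) (negbTE dm) (negbTE df) andbF.
- right; rewrite !inE eqxx orbT; split=> //; apply: (geo_face gK0 Kd).
    apply/fsubsetP => z; rewrite !inE.
    by case: (z == y); case: (z == m); case: (z == d); case: (z \in f).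
  by apply/fset0Pn; exists m; rewrite !inE eqxx orbT.
- by rewrite sube !inE (negbTE ym) (negbTE md) (negbTE (mf fr rf)).
- right; rewrite !inE eqxx; split=> //; apply: (geo_face gK0 Kd).
    apply/fsubsetP => z; rewrite !inE.
    by case: (z == y); case: (z == m); case: (z == d); case: (z \in f).
  by apply/fset0Pn; exists m; rewrite !inE eqxx orbT.
Qed.

(** Together with [path_star_on] this describes the subdivision: the simplices of [K] not containing
    [r], plus the join of the path [c], [m], [y], [d] with the boundary of [r]. *)
Lemma path_star_cases t : path_star t -> (K t /\ ~~ (r `<=` t)%fset) \/
  exists z1 z2 f, [/\ on_path z1 z2, (f `<=` r)%fset, ~~ (r `<=` f)%fset &
    (t `<=` z1 |` (z2 |` f))%fset].
Proof.
have rI g : ~~ (r `<=` g)%fset -> ~~ (r `<=` g `&` r)%fset.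
  by apply: contra => /fsubset_trans; apply; exact: fsubsetIl.
rewrite /path_star /star_at /= sube negb_and.
move=> [mdt [/K0E[|[q [g [qcd gq rg tE]]]]|[yt /K0E[[Ku ru]|[q [g [qcd gq rg uE]]]]]]].
- by left.
- right; exists c, m, (g `&` r)%fset; split; [by constructor 1|exact: fsubsetIr|exact: rI|].
  have mt : m \in t by rewrite tE !inE eqxx.
  rewrite mt /= in mdt; apply/fsubsetP => z zt; move: (zt); rewrite tE !inE.
  case/predU1P => [->|zg]; first by rewrite eqxx orbT.
  have := fsubsetP gq _ zg; rewrite !inE zg /= => /predU1P[zq|->]; last by rewrite !orbT.
  case: qcd zq => -> zq; first by rewrite zq eqxx.
  by rewrite -zq zt in mdt.
- by have := mK Ku ru; rewrite !inE eqxx !orbT.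
right.
have dg : d \in g.
  have : d \in (m |` g)%fset by rewrite -uE !inE eqxx !orbT.
  by rewrite !inE eq_sym (negbTE md).
have qd : q = d.
  case: qcd => // qc; have := fsubsetP gq _ dg.
  by rewrite qc !inE eq_sym (negbTE cd) (negbTE dr).
have tg z : z \in t -> [|| z == y, z == m | z \in g].
  move=> zt; case: eqVneq => //= zy; have : z \in (m |` g)%fset by rewrite -uE !inE zy zt.
  by rewrite !inE.
have gd z : z \in g -> (z == d) || (z \in r).
  by move=> /(fsubsetP gq); rewrite qd !inE.
case/orP: mdt => [mt|dt].
  exists y, d, (g `&` r)%fset; split; [by constructor 3|exact: fsubsetIr|exact: rI|].
  apply/fsubsetP => z zt; rewrite !inE; have := tg _ zt.
  case: eqVneq => //= zy; case: eqVneq => [zm|zm /= zg]; first by rewrite -zm zt in mt.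
  by rewrite zg; exact: gd.
exists m, y, (g `&` r)%fset; split; [by constructor 2|exact: fsubsetIr|exact: rI|].
apply/fsubsetP => z zt; rewrite !inE; have := tg _ zt.
case: (eqVneq z m) => //= zm; case: eqVneq => //= zy zg; rewrite zg /=.
by case/orP: (gd _ zg) => // /eqP zd; rewrite -zd zt in dt.
Qed.

Lemma path_star_vertex t v : path_star t -> v \in t -> v = y \/ exists2 u, K0 u & v \in u.
Proof.
move=> [_ [Kt|[_ Ku]]] vt; first by right; exists t.
have [->|vy] := eqVneq v y; first by left.
by right; eexists; first exact: Ku; rewrite !inE vy vt.
Qed.

End PathStar.
End FacetStar.

(** * The sliding vertex map and the volumes it changes *)

Section PathShift.
Context (R : realType) (N : nat).
Local Notation T := 'rV[R]_N.
Implicit Types (s t r f g : {fset T}) (v x y z p q : T).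
Implicit Types (K L : set {fset T}).

Lemma hull_mix s p q (k : R) : 0 <= k -> k <= 1 -> hull s p -> hull s q ->
  hull s ((1 - k) *: p + k *: q).
Proof.
move=> k0 k1 [a [a0 a1 ->]] [b [b0 b1 ->]]; exists (fun v => (1 - k) * a v + k * b v); split.
- by move=> v vs; rewrite addr_ge0 // mulr_ge0 ?a0 ?b0 // subr_ge0.
- by rewrite big_split -!mulr_sumr /= a1 b1; ring.
- rewrite !scaler_sumr -big_split /=; apply: eq_bigr => v _.
  by rewrite [RHS]scalerDl !scalerA.
Qed.

Lemma hull_barycenter s : s != fset0 -> hull s (barycenter s).
Proof. by move=> /inner_barycenter[a ? _]; apply/hull_bary; exists a. Qed.

Definition shift_map (m y x v : T) := if v == m then x else if v == y then m else v.

Section Shift.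
Context (K K0 : set {fset T}) (r : {fset T}) (m c d : T) (k k' : R).
Hypotheses (gK0 : geo K0) (r0 : r != fset0) (cr : c \notin r) (dr : d \notin r) (cd : c != d).
Hypotheses (mc : m != c) (md : m != d) (k0 : 0 < k) (k1 : k < 1) (k0' : 0 < k') (k1' : k' < 1).
Hypothesis mK : forall t, K t -> ~~ (r `<=` t)%fset -> m \notin t.
Hypothesis mf : forall f, (f `<=` r)%fset -> ~~ (r `<=` f)%fset -> m \notin f.
Hypothesis K0E : forall t, K0 t <-> (K t /\ ~~ (r `<=` t)%fset) \/
  exists e g, [/\ e = c \/ e = d, (g `<=` e |` r)%fset, ~~ (r `<=` g)%fset &
    t = (m |` g)%fset].

(** The description of [K0] is symmetric in [c] and [d], so all that is known about subdividing
    [[m, d]] also serves for [[m, c]]. *)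
Let K0E' t : K0 t <-> (K t /\ ~~ (r `<=` t)%fset) \/
  exists e g, [/\ e = d \/ e = c, (g `<=` e |` r)%fset, ~~ (r `<=` g)%fset &
    t = (m |` g)%fset].
Proof.
rewrite K0E; split=> -[h|[e [g [ecd ? ? ?]]]]; [by left| |by left|];
  by right; exists e, g; split=> //; case: ecd; [right|left].
Qed.

Let dc : d != c. Proof. by rewrite eq_sym. Qed.
Let y : T := (1 - k) *: m + k *: d.
Let x : T := (1 - k') *: m + k' *: c.
Let L1 := path_star K0 m d k.
Let L2 := path_star K0 m c k'.

Let y_fresh t : K0 t -> y \notin t.
Proof. exact: (path_fresh gK0 r0 dr md k0 k1 K0E). Qed.
Let x_fresh t : K0 t -> x \notin t.
Proof. exact: (path_fresh gK0 r0 cr mc k0' k1' K0E'). Qed.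

Let K0cm f : (f `<=` r)%fset -> ~~ (r `<=` f)%fset -> K0 (c |` (m |` f))%fset.
Proof.
move=> fr rf; apply/K0E; right; exists c, (c |` f)%fset; split; first by left.
- exact: fsetUS.
- exact: nsub_fsetU1.
- exact: fsetUCA.
Qed.

Let K0dm f : (f `<=` r)%fset -> ~~ (r `<=` f)%fset -> K0 (d |` (m |` f))%fset.
Proof.
move=> fr rf; apply/K0E; right; exists d, (d |` f)%fset; split; first by right.
- exact: fsetUS.
- exact: nsub_fsetU1.
- exact: fsetUCA.
Qed.

Let r00 : ~~ (r `<=` fset0)%fset. Proof. by rewrite fsubset0. Qed.
Let Kcm := K0cm (fsub0set r) r00.
Let Kdm := K0dm (fsub0set r) r00.

Let in2 z1 z2 f : z1 \in (z1 |` (z2 |` f))%fset. Proof. by rewrite !inE eqxx. Qed.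
Let in2' z1 z2 f : z2 \in (z1 |` (z2 |` f))%fset. Proof. by rewrite !inE eqxx orbT. Qed.
Let in2f z1 z2 f z : z \in f -> z \in (z1 |` (z2 |` f))%fset.
Proof. by rewrite !inE => ->; rewrite !orbT. Qed.

Let neqK t u z : K0 t -> (forall t', K0 t' -> z \notin t') -> u \in t -> u != z.
Proof. by move=> Kt zf ut; apply: contraNneq (zf _ Kt) => <-. Qed.

Let ym : m != y. Proof. exact: neqK Kcm y_fresh (in2' _ _ _). Qed.
Let xm : m != x. Proof. exact: neqK Kcm x_fresh (in2' _ _ _). Qed.

Local Notation phi := (shift_map m y x).

Lemma shift_m : phi m = x. Proof. by rewrite /shift_map eqxx. Qed.
Lemma shift_y : phi y = m. Proof. by rewrite /shift_map eqxx eq_sym (negbTE ym). Qed.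
Lemma shift_K0 t v : K0 t -> v \in t -> v != m -> phi v = v.
Proof.
by move=> Kt vt vm; rewrite /shift_map (negbTE vm) (negbTE (neqK Kt y_fresh vt)).
Qed.
Lemma shift_c : phi c = c. Proof. by apply: (shift_K0 Kcm); rewrite ?in2 // eq_sym. Qed.
Lemma shift_d : phi d = d. Proof. by apply: (shift_K0 Kdm); rewrite ?in2 // eq_sym. Qed.

Lemma shift_f f v : (f `<=` r)%fset -> ~~ (r `<=` f)%fset -> v \in f -> phi v = v.
Proof.
move=> fr rf vf; apply: (shift_K0 (K0cm fr rf)); first exact: in2f.
by apply: contraTneq vf => ->; exact: mf.
Qed.

Lemma shift_old t v : K t -> ~~ (r `<=` t)%fset -> v \in t -> phi v = v.
Proof.
move=> Kt rt vt; apply: (@shift_K0 t) => //; first by apply/K0E; left.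
by apply: contraTneq vt => ->; exact: mK Kt rt.
Qed.

Lemma shift_img_old t : K t -> ~~ (r `<=` t)%fset -> image_simplex phi t = t.
Proof.
move=> Kt rt; apply/fsetP => v; apply/idP/idP.
  by move=> /imgP[u ut ->]; rewrite (shift_old Kt rt).
by move=> vt; apply/imgP; exists v; rewrite ?(shift_old Kt rt).
Qed.

Lemma shift_img_on z1 z2 f : (f `<=` r)%fset -> ~~ (r `<=` f)%fset ->
  image_simplex phi (z1 |` (z2 |` f))%fset = (phi z1 |` (phi z2 |` f))%fset.
Proof.
move=> fr rf; apply/fsetP => v; apply/idP/idP.
  move=> /imgP[u + ->]; rewrite !inE => /or3P[/eqP ->|/eqP ->|uf]; rewrite ?eqxx ?orbT //.
  by rewrite (shift_f fr rf) // uf !orbT.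
rewrite !inE => /or3P[/eqP ->|/eqP ->|vf]; apply/imgP.
- by exists z1; rewrite ?in2.
- by exists z2; rewrite ?in2'.
- by exists v; rewrite ?in2f // (shift_f fr rf).
Qed.

(** The path [c], [m], [y], [d] goes to [c], [x], [m], [d] edge by edge, and all other vertices are
    fixed. *)
Lemma shift_simplex s : L1 s -> L2 (image_simplex phi s).
Proof.
move=> Ls; have := path_star_cases dr cd md mK K0E Ls.
have gL1 : geo L1 by exact: (geo_path_star gK0 r0 dr md k0 k1 K0E).
have gL2 : geo L2 by exact: (geo_path_star gK0 r0 cr mc k0' k1' K0E').
have on := path_star_on gK0 r0 dr cr dc mc k0' k1' mf K0E'.
case=> [[Ks rs]|[z1 [z2 [f [zz fr rf sz]]]]].
  by rewrite (shift_img_old Ks rs); exact: (path_star_old k' mK K0E' Ks rs).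
have L2z : L2 (phi z1 |` (phi z2 |` f))%fset.
  (* In [L2] the path is read from [d] to [c]; hence the exchanged vertices and the reversed
     numbering of the three cases. *)
  case: zz => -[-> ->]; rewrite ?shift_c ?shift_d ?shift_m ?shift_y.
  - by rewrite fsetUCA; apply: on => //; constructor 3.
  - by rewrite fsetUCA; apply: on => //; constructor 2.
  - by rewrite fsetUCA; apply: on => //; constructor 1.
apply: (geo_face gL2 L2z).
  rewrite -(shift_img_on _ _ fr rf); apply/fsubsetP => v /imgP[u us ->].
  by apply/imgP; exists u => //; exact: fsubsetP sz _ us.
have /fset0Pn[v vs] := geo_neq0 gL1 Ls.
by apply/fset0Pn; exists (phi v); apply/imgP; exists v.
Qed.

Lemma shiftK s v : L1 s -> v \in s -> shift_map m x y (phi v) = v.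
Proof.
move=> Ls vs; case: (path_star_vertex Ls vs) => [->|[u Ku vu]].
  by rewrite -/y shift_y /shift_map eqxx.
have [->|vm] := eqVneq v m.
  by rewrite shift_m /shift_map eqxx eq_sym (negbTE xm).
rewrite (shift_K0 Ku vu vm) /shift_map (negbTE vm).
by rewrite (negbTE (neqK Ku x_fresh vu)).
Qed.

End Shift.

Definition cons_mx m z (X : 'M[R]_(m, N)) : 'M[R]_(m.+1, N) :=
  \matrix_i (if unlift ord0 i is Some j then row j X else z).

Lemma row_cons0 m z (X : 'M[R]_(m, N)) : row ord0 (cons_mx z X) = z.
Proof. by rewrite rowK unlift_none. Qed.

Lemma row_consS m z (X : 'M[R]_(m, N)) i : row (lift ord0 i) (cons_mx z X) = row i X.
Proof. by rewrite rowK liftK. Qed.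

Lemma eq_rows m (Q Q' : 'M[R]_(m.+1, N)) : row ord0 Q = row ord0 Q' ->
  (forall i, row (lift ord0 i) Q = row (lift ord0 i) Q') -> Q = Q'.
Proof.
by move=> e0 eS; apply/row_matrixP => i; case: (unliftP ord0 i) => [j ->|->].
Qed.

Lemma edges_cons n z (X : 'M[R]_(n, N)) : edges (cons_mx z X) = edges_from z X.
Proof. by apply/row_matrixP => i; rewrite row_edges row_cons0 row_consS rowK. Qed.

Lemma ordered_cons m z f (X : 'M[R]_(m, N)) : z \notin f -> ordered f X ->
  ordered (z |` f)%fset (cons_mx z X).
Proof.
move=> zf fX; have [e iX] := fX; split=> [v|i j].
  rewrite !inE; split=> [/predU1P[->|/e[i <-]]|[i <-]].
  - by exists ord0; rewrite row_cons0.
  - by exists (lift ord0 i); rewrite row_consS.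
  - case: (unliftP ord0 i) => [j ->|->]; last by rewrite row_cons0 eqxx.
    by rewrite row_consS (ordered_mem j fX) orbT.
have zX k : z <> row k X by move=> zE; rewrite zE (ordered_mem k fX) in zf.
case: (unliftP ord0 i) => [i' ->|->]; case: (unliftP ord0 j) => [j' ->|->] //=;
  rewrite ?row_cons0 ?row_consS //.
- by move=> /iX ->.
- by move=> /esym/zX.
- by move=> /zX.
Qed.

Lemma map_cons m (h : T -> T) z (X : 'M[R]_(m, N)) :
  \matrix_i h (row i (cons_mx z X)) = cons_mx (h z) (\matrix_i h (row i X)).
Proof.
apply: eq_rows => [|i]; rewrite rowK ?row_cons0 ?row_consS //.
by rewrite rowK.
Qed.

Lemma edges_in_hull n s (Q : 'M[R]_(n.+1, N)) : (forall i, hull s (row i Q)) ->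
  rows_in (tangent s) (edges Q).
Proof.
move=> sQ i; rewrite row_edges.
have tE : tangent [fset row (lift ord0 i) Q; row ord0 Q]%fset = tangent [fset row (lift ord0 i) Q; row ord0 Q]%fset by [].
have /subvP : (tangent [fset row (lift ord0 i) Q; row ord0 Q]%fset <= tangent s)%VS.
  apply: tangent_sub_hull; apply: hull_convex => v.
  by rewrite !inE => /orP[] /eqP ->.
by apply; apply: memv_span; apply: allpairs_f; rewrite !inE eqxx ?orbT.
Qed.

(** * Volumes of simplices with two movable vertices *)

Section VolumeMix.
Context (n : nat) (s : {fset T}) (w : 'M[R]_(n.+1, N) -> R) (Y : 'M[R]_(n, N)).
Hypotheses (ws : nform_on (tangent s) w) (sY : forall i, hull s (row i Y)).

Local Notation vol z1 z2 := (w (edges (cons_mx z1 (cons_mx z2 Y)))).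

Let hull2 z1 z2 : hull s z1 -> hull s z2 -> forall i, hull s (row i (cons_mx z1 (cons_mx z2 Y))).
Proof.
move=> h1 h2 i; case: (unliftP ord0 i) => [j ->|->]; rewrite ?row_cons0 // row_consS.
by case: (unliftP ord0 j) => [l ->|->]; rewrite ?row_cons0 // row_consS.
Qed.

Lemma vol_swap z1 z2 : hull s z1 -> hull s z2 -> vol z1 z2 = - vol z2 z1.
Proof.
move=> h1 h2; pose p := tperm (ord0 : 'I_n.+2) (lift ord0 ord0).
have -> : cons_mx z1 (cons_mx z2 Y) = row_perm p (cons_mx z2 (cons_mx z1 Y)).
  apply: eq_rows => [|i]; rewrite row_row_perm ?tpermL ?row_consS ?row_cons0 //.
  case: (unliftP ord0 i) => [j ->|->]; last by rewrite tpermR !row_cons0.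
  by rewrite tpermD // !row_consS.
rewrite (form_edges_perm p (edges_in_hull (hull2 h2 h1)) ws) odd_tperm.
by rewrite (_ : ord0 != lift ord0 ord0) // mulN1r.
Qed.

Lemma vol_mix1 z1 z2 (k : R) : hull s z1 -> hull s z2 ->
  vol z1 ((1 - k) *: z2 + k *: z1) = (1 - k) * vol z1 z2.
Proof.
move=> h1 h2; pose c (i : 'I_n.+2) := if i == ord0 then k else if i == lift ord0 ord0 then 1 - k else 0.
have cS j : c (lift ord0 (lift ord0 j)) = 0 by [].
have c1 : \sum_i c i = 1.
  by rewrite !big_ord_recl big1 /c //= addr0 addrC subrK.
have := form_replace (lift ord0 ord0) (edges_in_hull (hull2 h1 h2)) ws c1.
rewrite {2}/c /= => <-; congr (w (edges _)).
have -> : \sum_i c i *: row i (cons_mx z1 (cons_mx z2 Y)) = (1 - k) *: z2 + k *: z1.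
  rewrite !big_ord_recl big1 ?addr0; last by move=> j _; rewrite cS scale0r.
  by rewrite row_cons0 row_consS row_cons0 addrC.
apply: eq_rows => [|i]; rewrite row_setrow ?row_cons0 // row_consS.
case: (unliftP ord0 i) => [j ->|->]; last by rewrite row_cons0 eqxx.
by rewrite !row_consS (_ : (_ == _) = false).
Qed.

Lemma vol_mix0 z1 z2 (k : R) : hull s z1 -> hull s z2 -> 0 <= k -> k <= 1 ->
  vol ((1 - k) *: z2 + k *: z1) z2 = k * vol z1 z2.
Proof.
move=> h1 h2 k0 k1; have hm := hull_mix k0 k1 h2 h1.
rewrite vol_swap // (vol_swap h1 h2) mulrN; congr (- _).
have -> : (1 - k) *: z2 + k *: z1 = (1 - (1 - k)) *: z1 + (1 - k) *: z2.
  by rewrite subKr addrC.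
by rewrite vol_mix1 // subKr.
Qed.

(** Of the n+1 equal coefficients of the barycenter only the one at [v] counts, since the other
    vertices already occur as rows of [Y]. *)
Lemma vol_barycenter z v f : ordered f Y -> v \notin f -> hull s z -> hull s v ->
  vol z (barycenter (v |` f)%fset) = n.+1%:R^-1 * vol z v.
Proof.
move=> fY vf hz hv; have vY := ordered_cons vf fY.
pose c (i : 'I_n.+2) := if i == ord0 then 0 else n.+1%:R^-1 : R.
have cS j : c (lift ord0 j) = n.+1%:R^-1 by [].
have c1 : \sum_i c i = 1.
  rewrite big_ord_recl add0r (eq_bigr (fun=> n.+1%:R^-1)) // sumr_const card_ord.
  by rewrite -(mulr_natr _^-1) mulVf // pnatr_eq0.
have := form_replace (lift ord0 ord0) (edges_in_hull (hull2 hz hv)) ws c1.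
rewrite {2}/c /= => <-; congr (w (edges _)).
have -> : \sum_i c i *: row i (cons_mx z (cons_mx v Y)) = barycenter (v |` f)%fset.
  rewrite big_ord_recl scale0r add0r /barycenter (ordered_sum _ vY) (ordered_card vY).
  by apply: eq_bigr => i _; rewrite row_consS.
apply: eq_rows => [|i]; rewrite row_setrow ?row_cons0 // row_consS.
case: (unliftP ord0 i) => [j ->|->]; last by rewrite row_cons0 eqxx.
by rewrite !row_consS (_ : (_ == _) = false).
Qed.

End VolumeMix.
End PathShift.

Section FacetMove.
Context (R : realType) (N n : nat).
Local Notation T := 'rV[R]_N.
Implicit Types (s t r f g : {fset T}) (v x y z p q : T).
Implicit Types (K L : set {fset T}).

Lemma bool_card_max (b1 b2 : bool) (k m : nat) : (m.+2 <= b1 + (b2 + k))%N -> (k <= m)%N ->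
  [/\ b1, b2 & k = m].
Proof.
move=> h km; have : ((b1 + b2 == 2) && (k == m))%N by case: b1 b2 h => -[] /=; lia.
by case: b1 b2 h => -[] //= _ /eqP.
Qed.

(** It suffices to compare volumes on the three edges of the path, each joined with a maximal proper
    face of [r]. The last hypothesis is the balance of the transfer: what leaves the simplex over
    [a] enters the one over [b], written with signed volumes. *)
Lemma facet_move K r a b (w : {fset T} -> 'M[R]_(n.+1, N) -> R) (l l' : {fset T} -> R) :
  geo K -> dim_le n.+1 K -> #|` r| = n.+1 -> two_cofaces K r a b -> forms_on K w ->
  (forall s, s != (a |` r)%fset -> s != (b |` r)%fset -> l s = l' s) ->
  0 < l' (a |` r)%fset < l (a |` r)%fset -> 0 < l (b |` r)%fset < l' (b |` r)%fset ->
  (forall X : 'M[R]_(n.+1, N), ordered r X ->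
    (l (b |` r)%fset - l' (b |` r)%fset) * w (b |` r)%fset (edges (cons_mx b X)) =
    (l (a |` r)%fset - l' (a |` r)%fset) * w (a |` r)%fset (edges (cons_mx a X))) ->
  pc_equiv K (fun s M => l s * w s M) (fun s M => l' s * w s M).
Proof.
move=> gK dK rn co wf ll /andP[la0 la] /andP[lb0 lb] vol.
have r0 : r != fset0 by rewrite -cardfs_eq0 rn.
have [ar br ab [Ka Kb cof]] := co.
have ba : b != a by rewrite eq_sym.
have [K0 [g0 b0 r0K mK [ma mb mf K0E]]] := facet_star gK r0 co.
set m := barycenter r in mK ma mb mf K0E.
have K0E' t : K0 t <-> (K t /\ ~~ (r `<=` t)%fset) \/
    exists c g, [/\ c = b \/ c = a, (g `<=` c |` r)%fset, ~~ (r `<=` g)%fset &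
      t = (m |` g)%fset].
  rewrite K0E; split=> -[h|[e [g [ecd ? ? ?]]]]; [by left| |by left|];
    by right; exists e, g; split=> //; case: ecd; [right|left].
set S := (a |` r)%fset in Ka la0 la ll vol *; set U := (b |` r)%fset in Kb lb0 lb ll vol *.
(* The outer pieces dictate the constants. The piece from [a] to [m] goes onto the one from [a] to
   [x], so [(1 - k') * l S] must be [l' S]; the piece from [y] to [b] goes onto the one from [m] to
   [b], so [(1 - k) * l' U] must be [l U]. *)
pose k := 1 - l U / l' U; pose k' := 1 - l' S / l S.
have lU0 : 0 < l' U by exact: lt_trans lb.
have lS0 : 0 < l S by exact: lt_trans la.
have kp : l U / l' U < 1 by rewrite ltr_pdivrMr // mul1r.
have kp' : l' S / l S < 1 by rewrite ltr_pdivrMr // mul1r.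
have kq : 0 < l U / l' U by rewrite divr_gt0.
have kq' : 0 < l' S / l S by rewrite divr_gt0.
have k0 : 0 < k by rewrite /k; lra.
have k1 : k < 1 by rewrite /k; lra.
have k0' : 0 < k' by rewrite /k'; lra.
have k1' : k' < 1 by rewrite /k'; lra.
set y : T := (1 - k) *: m + k *: b; set x : T := (1 - k') *: m + k' *: a.
pose phi := shift_map m y x.
have g1 := geo_path_star g0 r0 br mb k0 k1 K0E.
have g2 := geo_path_star g0 r0 ar ma k0' k1' K0E'.
have B1 := body_path_star g0 r0 br mb k0 k1 K0E.
have B2 := body_path_star g0 r0 ar ma k0' k1' K0E'.
have R1 : refines (path_star K0 m b k) K0 by exact: path_star_refines.
have R2 : refines (path_star K0 m a k') K0 by exact: path_star_refines.
have fm : phi m = x by exact: shift_m.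
have fy : phi y = m := shift_y k' g0 r0 ar br mb k0 k1 K0E.
have fa : phi a = a := shift_c k' g0 r0 ar br ma mb k0 k1 K0E.
have fb : phi b = b := shift_d k' g0 r0 br mb k0 k1 K0E.
have ff f v := @shift_f _ _ _ _ _ _ _ _ _ k' g0 r0 ar br mb k0 k1 mf K0E f v.
have scale_form (c : {fset T} -> R) : forms_on K (fun s M => c s * w s M).
  move=> s Ks; have [w1 w2] := wf _ Ks; split=> [i M A B p q *|i j M MD ij e].
    by rewrite (w1 i M A B p q) //; ring.
  by rewrite (w2 i j) ?mulr0.
apply: (@simplicial_pc_equiv _ _ _ K (path_star K0 m b k) (path_star K0 m a k') _ _ phi (shift_map m x y)) => //.
- by rewrite B1.
- by rewrite B2.
- exact: refines_trans R1 r0K.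
- exact: refines_trans R2 r0K.
- by move=> s; apply: (shift_simplex g0 r0 ar br ab ma mb k0 k1 k0' k1' mK mf K0E).
- by move=> s; apply: (shift_simplex g0 r0 br ar ba mb ma k0' k1' k0 k1 mK mf K0E').
- by move=> s v; apply: (shiftK g0 r0 ar br ma mb k0 k1 k0' k1' K0E).
- by move=> s v; apply: (shiftK g0 r0 br ar mb ma k0' k1' k0 k1 K0E').
move=> s s1 t1 Ls sn fsn Ks1 Kt1 st1 fs1.
have [[Ks rs]|[z1 [z2 [f [zz fr rf sz]]]]] := path_star_cases br ab mb mK K0E Ls.
  have fs : image_simplex phi s = s := shift_img_old k' g0 r0 br mb k0 k1 mK K0E Ks rs.
  have hss : hull s `<=` hull s by [].
  have [s1E _] := hull_simplex_uniq gK dK sn Ks Kt1 hss st1.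
  rewrite fs in fs1; have [s2E _] := hull_simplex_uniq gK dK sn Ks Ks1 hss fs1.
  exists (\matrix_(i < n.+2) nth 0 s i); first exact: ordered_nth sn.2.
  rewrite -s1E -s2E ll //; last 2 first.
  + by apply: contraNneq rs => ->; exact: fsubsetUr.
  + by apply: contraNneq rs => ->; exact: fsubsetUr.
  congr (_ * w s (edges _)); apply/row_matrixP => i; rewrite !rowK.
  by apply: (shift_old k' g0 r0 br mb k0 k1 mK K0E Ks rs); rewrite mem_nth // sn.2.
(* Counting vertices: [f] is a proper face of [r], so [s] can have n+2 vertices only if [f] has
   exactly n and [s] is the full join of [f] with the edge of the path. *)
have fn : (#|` f| <= n)%N.
  have fpr : (f `<` r)%fset.
    rewrite fproperEneq fr andbT; apply: contraNneq rf => ->; exact: fsubset_refl.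
  by rewrite -ltnS -rn; exact: fproper_ltn_card.
have cU z (g : {fset T}) : #|` (z |` g)%fset| = ((z \notin g) + #|` g|)%N by rewrite cardfsU1.
have : (n.+2 <= #|` (z1 |` (z2 |` f))%fset|)%N by rewrite -sn.2; exact: fsubset_leq_card.
rewrite !cU => cz.
have [z1n z2n fE] := bool_card_max cz fn.
have sE : s = (z1 |` (z2 |` f))%fset.
  by apply/eqP; rewrite eqEfcard sz !cU z1n z2n fE sn.2 !add1n leqnn.
have /fsubsetPn[v vr vf] := rf.
have rE : r = (v |` f)%fset.
  by apply/esym/eqP; rewrite eqEfcard fsubUset fsub1set vr fr cU vf fE rn add1n leqnn.
have fY := ordered_nth fE; set Y := \matrix_(i < n) nth 0 f i in fY.
exists (cons_mx z1 (cons_mx z2 Y)); first by rewrite sE; apply: ordered_cons => //; exact: ordered_cons.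
have -> : \matrix_i phi (row i (cons_mx z1 (cons_mx z2 Y))) = cons_mx (phi z1) (cons_mx (phi z2) Y).
  rewrite !map_cons; congr (cons_mx _ (cons_mx _ _)); apply/row_matrixP => i.
  by rewrite rowK; apply: (ff f) => //; exact: (ordered_mem i fY).
have fsE : image_simplex phi s = (phi z1 |` (phi z2 |` f))%fset.
  by rewrite sE; apply: (shift_img_on k' g0 r0 ar br mb k0 k1 mf K0E).
have hYr i : hull r (row i Y) by apply: hull_vertex; apply: (fsubsetP fr); exact: (ordered_mem i fY).
have sub (c : T) : hull r `<=` hull (c |` r)%fset by apply: hull_sub; exact: fsubsetUr.
have hm : hull r m by exact: hull_barycenter.
have top (c : T) : hull (c |` r)%fset c by apply: hull_vertex; rewrite !inE eqxx.
have hy : hull U y by apply: hull_mix => //; rewrite ?ltW //; [exact: sub|exact: top].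
have hx : hull S x by apply: hull_mix => //; rewrite ?ltW //; [exact: sub|exact: top].
have hSY i : hull S (row i Y) by exact: sub.
have hUY i : hull U (row i Y) by exact: sub.
have hUm : hull U m by exact: sub. have hSm : hull S m by exact: sub.
have hUb : hull U b by exact: top. have hSa : hull S a by exact: top.
have hUv : hull U v by apply: hull_vertex; rewrite !inE vr orbT.
have hSv : hull S v by apply: hull_vertex; rewrite !inE vr orbT.
have hull3 V p q : hull V p -> hull V q -> hull r `<=` hull V -> hull (p |` (q |` f))%fset `<=` hull V.
  move=> Vp Vq rV; apply: hull_convex => z; rewrite !inE => /or3P[/eqP ->|/eqP ->|zf] //.
  by apply/rV/hull_vertex; exact: (fsubsetP fr).
have srcE V : K V -> hull V z1 -> hull V z2 -> hull r `<=` hull V -> V = t1 /\ is_simplex n.+1 V.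
  move=> KV V1 V2 rV; apply: (hull_simplex_uniq gK dK sn KV Kt1) => //.
  by rewrite sE; exact: hull3.
have tgtE V : K V -> hull V (phi z1) -> hull V (phi z2) -> hull r `<=` hull V -> V = s1 /\ is_simplex n.+1 V.
  move=> KV V1 V2 rV; apply: (hull_simplex_uniq gK dK fsn KV Ks1) => //.
  by rewrite fsE; exact: hull3.
have wS : is_simplex n.+1 S -> nform_on (tangent S) (w S) by move=> ?; exact: wf.
have wU : is_simplex n.+1 U -> nform_on (tangent U) (w U) by move=> ?; exact: wf.
have mE : m = barycenter (v |` f)%fset by rewrite -rE.
have l1 : (1 - k') * l S = l' S by rewrite /k' subKr divfK // gt_eqF.
have l2 : (1 - k) * l' U = l U by rewrite /k subKr divfK // gt_eqF.
case: zz => -[e1 e2]; rewrite e1 e2 in srcE tgtE *.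
- rewrite fa fm in tgtE *.
  have [<- Sn] := srcE _ Ka hSa hSm (sub a); have [<- _] := tgtE _ Ka hSa hx (sub a).
  by rewrite (vol_mix1 (wS Sn) hSY) // mulrA [l S * _]mulrC l1.
(* The middle piece passes from [U] to [S]. Its two volumes are the fractions [k] and [k'] of those
   between the apex and [m]; the factor 1/(n+1) from the barycenter is common, and what remains is
   the balance hypothesis. *)
- rewrite fm fy in tgtE *.
  have [<- Un] := srcE _ Kb hUm hy (sub b); have [<- Sn] := tgtE _ Ka hx hSm (sub a).
  rewrite (vol_mix0 (wS Sn) hSY) ?(ltW k0') ?(ltW k1') //.
  rewrite (vol_swap (wU Un) hUY) // (vol_mix0 (wU Un) hUY) ?(ltW k0) ?(ltW k1) //.
  rewrite mE (vol_barycenter (wU Un) hUY fY vf) // (vol_barycenter (wS Sn) hSY fY vf) //.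
  have vX : ordered r (cons_mx v Y) by rewrite rE; exact: ordered_cons.
  have := vol _ vX.
  set E1 := w S _; set E2 := w U _ => e.
  have h1 : l S * k' = l S - l' S by rewrite -l1; ring.
  have h2 : l' U * k = l' U - l U by rewrite -l2; ring.
  have -> : l S * (k' * (n.+1%:R^-1 * E1)) = n.+1%:R^-1 * ((l S - l' S) * E1) by rewrite -h1; ring.
  have -> : l' U * - (k * (n.+1%:R^-1 * E2)) = n.+1%:R^-1 * - ((l' U - l U) * E2) by rewrite -h2; ring.
  by rewrite -e; ring.
- rewrite fy fb in tgtE *.
  have [<- Un] := srcE _ Kb hy hUb (sub b); have [<- _] := tgtE _ Kb hUm hUb (sub b).
  have yE : y = (1 - (1 - k)) *: b + (1 - k) *: m by rewrite subKr addrC.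
  rewrite -/y yE (vol_mix0 (wU Un) hUY) //; last 2 first.
  + by rewrite subr_ge0 ltW.
  + by rewrite gerBl ltW.
  by rewrite mulrA [l' U * _]mulrC l2.
Qed.

End FacetMove.

(** * Connectedness of the dual graph *)

Section Charts.
Context (R : realType) (N d : nat).
Local Notation T := 'rV[R]_N.
Local Notation D := 'rV[R]_d.
Implicit Types (s t r : {fset T}) (x : T).

(* A local inverse [g] of a chart; each of its values [g z] determines [z]
   through one of finitely many affine maps. *)
Lemma local_chart (P : set T) x : pl_boundary d P = set0 -> P x ->
  exists (y0 : D) (e : R) (g : D -> T) (cs : seq ('M[R]_(N, d) * D)),
    [/\ 0 < e, forall z, ball y0 e z -> {for z, continuous g},
        forall z, ball y0 e z -> P (g z) /\ exists2 c, c \in cs & z = g z *m c.1 + c.2 &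
        exists2 O, nbhs x O & forall x', O x' -> P x' -> exists2 z, ball y0 e z & g z = x'].
Proof.
move=> bP Px; have : ~ pl_boundary d P x by rewrite bP.
rewrite /pl_boundary /= => /not_andP[//|/contrapT[X [Y [h [XP nX [K [L [[cK bK] [cL bL] [hh ha]]]] iY]]]]].
rewrite bK bL in hh; have [[hXY hI hS] [g [gh hc gc]]] := hh.
have Xx : X x.
  by have : within P (nbhs x) X by []; rewrite /within /= => /nbhs_singleton; exact.
(* Local finiteness leaves finitely many simplices of [K] near [x]. Their affine maps form the list
   [cs], once the ball is small enough for [g] to map it into [U]. *)
have [U nU fU] : exists2 U : set T, nbhs x U & finite_set [set s | K s /\ hull s `&` U !=set0].
  by apply: complex_locally_finite cK _ _; rewrite bK.
have hx : g (h x) = x by apply: gh; rewrite inE.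
have gcI z : interior Y z -> {for z, continuous g}.
  move=> Yz; have := gc z; rewrite /continuous_at /prop_for.
  by rewrite (nbhs_subspace_interior Yz).
have /nbhs_ballP[e /= e0 De] : nbhs (h x) (interior Y `&` g @^-1` U).
  apply: filterI; first by apply: nbhs_interior.
  by apply: (gcI _ iY); rewrite hx.
have /choice[A AE] : forall s, exists c : 'M[R]_(N, d) * D, K s ->
    forall z, hull s z -> h z = z *m c.1 + c.2.
  move=> s; have [/ha[[A [b hE]] _]|?] := pselect (K s); last by exists (0, 0).
  by exists (A, b).
have hg z : Y z -> X (g z) /\ h (g z) = z.
  by move=> /hS[z' Xz' <-]; rewrite gh ?inE.
exists (h x), e, g, [seq A s | s <- fset_set [set s | K s /\ hull s `&` U !=set0]].
split=> //.
- by move=> z /De[/gcI].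
- move=> z /De[/interior_subset/hg[Xg hgz] Ug]; split; first exact: XP.
  have [s Ks sg] : body K (g z) by rewrite bK.
  exists (A s); last by rewrite -(AE _ Ks) ?hgz.
  by apply: map_f; rewrite in_fset_set // inE; split=> //; exists (g z).
- have hD : nbhs x [set x' | X x' -> ball (h x) e (h x')].
    have hcx : h @ within X (nbhs x) --> h x by rewrite (nbhs_subspace_in Xx); exact: hc.
    exact: (hcx _ (nbhsx_ballx (h x) e e0)).
    exists ([set x' | X x' -> ball (h x) e (h x')] `&` [set x' | P x' -> X x']).
    exact: filterI.
  move=> x' [h1 h2] Px'; have Xx' := h2 Px'; exists (h x'); first exact: h1.
  by apply: gh; rewrite inE.
Qed.

Lemma exists_normal q (M : 'M[R]_(q, d)) : (q < d)%N -> exists2 c : 'cV[R]_d, c != 0 & M *m c = 0.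
Proof.
move=> qd; have : kermx M^T != 0.
  rewrite kermx_eq0 /row_free neq_ltn; apply/orP; left.
  by apply: leq_ltn_trans qd; exact: rank_leq_col.
move=> /rowV0Pn[c /sub_kermxP cM c0]; exists c^T.
  by apply: contraNneq c0 => /(congr1 trmx); rewrite trmxK trmx0 => ->.
by apply: trmx_inj; rewrite trmx_mul trmxK trmx0.
Qed.

(** Fewer than d points of R^d, together with [p], lie on a hyperplane. *)
Lemma hull_normal s (A : 'M[R]_(N, d)) (b p : D) : (#|` s| < d)%N ->
  exists2 c : 'cV[R]_d, c != 0 & forall x, hull s x -> (x *m A + b - p) *m c = 0.
Proof.
move=> sd; have [c c0 cE] := exists_normal (\matrix_(i < #|` s|) (nth 0 s i *m A + b - p)) sd.
exists c => // x /hull_bary[a [_ _ a1 ->]].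
have -> : (\sum_(v <- s) a v *: v) *m A + b - p = \sum_(v <- s) a v *: (v *m A + b - p).
  rewrite mulmx_suml -addrA -[b - p in LHS]scale1r -a1 scaler_suml -big_split /=.
  by apply: eq_bigr => v _; rewrite -addrA [RHS]scalerDr scalemxAl.
rewrite mulmx_suml big1_seq // => v /andP[_ vs].
rewrite -scalemxAl; suff -> : (v *m A + b - p) *m c = 0 by rewrite scaler0.
have iv : (index v s < #|` s|)%N by rewrite index_mem.
move/row_matrixP/(_ (Ordinal iv)): cE; rewrite row_mul rowK /= nth_index // => ->.
by rewrite row0.
Qed.

(** With one vertex as base point, d points of R^d still lie on a hyperplane, though no longer one
    through a prescribed point. *)
Lemma hull_normal_cst s (A : 'M[R]_(N, d)) (b : D) : (#|` s| <= d)%N -> s != fset0 ->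
  exists (c : 'cV[R]_d) k, c != 0 /\ forall x, hull s x -> ((x *m A + b) *m c) 0 0 = k.
Proof.
move=> sd /fset0Pn[v vs].
have sd' : (#|` (s `\ v)%fset| < d)%N.
  by move: sd; rewrite (cardfsD1 v) vs.
have [c c0 cE] := hull_normal A b (v *m A + b) sd'.
exists c, (((v *m A + b) *m c) 0 0); split=> // x /hull_bary[a [_ _ a1 ->]].
suff e : (\sum_(u <- s) a u *: u) *m A + b - (v *m A + b) = \sum_(u <- s) a u *: (u *m A + b - (v *m A + b)).
  have : ((\sum_(u <- s) a u *: u) *m A + b - (v *m A + b)) *m c = 0.
    rewrite e mulmx_suml big1_seq // => u /andP[_ us]; rewrite -scalemxAl.
    have [->|uv] := eqVneq u v; first by rewrite subrr mul0mx scaler0.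
    by rewrite cE ?scaler0 //; apply: hull_vertex; rewrite !inE uv us.
  by rewrite mulmxBl => /eqP; rewrite subr_eq0 => /eqP ->.
rewrite mulmx_suml -addrA -[b - _ in LHS]scale1r -a1 scaler_suml -big_split /=.
by apply: eq_bigr => u _; rewrite -addrA [RHS]scalerDr scalemxAl.
Qed.

(** The hyperplanes are avoided one after the other: a point on the next one is pushed off, inside
    the open set, along a coordinate direction in which the normal vector is nonzero. *)
Lemma generic_point (cs : seq ('cV[R]_d * R)) (O : set D) : open O -> O !=set0 ->
  (forall c, c \in cs -> c.1 != 0) ->
  exists2 z, O z & forall c, c \in cs -> (z *m c.1) 0 0 != c.2.
Proof.
elim: cs O => [|[c k] cs IH] O oO [z Oz] cs0; first by exists z.
have c0 : c != 0 by apply: (cs0 (c, k)); rewrite inE eqxx.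
pose H := ev (c, - k) @^-1` [set y : R | y != 0].
have HE y : H y <-> (y *m c) 0 0 != k by rewrite /H /ev /= subr_eq0.
have oH : open H.
  apply: open_comp; first by move=> y _; exact: ev_continuous.
  exact: open_neq.
have [|||z' [Oz' Hz'] z'E] := IH (O `&` H).
- exact: openI.
- have [Hz|/negPn/eqP zk] := boolP ((z *m c) 0 0 != k); first by exists z; split=> //; apply/HE.
  have [i ci] : exists i, c i 0 != 0.
    apply: contrapT => ci; case/eqP: c0; apply/colP => i; rewrite mxE.
    by apply: contrapT => /eqP ?; apply: ci; exists i.
  have cl : continuous (fun t : R => t *: (delta_mx 0 i : D) + z).
    move=> t; apply: cvgD; last exact: cvg_cst.
    by apply: cvgZr_tmp; exact: cvg_id.
  have := cl 0; rewrite /continuous_at scale0r add0r => /(_ O (open_nbhs_nbhs (conj oO Oz))).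
  move=> /nbhs_ballP[e /= e0 eO].
  exists ((e / 2) *: (delta_mx 0 i : D) + z); split.
    apply: eO; rewrite /ball /= sub0r normrN gtr0_norm; lra.
  apply/HE; rewrite mulmxDl [_ 0 0]mxE zk -[X in _ != X]add0r (inj_eq (addIr _)).
  by rewrite -scalemxAl mxE -rowE mxE mulf_neq0 // gt_eqF //; lra.
- by move=> c' c's; apply: cs0; rewrite inE c's orbT.
exists z' => // c'; rewrite inE => /predU1P[->|/z'E //]; exact/HE.
Qed.

End Charts.

(** * Classes of top simplices and their separation in charts *)

Section DualGraph.
Context (R : realType) (N d : nat).
Local Notation T := 'rV[R]_N.
Local Notation D := 'rV[R]_d.
Implicit Types (s t r : {fset T}) (x : T).

(** Connectedness of [0, 1]. Continuity is asked only at points of the interval, because the inverse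
    of a chart is controlled only on a ball; hence the closures in place of plain preimages. *)
Lemma unit_interval_sep (V : topologicalType) (f : R -> V) (A B : set V) :
  closed A -> closed B -> (forall t : R, 0 <= t <= 1 -> {for t, continuous f}) ->
  (forall t : R, 0 <= t <= 1 -> A (f t) \/ B (f t)) ->
  (forall t : R, 0 <= t <= 1 -> A (f t) -> B (f t) -> False) ->
  A (f 0) -> A (f 1).
Proof.
move=> cA cB fc AB nAB A0; pose I := [set t : R | 0 <= t <= 1].
have Ic : connected I.
  apply/connected_intervalP => x y /andP[x0 _] /andP[_ y1] z /andP[xz zy].
  by apply/andP; split; [exact: le_trans xz|exact: le_trans zy _].
have cl (C : set V) : closed C -> forall t : R, I t -> closure (I `&` f @^-1` C) t -> C (f t).
  move=> cC t It tcl; apply: cC => U fU; have [s [[_ Cs] Us]] := tcl _ (fc _ It _ fU).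
  by exists (f s).
have e : I `&` f @^-1` A = I.
  apply: Ic.
  - by exists 0; split=> //; rewrite /I /= lexx ler01.
  - exists (~` closure (I `&` f @^-1` B)); first by apply: closed_openC; exact: closed_closure.
    apply/seteqP; split=> t [It h]; split=> //.
      by move=> /(cl _ cB _ It); exact: nAB.
    by case: (AB _ It) => // Bt; case: h; apply: subset_closure.
  - exists (closure (I `&` f @^-1` A)); first exact: closed_closure.
    apply/seteqP; split=> t [It h]; split=> //; first exact: subset_closure.
    exact: cl.
have : I 1 by rewrite /I /= lexx ler01.
by rewrite -e => -[].
Qed.

Lemma ball_segment (y p q : D) (e t : R) : 0 <= t <= 1 -> ball y e p -> ball y e q ->
  ball y e (p + t *: (q - p)).
Proof.
move=> /andP[t0 t1]; rewrite mx_norm_ball /ball_ /= => yp yq.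
have -> : y - (p + t *: (q - p)) = (1 - t) *: (y - p) + t *: (y - q).
  by apply/rowP => i; rewrite !mxE; ring.
apply: le_lt_trans (ler_normD _ _) _; rewrite !normrZ !ger0_norm ?subr_ge0 //.
have [->|tn] := eqVneq t 0; first by rewrite subr0 mul1r mul0r addr0.
have tp : 0 < t by rewrite lt_neqAle eq_sym tn.
have h1 : (1 - t) * `|y - p| <= (1 - t) * e by rewrite ler_wpM2l ?subr_ge0 // ltW.
have h2 : t * `|y - q| < t * e by rewrite ltr_pM2l.
lra.
Qed.

Section Split.
Context (P : set T) (K : set {fset T}) (Q : {fset T} -> Prop).
Hypotheses (d0 : (0 < d)%N) (gK : geo K) (bK : body K = P).
Hypothesis dK : forall s, K s -> (#|` s| <= d.+1)%N.
Hypothesis adj : forall s t, K s -> K t -> #|` s| = d.+1 -> #|` t| = d.+1 ->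
  #|` (s `&` t)%fset| = d -> Q s -> Q t.

Definition class_union (C : {fset T} -> Prop) :=
  \bigcup_(s in [set s | [/\ K s, #|` s| = d.+1 & C s]]) hull s.
Local Notation A := (class_union Q).
Local Notation B := (class_union (fun s => ~ Q s)).

Lemma class_union_closed C : closed (class_union C).
Proof.
apply: closed_bigcup => [|s [Ks _ _]].
  by apply: sub_finite_set (geo_fin gK) => s [].
by apply: hull_closed; exact: geo_indep gK Ks.
Qed.

Lemma class_union_top s x : K s -> #|` s| = d.+1 -> hull s x -> A x \/ B x.
Proof. by move=> Ks sd sx; have [Qs|nQs] := pselect (Q s); [left|right]; exists s. Qed.

(** The common face of top simplices from different classes cannot have d+1 vertices, as they would
    be equal, nor d, as they would be adjacent. *)
Lemma classes_meet_low x : A x -> B x -> exists s, [/\ K s, (#|` s| < d)%N & hull s x].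
Proof.
move=> [s [Ks sd Qs] sx] [t [Kt td nQt] tx].
have rx := geo_meet gK Ks Kt sx tx.
have r0 : (s `&` t)%fset != fset0 by apply: contraPneq rx => ->; rewrite hull0.
have Kr : K (s `&` t)%fset by apply: (geo_face gK Ks) => //; exact: fsubsetIl.
exists (s `&` t)%fset; split=> //; rewrite ltnNge; apply/negP => dr.
have [rd|rd] := eqVneq #|` (s `&` t)%fset| d; first exact/nQt/(adj Ks Kt).
have dr1 : (d.+1 <= #|` (s `&` t)%fset|)%N by rewrite ltn_neqAle eq_sym rd.
have rs : (s `&` t)%fset = s by apply/eqP; rewrite eqEfcard fsubsetIl sd.
have rt : (s `&` t)%fset = t by apply/eqP; rewrite eqEfcard fsubsetIr td.
by apply: nQt; rewrite -rt rs.
Qed.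

(** Generic points avoid the images of all simplices with at most d vertices, so they land in [A] or
    [B], and by density so does the whole ball. If generic [p] and [q] landed in different classes,
    a third generic point could be joined to both by segments avoiding the intersection of [A] and
    [B], and would belong to both. *)
Lemma chart_one_class (y : D) (e : R) (g : D -> T) (cs : seq ('M[R]_(N, d) * D)) :
  0 < e -> (forall z, ball y e z -> {for z, continuous g}) ->
  (forall z, ball y e z -> P (g z) /\ exists2 c, c \in cs & z = g z *m c.1 + c.2) ->
  (forall z, ball y e z -> A (g z)) \/ (forall z, ball y e z -> B (g z)).
Proof.
move=> e0 gc gP.
have oball : open (ball y e) by exact: ball_open.
have fin (q : nat) : finite_set [set s | K s /\ (#|` s| <= q)%N].
  by apply: sub_finite_set (geo_fin gK) => s [].
have /choice[f fE] : forall sc : {fset T} * ('M[R]_(N, d) * D), exists ck : 'cV[R]_d * R,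
    ck.1 != 0 /\ (K sc.1 -> (#|` sc.1| <= d)%N -> forall x, hull sc.1 x ->
      ((x *m sc.2.1 + sc.2.2) *m ck.1) 0 0 = ck.2).
  move=> [s [M b]] /=; have [[Ks sd]|h] := pselect (K s /\ (#|` s| <= d)%N).
    by have [c [k [c0 h]]] := hull_normal_cst M b sd (geo_neq0 gK Ks); exists (c, k).
  have [c c0 _] := exists_normal (0 : 'M[R]_(0, d)) d0.
  by exists (c, 0); split=> // Ks sd; case: h.
pose cs1 := [seq f (s, c) | s <- fset_set [set s | K s /\ (#|` s| <= d)%N], c <- cs].
have cs1n c : c \in cs1 -> c.1 != 0.
  by move=> /allpairsP[p [_ _ ->]]; exact: (fE _).1.
pose gen (z : D) := forall c, c \in cs1 -> (z *m c.1) 0 0 != c.2.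
have gen_top z s : ball y e z -> gen z -> K s -> hull s (g z) -> #|` s| = d.+1.
  move=> yz gz Ks sz; apply/eqP; rewrite eqn_leq dK //= ltnNge; apply/negP => sd.
  have [_ [c ccs zE]] := gP _ yz.
  have /gz/eqP : f (s, c) \in cs1.
    by apply: allpairs_f => //; rewrite in_fset_set // inE.
  by apply; rewrite {1}zE; exact: (fE (s, c)).2.
have genAB z : ball y e z -> gen z -> A (g z) \/ B (g z).
  move=> yz gz; have [Pg _] := gP _ yz; rewrite -bK in Pg; have [s Ks sz] := Pg.
  exact: class_union_top (gen_top _ _ yz gz Ks sz) sz.
have dense (C : set T) : closed C -> (forall z, ball y e z -> gen z -> C (g z)) ->
    forall z, ball y e z -> C (g z).
  move=> cC h z yz; apply: contrapT => nC.
  have : nbhs z (ball y e `&` g @^-1` (~` C)).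
    apply: filterI; first by apply: open_nbhs_nbhs.
    by apply: (gc _ yz); apply: open_nbhs_nbhs; split=> //; exact: closed_openC.
  rewrite nbhsE => -[W [oW Wz] Wsub].
  have [z' Wz' gz'] := generic_point oW (ex_intro _ z Wz) cs1n.
  by have [yz' nC'] := Wsub _ Wz'; apply: nC'; exact: h.
have allAB z : ball y e z -> A (g z) \/ B (g z).
  apply: (dense (A `|` B)); last exact: genAB.
  by apply: closedU; exact: class_union_closed.
have /choice[k kE] : forall psc : D * ({fset T} * ('M[R]_(N, d) * D)), exists c : 'cV[R]_d,
    c != 0 /\ (K psc.2.1 -> (#|` psc.2.1| < d)%N -> forall x, hull psc.2.1 x ->
      (x *m psc.2.2.1 + psc.2.2.2 - psc.1) *m c = 0).
  move=> [p [s [M b]]] /=; have [[Ks sd]|h] := pselect (K s /\ (#|` s| < d)%N).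
    by have [c c0 h] := hull_normal M b p sd; exists c.
  have [c c0 _] := exists_normal (0 : 'M[R]_(0, d)) d0.
  by exists c; split=> // Ks sd; case: h.
(* Hyperplanes through [p] that contain the image of a simplex of codimension at least two: a
   segment from [p] that meets this image at a nonzero parameter ends on such a hyperplane. *)
pose cs2 p := [seq (k (p, (s, c)), (p *m k (p, (s, c))) 0 0) |
  s <- fset_set [set s | K s /\ (#|` s| <= d)%N], c <- cs].
have cs2n p c : c \in cs2 p -> c.1 != 0.
  by move=> /allpairsP[q [_ _ ->]]; exact: (kE _).1.
have seg p q (C C' : set T) : closed C -> closed C' ->
    (forall x, A x \/ B x -> C x \/ C' x) ->
    (forall x, C x -> C' x -> A x /\ B x) ->
    ball y e p -> gen p -> ball y e q -> (forall c, c \in cs2 p -> (q *m c.1) 0 0 != c.2) ->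
    C (g p) -> C (g q).
  move=> cC cC' AC CA yp gp yq gq.
  have := @unit_interval_sep T (fun t : R => g (p + t *: (q - p))) C C' cC cC'.
  rewrite scale0r addr0 scale1r [p + _]addrC subrK; apply.
  - move=> t t01; have ys := ball_segment t01 yp yq.
    apply: continuous_comp; last exact: gc.
    apply: cvgD; first exact: cvg_cst.
    by apply: cvgZr_tmp; exact: cvg_id.
  - by move=> t t01; apply/AC/allAB; exact: ball_segment.
  - move=> t t01 Cx C'x; have [Ax Bx] := CA _ Cx C'x.
    have yz := ball_segment t01 yp yq; move: yz Ax Bx; set z := p + _ => yz Ax Bx.
    have [s [Ks sd sx]] := classes_meet_low Ax Bx.
    have [t0|t0] := eqVneq t 0.
      have zp : z = p by rewrite /z t0 scale0r addr0.
      rewrite zp in sx; have sd' := gen_top _ _ yp gp Ks sx.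
      by rewrite sd' ltnNge leqnSn in sd.
    have [_ [c ccs zE]] := gP _ yz.
    have /gq /= : (k (p, (s, c)), (p *m k (p, (s, c))) 0 0) \in cs2 p.
      apply: (allpairs_f (fun s c => (k (p, (s, c)), (p *m k (p, (s, c))) 0 0))) => //.
      by rewrite in_fset_set // inE; split=> //; exact: ltnW.
    have := (kE (p, (s, c))).2 Ks sd _ sx; rewrite /= -zE.
    rewrite /z addrC addKr -scalemxAl => /eqP; rewrite scaler_eq0 (negbTE t0) /=.
    by rewrite mulmxBl subr_eq0 => /eqP ->; rewrite eqxx.
have cA : closed A by exact: class_union_closed.
have cB : closed B by exact: class_union_closed.
have noAB p q : ball y e p -> ball y e q -> gen p -> gen q -> A (g p) -> B (g q) -> False.
  move=> yp yq gp gq Ap Bq.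
  have [||z yz zE] := @generic_point _ _ (cs1 ++ (cs2 p ++ cs2 q)) (ball y e) oball.
  - by exists p.
  - by move=> c; rewrite !mem_cat => /or3P[/cs1n|/cs2n|/cs2n].
  have gz : gen z by move=> c cc; apply: zE; rewrite mem_cat cc.
  have Az : A (g z).
    apply: (seg p z A B) => //; last by move=> c cc; apply: zE; rewrite !mem_cat cc orbT.
  have Bz : B (g z).
    apply: (seg q z B A) => //; first by move=> x []; [right|left].
    by move=> c cc; apply: zE; rewrite !mem_cat cc !orbT.
  have [s [Ks sd sx]] := classes_meet_low Az Bz.
  by rewrite (gen_top _ _ yz gz Ks sx) ltnNge leqnSn in sd.
have [p yp gp] := generic_point oball (ex_intro _ y (ballxx y e0)) cs1n.
have [Ap|Bp] := genAB _ yp gp; [left|right]; apply: dense => // z yz gz.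
- by have [//|Bz] := genAB _ yz gz; case: (noAB p z).
- by have [Az|//] := genAB _ yz gz; case: (noAB z p).
Qed.

End Split.

(** Every point has a neighbourhood in [P] contained in one of the two closed unions. This makes
    them disjoint, and connectedness of [P] leaves only one. *)
Lemma dual_connected (P : set T) (K : set {fset T}) (Q : {fset T} -> Prop) :
  (0 < d)%N -> pl_boundary d P = set0 -> connected P -> geo K -> body K = P ->
  (forall s, K s -> (#|` s| <= d.+1)%N) ->
  (forall s t, K s -> K t -> #|` s| = d.+1 -> #|` t| = d.+1 ->
     #|` (s `&` t)%fset| = d -> Q s -> Q t) ->
  (exists s, [/\ K s, #|` s| = d.+1 & Q s]) ->
  forall t, K t -> #|` t| = d.+1 -> Q t.
Proof.
move=> d0 bP cP gK bK dK adj [s0 [Ks0 s0d Qs0]] t Kt td.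
pose A := class_union K Q; pose B := class_union K (fun s => ~ Q s).
have cA : closed A by exact: class_union_closed.
have cB : closed B by exact: class_union_closed.
have one x : P x -> exists2 O, nbhs x O &
    (forall x', O x' -> P x' -> A x') \/ (forall x', O x' -> P x' -> B x').
  move=> Px; have [y [e [g [cs [e0 gc gP [W nO OE]]]]]] := local_chart bP Px.
  exists W => //; have [h|h] := chart_one_class d0 gK bK dK adj e0 gc gP; [left|right];
    by move=> x' /OE h' /h'[z /h ? <-].
(* Arbitrarily near [x] there are inner points of [s], which lie in no other top simplex; so a class
   that covers a neighbourhood of [x] contains every top simplex at [x]. *)
have excl (C : {fset T} -> Prop) x O : nbhs x O ->
    (forall x', O x' -> P x' -> class_union K C x') ->
    forall s, K s -> #|` s| = d.+1 -> hull s x -> C s.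
  move=> nO OC s Ks sd sx; have sb := inner_barycenter (geo_neq0 gK Ks).
  have [u0 u01 Ou] : exists2 u : R, 0 < u <= 1 & O ((1 - u) *: x + u *: barycenter s).
    have cl : continuous (fun u : R => u *: (barycenter s - x) + x).
      move=> u; apply: cvgD; last exact: cvg_cst.
      by apply: cvgZr_tmp; exact: cvg_id.
    have := cl 0; rewrite /continuous_at scale0r add0r => /(_ O nO).
    move=> /nbhs_ballP[e /= e0 eO]; pose u := Num.min 1 (e / 2).
    have u0 : 0 < u by rewrite lt_min ltr01 divr_gt0.
    exists u; first by rewrite u0 ge_min lexx.
    have := eO u; rewrite /ball /= sub0r normrN gtr0_norm // => h.
    have -> : (1 - u) *: x + u *: barycenter s = u *: (barycenter s - x) + x.
      by apply/rowP => i; rewrite !mxE; ring.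
    apply: h; apply: (@le_lt_trans _ _ (e / 2)); last by lra.
    by rewrite ge_min lexx orbT.
  have [[a sa ap] /hull_bary[b sbx]] := (sb, sx).
  have inn : inner s ((1 - u0) *: x + u0 *: barycenter s).
    have [u00 u1] := andP u01.
    have [b0 bs b1 bE] := sbx; have [a0 as0 a1 aE] := sa.
    exists (fun v => (1 - u0) * b v + u0 * a v).
      split.
      - by move=> v; rewrite addr_ge0 // mulr_ge0 ?subr_ge0 // ltW.
      - by move=> v vs; rewrite bs // as0 // !mulr0 addr0.
      - by rewrite big_split /= -!mulr_sumr a1 b1; ring.
      - rewrite {1}bE {1}aE !scaler_sumr -big_split /=; apply: eq_bigr => v _.
        by rewrite [RHS]scalerDl !scalerA.
    by move=> v vs; rewrite ltr_wpDl ?mulr_gt0 ?ap // mulr_ge0 // subr_ge0.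
  have Pi : P ((1 - u0) *: x + u0 *: barycenter s).
    by rewrite -bK; exists s => //; case: inn => c ? _; apply/hull_bary; exists c.
  have [s' [Ks' s'd Cs'] s'x] := OC _ Ou Pi.
  have ss := geo_inner_sub gK Ks Ks' inn s'x.
  have -> : s = s' by apply/eqP; rewrite eqEfcard ss sd s'd leqnn.
  by [].
have sub C : class_union K C `<=` P by move=> x [s [Ks _ _] sx]; rewrite -bK; exists s.
have disj x : A x -> B x -> False.
  move=> Ax Bx; have [W nO [h|h]] := one _ (sub _ _ Ax).
    by have [s [Ks sd nQ] sx] := Bx; apply: nQ; exact: excl nO h _ Ks sd sx.
  have [s [Ks sd Qs] sx] := Ax.
  by have := excl (fun s => ~ Q s) _ _ nO h _ Ks sd sx.
have cov x : P x -> A x \/ B x.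
  by move=> Px; have [W /nbhs_singleton Ox [h|h]] := one _ Px; [left|right]; exact: h.
have AP : A = P.
  apply: cP.
  - by have [x s0x] := hull_neq0 (geo_neq0 gK Ks0); exists x; exists s0.
  - exists (~` B); first exact: closed_openC.
    apply/seteqP; split=> x; last by move=> [/cov[] // ? []].
    by move=> Ax; split; [exact: sub Ax|move=> Bx; exact: disj Ax Bx].
  - exists A => //; apply/seteqP; split=> x; last by case.
    by move=> Ax; split=> //; exact: sub Ax.
apply: contrapT => nQ; have [x tx] := hull_neq0 (geo_neq0 gK Kt).
have Bx : B x by exists t.
by apply: (disj x) => //; rewrite AP; exact: sub Bx.
Qed.

End DualGraph.

(** * Additivity of volume *)

Section Coordinates.
Context (R : realType) (N : nat).
Local Notation T := 'rV[R]_N.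
Implicit Types (s t r f g : {fset T}) (x u v z : T) (a : T -> R) (L : set {fset T}).

Definition bco s x : T -> R := xget (fun=> 0) [set a | bary s a x].

Lemma bcoP s x : hull s x -> bary s (bco s x) x.
Proof. by move=> /hull_bary[a sx]; apply: (@xgetPex _ _ [set a | bary s a x]); exists a. Qed.

Lemma bcoE s a x : indep s -> bary s a x -> bco s x = a.
Proof.
move=> sI sx; have hx : hull s x by apply/hull_bary; exists a.
exact: sI (bcoP hx) sx.
Qed.

Lemma bco_sub s g x : indep s -> (g `<=` s)%fset -> hull g x -> bco s x = bco g x.
Proof. by move=> sI gs gx; exact: (bcoE sI (bary_sup gs (bcoP gx))). Qed.

Lemma indep_sub s g : (g `<=` s)%fset -> indep s -> indep g.
Proof. by move=> gs sI a b x ga gb; exact: (sI _ _ x (bary_sup gs ga) (bary_sup gs gb)). Qed.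

Lemma bco_comb s t a x v : indep s -> hull t `<=` hull s -> bary t a x ->
  bco s x v = \sum_(w <- t) a w * bco s w v.
Proof.
move=> sI ts tx; have -> := bcoE sI (bary_comb tx (fun w wt => bcoP (ts _ (hull_vertex wt)))).
by [].
Qed.

Lemma hull_bco0 s g x : indep s -> (g `<=` s)%fset -> hull s x ->
  (forall v, v \in s -> v \notin g -> bco s x v = 0) -> hull g x.
Proof.
move=> sI gs sx h0; apply/hull_bary; exists (bco s x).
apply: (bary_restrict _ (bcoP sx)) => v; apply: contraNT => vg.
have [vs|vs] := boolP (v \in s); first by rewrite h0.
by have [_ -> //] := bcoP sx.
Qed.

(** At a vertex of [t] outside [g] the coordinate of the inner point vanishes, and it is a
    combination, with positive weights, of the nonnegative coordinates of the vertices of [s]. *)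
Lemma hull_face s g t x : indep t -> (g `<=` t)%fset -> hull s `<=` hull t ->
  inner s x -> hull g x -> hull s `<=` hull g.
Proof.
move=> tI gt st [a sx ap] gx; apply: hull_convex => w ws.
apply: (hull_bco0 tI gt); first by apply: st; exact: hull_vertex.
move=> v vt vg; have : bco t x v = 0.
  by rewrite (bco_sub tI gt gx); have [_ -> //] := bcoP gx.
have b0 z : z \in s -> 0 <= bco t z v.
  by move=> /hull_vertex/st/bcoP[].
rewrite (bco_comb _ tI st sx) => /eqP; rewrite big_seq psumr_eq0; last first.
  by move=> z zs; rewrite mulr_ge0 ?b0 // ltW // ap.
move=> /allP/(_ w ws); rewrite ws /= mulf_eq0 gt_eqF ?ap //= => /eqP.
by [].
Qed.

Definition coord_mx m q (P : 'M[R]_(m, N)) (Q : 'M[R]_(q, N)) s : 'M[R]_(m, q) :=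
  \matrix_(i, j) bco s (row i P) (row j Q).

Lemma coord_mx_mul q m (P : 'M[R]_(m, N)) (Q : 'M[R]_(q, N)) s : ordered s Q ->
  (forall i, hull s (row i P)) -> P = coord_mx P Q s *m Q.
Proof.
move=> sQ sP; apply/row_matrixP => i; rewrite row_mul.
have -> : row i (coord_mx P Q s) = \row_j bco s (row i P) (row j Q).
  by apply/rowP => j; rewrite !mxE.
exact: (bary_mulmx sQ (bcoP (sP i))).1.
Qed.

Lemma coord_mx_sum q m (P : 'M[R]_(m, N)) (Q : 'M[R]_(q, N)) s : ordered s Q ->
  (forall i, hull s (row i P)) -> forall i, \sum_j coord_mx P Q s i j = 1.
Proof.
move=> sQ sP i; have [_ <-] := bary_mulmx sQ (bcoP (sP i)).
by apply: eq_bigr => j _; rewrite mxE.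
Qed.

Lemma coord_mx_free m q (P : 'M[R]_(m, N)) (Q : 'M[R]_(q, N)) s t (u : 'rV_m) :
  ordered s Q -> ordered t P -> indep t -> hull t `<=` hull s ->
  u *m coord_mx P Q s = 0 -> u = 0.
Proof.
move=> sQ tP /affinely_indepP tI ts u0.
have sP i : hull s (row i P) by apply/ts/hull_vertex; exact: ordered_mem tP.
pose a v := if [pick i | row i P == v] is Some i then u 0 i else 0.
have aE i : a (row i P) = u 0 i.
  by rewrite /a; case: pickP => [j /eqP/tP.2 ->|/(_ i)]; rewrite ?eqxx.
have z v : v \in t -> a v = 0.
  apply: tI; rewrite (ordered_sum _ tP).
    rewrite (eq_bigr (fun i => \sum_j u 0 i * coord_mx P Q s i j)); last first.
      by move=> i _; rewrite aE -mulr_sumr (coord_mx_sum sQ sP) mulr1.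
    rewrite exchange_big big1 //= => j _.
    by move/rowP/(_ j): u0; rewrite [LHS]mxE [RHS]mxE.
  under eq_bigr do rewrite aE.
  by rewrite -mulmx_sum_row (coord_mx_mul sQ sP) mulmxA u0 mul0mx.
by apply/rowP => i; rewrite -aE z ?mxE //; exact: ordered_mem tP.
Qed.

Lemma ordered_vertex q (Q : 'M[R]_(q, N)) s v : ordered s Q -> v \in s -> exists i, row i Q = v.
Proof. by move=> [h _] /h. Qed.

End Coordinates.

(** * Relative volumes and cones over facets *)

Section Additivity.
Context (R : realType) (N : nat).
Local Notation T := 'rV[R]_N.
Implicit Types (s t r f g : {fset T}) (x u v z : T) (a : T -> R) (L : set {fset T}).

Definition ord_mx s m : 'M[R]_(m, N) := \matrix_(i < m) nth 0 s i.

(** The ratio of the volume of [s] to that of [sg], without reference to any form; the absolute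
    value removes the dependence on the orders of the vertices. *)
Definition rel_vol q (Q : 'M[R]_(q, N)) sg s : R :=
  `|\det (coord_mx (ord_mx s q) Q sg)|.

Definition tops L q := fset_set [set s | L s /\ #|` s| = q].

Lemma in_tops L q s : geo L -> (s \in tops L q) <-> L s /\ #|` s| = q.
Proof.
move=> gL; rewrite in_fset_set ?inE //.
by apply: sub_finite_set (geo_fin gL) => ? [].
Qed.

Lemma ordered_hull m s (P : 'M[R]_(m, N)) (c : 'I_m -> R) : ordered s P ->
  (forall i, 0 <= c i) -> \sum_i c i = 1 -> hull s (\sum_i c i *: row i P).
Proof.
move=> sP c0 c1; pose a v := if [pick i | row i P == v] is Some i then c i else 0.
have aE i : a (row i P) = c i.
  by rewrite /a; case: pickP => [j /eqP/sP.2 ->|/(_ i)]; rewrite ?eqxx.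
exists a; split.
- by move=> v vs; rewrite /a; case: pickP.
- by rewrite (ordered_sum _ sP) -[RHS]c1; apply: eq_bigr => i _; rewrite aE.
- by rewrite (ordered_sum _ sP); apply: eq_bigr => i _; rewrite aE.
Qed.

Section Step.
Context (q : nat) (sg : {fset T}) (Q : 'M[R]_(q.+2, N)) (L : set {fset T}).
Hypotheses (sgQ : ordered sg Q) (sgI : indep sg) (gL : geo L) (bL : body L = hull sg).

Let u := row ord0 Q.
Let ph := (sg `\ u)%fset.

Let ush : u \in sg. Proof. exact: ordered_mem sgQ. Qed.
Let subL s : L s -> hull s `<=` hull sg.
Proof. by move=> Ls x sx; rewrite -bL; exists s. Qed.
Let hu : hull sg u. Proof. exact: hull_vertex. Qed.
Let phs : (ph `<=` sg)%fset. Proof. exact: fsubsetDl. Qed.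

Lemma step_card s : L s -> (#|` s| <= q.+2)%N.
Proof.
move=> Ls; rewrite -(ordered_card sgQ); apply: card_hull_sub => //.
- exact: geo_indep gL Ls.
- exact: geo_neq0 gL _ Ls.
- exact: subL.
Qed.

(** The signed relative volume of the cone from [v] over [f]. It is affine in [v], and its sign
    tells on which side of the hyperplane of [f] the point lies. *)
Definition cone_det v f : R := \det (coord_mx (cons_mx v (ord_mx f q.+1)) Q sg).

Lemma cone_det_expand v f : cone_det v f = \sum_j bco sg v (row j Q) *
  cofactor (coord_mx (cons_mx 0 (ord_mx f q.+1)) Q sg) ord0 j.
Proof.
rewrite /cone_det (expand_det_row _ ord0); apply: eq_bigr => j _.
rewrite {1}mxE row_cons0; congr (_ * (_ * \det _)).
apply/matrixP => i k; rewrite !mxE; congr (bco sg _ _).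
by rewrite !row_consS.
Qed.

Lemma cone_det_lin (I : Type) (l : seq I) (c : I -> R) (y : I -> T) x f :
  (forall j, bco sg x (row j Q) = \sum_(i <- l) c i * bco sg (y i) (row j Q)) ->
  cone_det x f = \sum_(i <- l) c i * cone_det (y i) f.
Proof.
move=> xE; rewrite cone_det_expand; under eq_bigr do rewrite xE mulr_suml.
rewrite exchange_big /=; apply: eq_bigr => i _; rewrite cone_det_expand mulr_sumr.
by apply: eq_bigr => j _; rewrite mulrA.
Qed.

Lemma cone_det_bary t a x f : hull t `<=` hull sg -> bary t a x ->
  cone_det x f = \sum_(w <- t) a w * cone_det w f.
Proof. by move=> ts tx; apply: cone_det_lin => j; exact: bco_comb. Qed.

Lemma cone_det_mem w f : #|` f| = q.+1 -> w \in f -> cone_det w f = 0.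
Proof.
move=> fq wf; have [i iE] := ordered_vertex (ordered_nth fq) wf.
apply: (determinant_alternate (neq_lift ord0 i)) => j.
by rewrite !mxE row_cons0 row_consS /ord_mx iE.
Qed.

Lemma cone_det_hull x f : L f -> #|` f| = q.+1 -> hull f x -> cone_det x f = 0.
Proof.
move=> Lf fq /bcoP fx; rewrite (cone_det_bary _ (subL Lf) fx) big1_seq // => w /andP[_ wf].
by rewrite cone_det_mem // mulr0.
Qed.

Lemma coord_det_neq0 s (P : 'M[R]_(q.+2, N)) : L s -> ordered s P ->
  \det (coord_mx P Q sg) != 0.
Proof.
move=> Ls sP; have : row_free (coord_mx P Q sg).
  by apply: inj_row_free => c; exact: coord_mx_free sgQ sP (geo_indep gL Ls) (subL Ls).
by rewrite row_free_unit unitmxE unitfE.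
Qed.

Lemma cone_det_neq0 v f : #|` f| = q.+1 -> v \notin f -> L (v |` f)%fset -> cone_det v f != 0.
Proof.
by move=> fq vf Lvf; apply: coord_det_neq0 Lvf _; apply: ordered_cons => //; exact: ordered_nth.
Qed.

Lemma rel_vol_perm s (P : 'M[R]_(q.+2, N)) : ordered s P ->
  rel_vol Q sg s = `|\det (coord_mx P Q sg)|.
Proof.
move=> sP; have sN := ordered_nth (ordered_card sP).
have [p pE] := ordered_row_perm sP sN.
rewrite /rel_vol /ord_mx pE; have -> : coord_mx (row_perm p P) Q sg = row_perm p (coord_mx P Q sg).
  by apply/matrixP => i j; rewrite !mxE row_row_perm.
by rewrite row_permE det_mulmx det_perm normrM normrX normrN1 expr1n mul1r.
Qed.

Lemma rel_vol_cone v f : #|` f| = q.+1 -> v \notin f ->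
  rel_vol Q sg (v |` f)%fset = `|cone_det v f|.
Proof. by move=> fq vf; apply: rel_vol_perm; apply: ordered_cons => //; exact: ordered_nth. Qed.

(** The coordinates come from inverting the coordinate matrix of [s]; as [x] need not lie in [s],
    they may be negative. *)
Lemma top_coords s (P : 'M[R]_(q.+2, N)) x : L s -> ordered s P -> hull sg x ->
  exists b : 'I_q.+2 -> R, [/\ \sum_i b i = 1, x = \sum_i b i *: row i P &
    forall f, cone_det x f = \sum_i b i * cone_det (row i P) f].
Proof.
move=> Ls sP hx; pose X := coord_mx P Q sg.
have Xu : X \in unitmx by rewrite unitmxE unitfE; exact: coord_det_neq0 Ls sP.
have hP i : hull sg (row i P) by apply/(subL Ls)/hull_vertex; exact: ordered_mem sP.
pose cx : 'rV_q.+2 := \row_j bco sg x (row j Q).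
pose b := cx *m invmx X; have bX : b *m X = cx by rewrite mulmxKV.
have [xE x1] := bary_mulmx sgQ (bcoP hx).
exists (fun i => b 0 i); split.
- rewrite -[RHS]x1; under [RHS]eq_bigr => j _.
    have -> : bco sg x (row j Q) = (b *m X) 0 j by rewrite bX mxE.
    rewrite mxE; over.
  rewrite exchange_big /=; apply: eq_bigr => i _.
  by rewrite -mulr_sumr (coord_mx_sum sgQ hP) mulr1.
- rewrite -mulmx_sum_row (coord_mx_mul sgQ hP) -/X mulmxA bX; exact: xE.
- move=> f; apply: cone_det_lin => j.
  have -> : bco sg x (row j Q) = (b *m X) 0 j by rewrite bX mxE.
  by rewrite [LHS]mxE; apply: eq_bigr => i _; congr (_ * _); rewrite mxE.
Qed.

(** Write [u] as an affine combination of the vertices of [s]. The coefficient at [v] is the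
    quotient of the cones from [u] and from [v] over the facet opposite [v], and the coefficients
    sum to 1. *)
Lemma rel_vol_stokes s : L s -> #|` s| = q.+2 ->
  rel_vol Q sg s = \sum_(v <- s) Num.sg (cone_det v (s `\ v)%fset) * cone_det u (s `\ v)%fset.
Proof.
move=> Ls sq; have sP := ordered_nth sq; set P := \matrix_i _ in sP.
have [b [b1 _ bE]] := top_coords Ls sP hu.
rewrite (ordered_sum _ sP) -[LHS]mul1r -b1 mulr_suml; apply: eq_bigr => i _.
set v := row i P; set f := (s `\ v)%fset.
have vs : v \in s := ordered_mem i sP.
have fq : #|` f| = q.+1 by have := sq; rewrite (cardfsD1 v) vs add1n => -[].
have vf : v \notin f by rewrite !inE eqxx.
have sE : s = (v |` f)%fset by rewrite fsetD1K.
rewrite bE (bigD1 i) //= big1 => [|j ji]; last first.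
  rewrite cone_det_mem ?mulr0 // !inE (ordered_mem j sP) andbT.
  by apply: contra ji => /eqP/sP.2 ->.
by rewrite addr0 mulrCA -normrEsg {1}sE rel_vol_cone.
Qed.

(** Move from the barycenter of [f] slightly towards [z]. The simplices not containing [f] form a
    closed set that misses the barycenter, so the new point lies in a simplex strictly containing
    [f], and the dimension leaves room for one more vertex only. *)
Lemma side_exists z f : L f -> #|` f| = q.+1 -> hull sg z -> cone_det z f != 0 ->
  exists v, [/\ v \notin f, L (v |` f)%fset & Num.sg (cone_det v f) = Num.sg (cone_det z f)].
Proof.
move=> Lf fq sz z0; have f0 := geo_neq0 gL Lf.
have fb := inner_barycenter f0; set x := barycenter f in fb.
have hfx : hull f x by case: fb => a ? _; apply/hull_bary; exists a.
pose W := \bigcup_(s in [set s | L s /\ ~~ (f `<=` s)%fset]) hull s.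
have cW : closed W.
  apply: closed_bigcup => [|s [Ls _]].
    by apply: sub_finite_set (geo_fin gL) => ? [].
  by apply: hull_closed; exact: geo_indep gL Ls.
have nW : (~` W) x.
  by move=> [s [Ls fs] sx]; case/negP: fs; exact: geo_inner_sub gL Lf Ls fb sx.
have [e /andP[e0 e1] We] : exists2 e : R, 0 < e <= 1 & (~` W) ((1 - e) *: x + e *: z).
  have cl : continuous (fun e : R => e *: (z - x) + x).
    move=> e; apply: cvgD; last exact: cvg_cst.
    by apply: cvgZr_tmp; exact: cvg_id.
  have nWx : nbhs x (~` W) by apply: open_nbhs_nbhs; split=> //; exact: closed_openC.
  have := cl 0; rewrite /continuous_at scale0r add0r => /(_ _ nWx).
  move=> /nbhs_ballP[d /= d0 dW]; pose e := Num.min 1 (d / 2).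
  have e0 : 0 < e by rewrite lt_min ltr01 divr_gt0.
  exists e; first by rewrite e0 ge_min lexx.
  have := dW e; rewrite /ball /= sub0r normrN gtr0_norm // => h.
  have -> : (1 - e) *: x + e *: z = e *: (z - x) + x.
    by apply/rowP => i; rewrite !mxE; ring.
  apply: h; apply: (@le_lt_trans _ _ (d / 2)); last by lra.
  by rewrite ge_min lexx orbT.
set y := _ + _ in We.
have sy : hull sg y by apply: hull_mix => //; [exact: ltW|exact: subL Lf _ hfx].
have [s Ls ys] : body L y by rewrite bL.
have fs : (f `<=` s)%fset.
  by apply/negPn/negP => nfs; apply: We; exists s.
have yz : cone_det y f = e * cone_det z f.
  have [xz|xz] := eqVneq x z.
    by move: z0; rewrite -xz (cone_det_hull Lf fq hfx) eqxx.
  have h : hull [fset x; z]%fset `<=` hull sg.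
    apply: hull_convex => w; rewrite !inE => /orP[/eqP ->|/eqP ->] //.
    exact: subL Lf _ hfx.
  have by2 : bary [fset x; z]%fset (fun w => if w == x then 1 - e else if w == z then e else 0) y.
    split.
    - by move=> w; do 2?case: ifP => _ //; rewrite ?subr_ge0 // ltW.
    - by move=> w; rewrite !inE negb_or => /andP[/negbTE -> /negbTE ->].
    - by rewrite big_fsetU1 ?inE //= big_seq_fset1 eqxx eq_sym (negbTE xz) eqxx subrK.
    - by rewrite big_fsetU1 ?inE //= big_seq_fset1 eqxx eq_sym (negbTE xz) eqxx.
  rewrite (cone_det_bary f h by2) big_fsetU1 ?inE //= big_seq_fset1 eqxx eq_sym (negbTE xz) eqxx.
  by rewrite (cone_det_hull Lf fq hfx) mulr0 add0r.
have yn0 : cone_det y f != 0 by rewrite yz mulf_neq0 // gt_eqF.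
have fns : f != s by apply: contraNneq yn0 => fE; rewrite -fE in ys; rewrite (cone_det_hull Lf fq ys).
have fps : (f `<` s)%fset by rewrite fproperEneq fns fs.
have /fsubsetPn[v vs vf] : ~~ (s `<=` f)%fset by move: fps; rewrite fproperE => /andP[].
have sE : s = (v |` f)%fset.
  apply/esym/eqP; rewrite eqEfcard fsubUset fsub1set vs fs cardfsU1 vf fq.
  exact: step_card.
exists v; rewrite -sE; split=> //.
have yb := bcoP ys.
have yD : cone_det y f = bco s y v * cone_det v f.
  rewrite (cone_det_bary f (subL Ls) yb) (big_fsetD1 v) //= big1_seq ?addr0 // => w.
  rewrite !inE => /andP[_ /andP[wv ws]]; rewrite cone_det_mem ?mulr0 //.
  by move: ws; rewrite sE !inE (negbTE wv).
have a0 : 0 < bco s y v.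
  rewrite lt_neqAle; have [-> // _ _ _] := yb; rewrite andbT eq_sym.
  by apply: contraNneq yn0 => h0; rewrite yD h0 mul0r.
by rewrite -[RHS]mul1r -(gtr0_sg e0) -sgrM -yz yD sgrM (gtr0_sg a0) mul1r.
Qed.

(** Two cones over [f] on the same side overlap: a point slightly off the barycenter towards [v']
    lies in both, yet only one of its two coordinate functions has positive weight at [v']. *)
Lemma side_uniq v v' f : L f -> #|` f| = q.+1 -> v \notin f -> v' \notin f ->
  L (v |` f)%fset -> L (v' |` f)%fset ->
  Num.sg (cone_det v f) = Num.sg (cone_det v' f) -> v = v'.
Proof.
move=> Lf fq vf vf' Lv Lv' e; apply/eqP/negPn/negP => vv'.
have fF := ordered_nth fq; set F := \matrix_i _ in fF.
have vP := ordered_cons vf fF.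
have hv' : hull sg v' by apply: subL Lv' _ _; apply: hull_vertex; rewrite !inE eqxx.
have [b [b1 bE bD]] := top_coords Lv vP hv'.
have d0 := cone_det_neq0 fq vf Lv.
have b0 : 0 < b ord0.
  have : cone_det v' f = b ord0 * cone_det v f.
    rewrite bD big_ord_recl row_cons0 big1 ?addr0 // => i _.
    by rewrite row_consS cone_det_mem ?mulr0 //; exact: ordered_mem fF.
  move=> h; move: e; rewrite h sgrM => e.
  have : Num.sg (b ord0) = 1.
    by apply: (mulIf (_ : Num.sg (cone_det v f) != 0)); rewrite ?sgr_eq0 // mul1r -e.
  by move/eqP; rewrite sgr_cp0.
(* For this [k] the number [(1 - k) / q.+1] equals [k] times the sum of all [|b i|], which outweighs
   any negative coefficient. *)
pose k : R := (1 + q.+1%:R * \sum_i `|b i|)^-1.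
have q0 : (0 : R) < q.+1%:R by rewrite ltr0n.
have S0 : 0 <= \sum_i `|b i| by apply: sumr_ge0.
have k0 : 0 < k by rewrite invr_gt0 ltr_pwDl // mulr_ge0 // ltW.
have k1 : k <= 1 by rewrite invf_le1 ?lerDl ?mulr_ge0 ?(ltW q0) // ltr_pwDl // mulr_ge0 // ltW.
have kb i : 0 <= (1 - k) / q.+1%:R + k * b i.
  have bi : - \sum_i `|b i| <= b i.
    rewrite lerNl; apply: le_trans (ler_norm _) _; rewrite normrN (bigD1 i) //= lerDl.
    exact: sumr_ge0.
  have : (1 - k) / q.+1%:R - k * \sum_i `|b i| = 0.
    have : (1 + q.+1%:R * \sum_i `|b i|) * k = 1 by rewrite /k mulfV // gt_eqF // ltr_pwDl // mulr_ge0 // ltW.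
    move: (\sum_i _) => S h; have qn0 : q.+1%:R != 0 :> R by rewrite gt_eqF.
    apply: (mulfI qn0).
    rewrite mulr0 mulrBr mulrCA mulfV ?gt_eqF // mulr1; move: h; lra.
  have : k * - \sum_i `|b i| <= k * b i by rewrite ler_pM2l.
  have aux (k2 c S b2 : R) : (1 - k2) / c - k2 * S = 0 -> k2 * - S <= k2 * b2 ->
      0 <= (1 - k2) / c + k2 * b2.
    by rewrite mulrN; lra.
  by move=> h1 h2; exact: aux h2 h1.
have f0 := geo_neq0 gL Lf; pose x := barycenter f; pose y := (1 - k) *: x + k *: v'.
have xb := bary_barycenter f0.
have yv' : bary (v' |` f)%fset (fun w => (1 - k) * (if w \in f then (#|` f|%:R)^-1 else 0) + k * (w == v')%:R) y.
  have [x0 xs x1 xE] := bary_sup (fsubsetUr [fset v']%fset f) xb.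
  have vin : v' \in (v' |` f)%fset by rewrite !inE eqxx.
  have [z0 zs z1 zE] := bary_vertex vin.
  split.
  - by move=> w; rewrite addr_ge0 // mulr_ge0 ?subr_ge0 // ltW.
  - by move=> w wf; rewrite (xs _ wf) zs // !mulr0 addr0.
  - by rewrite big_split /= -!mulr_sumr x1 z1 !mulr1 subrK.
  - rewrite /y /x {1}zE {1}xE !scaler_sumr -big_split /=.
    by apply: eq_bigr => w _; rewrite [RHS]scalerDl !scalerA.
pose c (i : 'I_q.+2) := if i == ord0 then k * b ord0 else (1 - k) / q.+1%:R + k * b i.
have yv : hull (v |` f)%fset y.
  have -> : y = \sum_i c i *: row i (cons_mx v F).
    rewrite /y bE scaler_sumr [in RHS]big_ord_recl [in LHS]big_ord_recl /c eqxx scalerA.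
    rewrite addrCA; congr (_ + _); rewrite /x /barycenter (ordered_sum _ fF) fq scaler_sumr -big_split /=.
    by apply: eq_bigr => i _; rewrite row_consS !scalerA [RHS]scalerDl.
  apply: ordered_hull vP _ _ => [i|]; first by rewrite /c; case: eqP => // _; rewrite mulr_ge0 ?ltW.
  rewrite big_ord_recl /c eqxx big_split /= -mulr_sumr sumr_const card_ord.
  rewrite -[_^-1 *+ _]mulr_natr mulVf ?gt_eqF // mulr1 -mulr_sumr addrCA -mulrDr.
  by have := b1; rewrite big_ord_recl => ->; rewrite mulr1 subrK.
have /hull_bary[a ya] := yv.
have := geo_uniq gL Lv Lv' ya yv' => /(congr1 (fun h => h v')).
have [_ a0 _ _] := ya; rewrite a0; last by rewrite !inE negb_or eq_sym vv' vf'.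
by rewrite (negbTE vf') eqxx mulr0 add0r mulr1 => k00; rewrite -k00 ltxx in k0.
Qed.

Lemma cone_det_base w f : #|` f| = q.+1 -> hull f `<=` hull ph -> hull ph w -> cone_det w f = 0.
Proof.
move=> fq fph pw; have c0 x : hull ph x -> bco sg x u = 0.
  by move=> px; rewrite (bco_sub sgI phs px); have [_ -> //] := bcoP px; rewrite !inE eqxx.
rewrite /cone_det (expand_det_col _ ord0) big1 // => i _; rewrite mxE -/u c0 ?mul0r //.
case: (unliftP ord0 i) => [j ->|->]; rewrite ?row_cons0 // row_consS.
by apply/fph/hull_vertex; exact: ordered_mem (ordered_nth fq).
Qed.

(** A facet whose cone from [u] is nonzero has one coface on the side of [u]. If it lies in [ph],
    the other side is outside [sg]; otherwise that side carries one coface as well, with opposite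
    sign, and the terms cancel. Facets in the other faces of [sg] are coplanar with [u] and
    contribute nothing. *)
Lemma facet_sum (Vs : {fset T}) f : L f -> #|` f| = q.+1 ->
  (forall v, v \notin f -> L (v |` f)%fset -> v \in Vs) ->
  \sum_(v <- Vs | (v \notin f) && ((v |` f)%fset \in tops L q.+2))
     Num.sg (cone_det v f) * cone_det u f =
  if `[< hull f `<=` hull ph >] then `|cone_det u f| else 0.
Proof.
move=> Lf fq LV; have [D0|D0] := eqVneq (cone_det u f) 0.
  by rewrite D0 normr0 big1 => [|v _]; [case: ifP|rewrite mulr0].
have tE v : v \notin f -> ((v |` f)%fset \in tops L q.+2) <-> L (v |` f)%fset.
  move=> vf; rewrite in_tops //; split=> [[]//|Lv]; split=> //.
  by rewrite cardfsU1 vf fq.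
have [v1 [v1f Lv1 s1]] := side_exists Lf fq hu D0.
have c1 : (v1 \notin f) && ((v1 |` f)%fset \in tops L q.+2).
  by rewrite v1f; apply/tE.
have only v : (v \notin f) && ((v |` f)%fset \in tops L q.+2) -> v != v1 ->
    Num.sg (cone_det v f) = - Num.sg (cone_det u f).
  move=> /andP[vf /(tE _ vf) Lv] vv1.
  have := cone_det_neq0 fq vf Lv; have : Num.sg (cone_det v f) != Num.sg (cone_det u f).
    by apply: contraNneq vv1 => e; apply/eqP/(side_uniq Lf fq) => //; rewrite e.
  by move: D0; case: (sgrP (cone_det v f)); case: (sgrP (cone_det u f)); rewrite ?eqxx ?opprK.
set l := [seq v <- Vs | (v \notin f) && ((v |` f)%fset \in tops L q.+2)].
have ul : uniq l by rewrite filter_uniq // fset_uniq.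
have inl v : v \in l -> (v \notin f) && ((v |` f)%fset \in tops L q.+2).
  by rewrite mem_filter => /andP[].
have lin v : v \notin f -> L (v |` f)%fset -> v \in l.
  by move=> vf Lv; rewrite mem_filter vf LV // andbT; apply/tE.
have m1 : v1 \in l by exact: lin.
rewrite -big_filter -/l (bigD1_seq v1 m1 ul) /= s1 -normrEsg.
case: ifPn => [/asboolP fph|/asboolP nfph].
  rewrite big1_seq ?addr0 // => v /andP[vv1 /inl cv].
  have s2 := only _ cv vv1; have /andP[vf /(tE _ vf) Lv] := cv.
  have hv : hull sg v by apply: subL Lv _ _; apply: hull_vertex; rewrite !inE eqxx.
  have [a0 as0 a1 _] := bcoP hv.
  have vE : cone_det v f = bco sg v u * cone_det u f.
    have := cone_det_bary f (@subset_refl _ (hull sg)) (bcoP hv).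
    rewrite (big_fsetD1 u) //= big1_seq ?addr0 // => w /andP[_ ws].
    by rewrite cone_det_base ?mulr0 //; exact: hull_vertex.
  move: s2; rewrite vE sgrM => s2.
  have : Num.sg (bco sg v u) = -1.
    apply: (mulIf (_ : Num.sg (cone_det u f) != 0)); first by rewrite sgr_eq0.
    by rewrite s2 mulN1r.
  by move/eqP; rewrite sgr_cp0 ltNge a0.
have f0 := geo_neq0 gL Lf; have hx := hull_barycenter f0; set x := barycenter f in hx.
have hsx : hull sg x by exact: subL hx.
have [a0 as0 a1 xE] := bcoP hsx.
set c := bco sg x u.
have c0 : 0 < c.
  rewrite lt_neqAle a0 andbT eq_sym; apply/negP => /eqP cu; apply: nfph.
  apply: (hull_face sgI phs (subL Lf) (inner_barycenter f0)).
  apply: (hull_bco0 sgI phs hsx) => v vs; rewrite !inE vs andbT negbK => /eqP ->.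
  exact: cu.
(* The barycenter is moved away from [u] by its own coordinate [c] at [u]. That coordinate becomes
   the square of [c], so the point stays in [sg], and it lies on the side of [f] opposite to [u]. *)
pose z := (1 + c) *: x - c *: u.
have zb : bary sg (fun v => (1 + c) * bco sg x v - c * (v == u)%:R) z.
  split.
  - move=> v; case: eqP => [->|_]; last by rewrite mulr0 subr0 mulr_ge0 // addr_ge0 // ltW.
    by rewrite mulr1 -/c mulrDl mul1r addrAC subrr add0r mulr_ge0 // ltW.
  - move=> v vs; rewrite as0 // mulr0 (_ : (v == u) = false) ?mulr0 ?subr0 //.
    by apply: contraNF vs => /eqP ->.
  - have [_ _ u1 _] := bary_vertex ush.
    by rewrite sumrB -!mulr_sumr a1 u1 !mulr1 addrK.
  - have [_ _ _ uE] := bary_vertex ush.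
    rewrite /z {1}xE {1}uE !scaler_sumr -sumrB; apply: eq_bigr => v _.
    by rewrite [RHS]scalerBl !scalerA.
have hz : hull sg z by apply/hull_bary; eexists; exact: zb.
have zD : cone_det z f = - c * cone_det u f.
  have -> : cone_det z f = \sum_(b <- [:: true; false]) (if b then 1 + c else - c) * cone_det (if b then x else u) f.
    apply: cone_det_lin => j; rewrite (bcoE sgI zb) !big_cons big_nil /= addr0.
    by rewrite (bcoE sgI (bary_vertex ush)) mulNr.
  by rewrite !big_cons big_nil /= addr0 (cone_det_hull Lf fq hx) mulr0 add0r.
have zD0 : cone_det z f != 0 by rewrite zD mulf_neq0 // oppr_eq0 gt_eqF.
have [v2 [v2f Lv2 s2]] := side_exists Lf fq hz zD0.
have s2' : Num.sg (cone_det v2 f) = - Num.sg (cone_det u f).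
  by rewrite s2 zD mulNr sgrN sgrM (gtr0_sg c0) mul1r.
have v21 : v2 != v1.
  apply: contraTneq D0 => e; have : Num.sg (cone_det u f) = - Num.sg (cone_det u f).
    by rewrite -[LHS]s1 -e s2'.
  by move=> h; rewrite negbK -sgr_eq0; apply/eqP; lra.
have c2 : (v2 \notin f) && ((v2 |` f)%fset \in tops L q.+2) by rewrite v2f; apply/tE.
have m2 : v2 \in [seq v <- l | v != v1] by rewrite mem_filter v21 lin.
rewrite -[\sum_(i <- l | _) _]big_filter (bigD1_seq v2 m2) /=; last exact: filter_uniq.
rewrite big1_seq => [|v]; last first.
  rewrite mem_filter => /andP[vv2 /andP[vv1 /inl cv]].
  have /andP[vf /(tE _ vf) Lv] := cv.
  by case/eqP: vv2; apply: (side_uniq Lf fq) => //; rewrite s2' (only _ cv vv1).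
by rewrite addr0 s2' mulNr -normrEsg subrr.
Qed.

End Step.

Lemma rel_vol_additive q (Q : 'M[R]_(q.+1, N)) sg L : ordered sg Q -> indep sg -> geo L ->
  body L = hull sg -> \sum_(s <- tops L q.+1) rel_vol Q sg s = 1.
Proof.
elim: q Q sg L => [|q IH] Q sg L sgQ sgI gL bL.
  have [u ush] : exists u, u \in sg by exists (row ord0 Q); exact: ordered_mem sgQ.
  have sgE : sg = [fset u]%fset.
    by apply/eqP; rewrite eq_sym eqEfcard fsub1set ush (ordered_card sgQ) cardfs1.
  have only s : L s -> s = [fset u]%fset.
    move=> Ls; apply/eqP; rewrite eqEfsubset; apply/andP; split; last first.
      have /fset0Pn[v vs] := geo_neq0 gL Ls; rewrite fsub1set.
      suff -> : u = v by [].
      have : hull sg v by rewrite -bL; exists s => //; exact: hull_vertex.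
      by rewrite sgE => /hull_bary[a [_ _ + ->]]; rewrite !big_seq_fset1 => ->; rewrite scale1r.
    apply/fsubsetP => v vs; have : hull sg v by rewrite -bL; exists s => //; exact: hull_vertex.
    by rewrite sgE inE => /hull_bary[a [_ _ + ->]]; rewrite !big_seq_fset1 => ->; rewrite scale1r.
  have Lu : L [fset u]%fset.
    by have [s Ls _] : body L u by [rewrite bL; exact: hull_vertex]; rewrite -(only _ Ls).
  have -> : tops L 1 = [fset [fset u]]%fset.
    apply/fsetP => s; rewrite inE; apply/idP/eqP => [/(in_tops _ _ gL)[/only]//|->].
    by apply/in_tops; rewrite ?cardfs1.
  have sN : ordered sg (ord_mx [fset u]%fset 1) by rewrite sgE; exact: ordered_nth (cardfs1 u).
  rewrite big_seq_fset1 /rel_vol det_mx11.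
  have hP i : hull sg (row i (ord_mx [fset u]%fset 1)) by apply: hull_vertex; exact: ordered_mem sN.
  by have := coord_mx_sum sgQ hP 0; rewrite big_ord1 => ->; rewrite normr1.
pose u := row ord0 Q; pose ph := (sg `\ u)%fset; pose Q' := \matrix_i row (lift ord0 i) Q.
have ush : u \in sg by exact: ordered_mem sgQ.
have phs : (ph `<=` sg)%fset by exact: fsubsetDl.
have phI : indep ph by exact: indep_sub sgI.
rewrite ?row_cons0 ?row_consS ?rowK.
have phQ : ordered ph Q'.
  have [e iQ] := sgQ; split=> [v|i j]; last by rewrite !rowK => /iQ/lift_inj.
  rewrite !inE; split=> [/andP[vu /e[i iE]]|[i <-]].
    case: (unliftP ord0 i) => [j ij|i0]; first by exists j; rewrite rowK -ij.
    by case/eqP: vu; rewrite -iE i0.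
  rewrite rowK (ordered_mem _ sgQ) andbT; apply/negP => /eqP/iQ/eqP.
  by rewrite eq_sym (negbTE (neq_lift _ _)).
pose Vs := (\bigcup_(s <- tops L q.+2) s)%fset.
have inVs s v : L s -> #|` s| = q.+2 -> v \in s -> v \in Vs.
  move=> Ls sq vs; apply/bigfcupP; exists s => //; rewrite andbT.
  by apply/in_tops.
pose t v f := Num.sg (cone_det sg Q v f) * cone_det sg Q u f.
(* Pairs of a top simplex and one of its vertices are regrouped as pairs of a facet and an apex over
   it; the common vertex set [Vs] makes the two sums exchangeable. *)
transitivity (\sum_(v <- Vs) \sum_(s <- tops L q.+2 | v \in s) t v (s `\ v)%fset).
  rewrite (exchange_big_dep xpredT) //=; apply: eq_big_seq => s /(in_tops _ _ gL)[Ls sq].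
  rewrite (rel_vol_stokes sgQ gL bL Ls sq) [RHS]big_fset_condE.
  apply: eq_fbig => [v|//]; rewrite !inE /=; apply/idP/andP => [vs|[]//]; split=> //.
  exact: inVs vs.
have facets v : \sum_(s <- tops L q.+2 | v \in s) t v (s `\ v)%fset =
    \sum_(f <- tops L q.+1 | (v \notin f) && ((v |` f)%fset \in tops L q.+2)) t v f.
  rewrite [LHS]big_fset_condE [RHS]big_fset_condE.
  transitivity (\sum_(f <- [fset (s `\ v)%fset | s in [fset s in tops L q.+2 | v \in s]]%fset) t v f); last first.
    apply: eq_fbigl => f; apply/imfsetP/idP => [[s /= + ->]|]; last first.
      rewrite !inE /= => /andP[_ /andP[vf vft]]; exists (v |` f)%fset; last by rewrite fsetU1K.
      by rewrite /= !inE vft eqxx.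
    rewrite !inE /= => /andP[st vs]; have /(in_tops _ _ gL)[Ls sq] := st.
    rewrite eqxx /= fsetD1K // st andbT; apply/in_tops => //.
    have fq : #|` (s `\ v)%fset| = q.+1 by have := sq; rewrite (cardfsD1 v) vs add1n => -[].
    split=> //; apply: (geo_face gL Ls); first exact: fsubsetDl.
    by rewrite -cardfs_eq0 fq.
  rewrite [RHS]big_imfset //= => s s'; rewrite !inE /= => /andP[_ vs] /andP[_ vs'] e.
  by rewrite -(fsetD1K vs) e fsetD1K.
rewrite (eq_bigr _ (fun v _ => facets v)).
rewrite (exchange_big_dep xpredT) //=.
(* The simplices of [L] inside [ph] triangulate it: as [ph] is a face, the smallest simplex
   containing a point of [ph] lies in [ph]. *)
pose Lp : set {fset T} := [set s | L s /\ hull s `<=` hull ph].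
have gLp : geo Lp.
  split.
  - by apply: sub_finite_set (geo_fin gL) => s [].
  - by move=> s [Ls _]; exact: geo_neq0 gL _ Ls.
  - move=> s s' [Ls sp] ss s0; split; first exact: geo_face gL _ _ Ls ss s0.
    exact: subset_trans (hull_sub ss) sp.
  - by move=> s s' a b x [Ls _] [Ls' _]; exact: geo_uniq gL _ _ _ _ _ Ls Ls'.
have subL s : L s -> hull s `<=` hull sg by move=> Ls x sx; rewrite -bL; exists s.
have bLp : body Lp = hull ph.
  apply/seteqP; split=> x; first by move=> [s [_ sp] /sp].
  move=> px; have [s Ls sx] : body L x by rewrite bL; exact: hull_sub phs _ px.
  have [s' [Ls' _ s'x]] := geo_support gL Ls sx.
  exists s'; last by case: s'x => a ? _; apply/hull_bary; exists a.
  by split=> //; exact: (hull_face sgI phs (subL _ Ls') s'x).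
rewrite -(IH Q' ph Lp phQ phI gLp bLp).
rewrite (eq_big_seq (fun f => if `[< hull f `<=` hull ph >] then rel_vol Q' ph f else 0)); last first.
  move=> f /(in_tops _ _ gL)[Lf fq]; rewrite (facet_sum sgQ sgI gL bL Lf fq).
    (* The row of [u] in the coordinate matrix is a unit vector, so expanding along it leaves the
       coordinate matrix relative to [ph]. *)
    case: ifP => // /asboolP fp; congr (`|_|); rewrite /cone_det (expand_det_row _ ord0) big_ord_recl big1.
      rewrite addr0 mxE row_cons0 -/u (bcoE sgI (bary_vertex ush)) eqxx mul1r /cofactor expr0 mul1r.
      congr (\det _); apply/matrixP => i j; rewrite !mxE row_consS !rowK (bco_sub sgI phs) //.
      by apply/fp/hull_vertex; rewrite mem_nth // fq.
    move=> j _; rewrite mxE row_cons0 (bcoE sgI (bary_vertex ush)) (_ : _ == _ = false) ?mul0r //.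
    apply/negP => /eqP/sgQ.2/eqP; by rewrite eq_sym (negbTE (neq_lift _ _)).
  by move=> v vf Lv; apply: (inVs _ _ Lv); rewrite ?cardfsU1 ?vf ?fq // !inE eqxx.
rewrite -big_mkcond /= big_fset_condE; apply: eq_fbigl => s; rewrite !inE /=; apply/andP/idP.
  by move=> [/(in_tops _ _ gL)[Ls sq] /asboolP sp]; apply/in_tops.
move=> /(in_tops _ _ gLp)[[Ls sp] sq]; split; [exact/in_tops|exact/asboolP].
Qed.

End Additivity.

(** * Transfers along paths *)

Section Transfer.
Context (R : realType) (I : choiceType) (S : {fset I}) (adj : I -> I -> Prop)
  (Rel : (I -> R) -> (I -> R) -> Prop).
Implicit Types (a b : I -> R) (s t : I).

Definition move a s t (d : R) x := if x == s then a x - d else if x == t then a x + d else a x.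

Lemma move_src a s t d : move a s t d s = a s - d.
Proof. by rewrite /move eqxx. Qed.

Lemma move_tgt a s t d : t != s -> move a s t d t = a t + d.
Proof. by rewrite /move eqxx => /negbTE ->. Qed.

Lemma move_off a s t d x : x != s -> x != t -> move a s t d x = a x.
Proof. by rewrite /move => /negbTE -> /negbTE ->. Qed.

Definition pos a := forall s, s \in S -> 0 < a s.

Hypothesis conn : forall (Q : I -> Prop) s0, s0 \in S -> Q s0 ->
  (forall s t, s \in S -> t \in S -> adj s t -> Q s -> Q t) -> forall t, t \in S -> Q t.
Hypothesis trans : forall a b c, Rel a b -> Rel b c -> Rel a c.
Hypothesis eqS : forall a b, (forall s, s \in S -> a s = b s) -> Rel a b.
Hypothesis moves : forall a s t d, s \in S -> t \in S -> s != t -> adj s t ->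
  pos a -> 0 < d < a s -> Rel a (move a s t d).

Lemma move_pos a s t d : pos a -> 0 < d < a s -> pos (move a s t d).
Proof.
move=> pa /andP[d0 ds] x xS; rewrite /move; case: eqP => [->|_]; first by rewrite subr_gt0.
by case: eqP => _; [rewrite addr_gt0 // pa|exact: pa].
Qed.

(* Mass is passed along a path one edge at a time; each intermediate vertex
   returns to its initial mass, so positivity is preserved. *)
Lemma transfer a s t d : s \in S -> t \in S -> s != t -> pos a -> 0 < d < a s ->
  Rel a (move a s t d).
Proof.
move=> sS tS st pa ds.
suff : s = t \/ forall a, pos a -> 0 < d < a s -> Rel a (move a s t d).
  by case=> [e|]; [rewrite e eqxx in st|apply].
move: t tS {st}; apply: (conn sS); first by left.
move=> t t' tS t'S tt' Qt; have [->|st'] := eqVneq t' s; first by left.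
have st : s != t' by rewrite eq_sym.
right=> {}a {}pa {}ds; have [tE|tt] := eqVneq t t'.
  case: Qt => [sE|]; last by rewrite -tE; apply.
  by rewrite -tE sE eqxx in st.
case: Qt => [sE|Qt]; first by rewrite -sE in tt'; exact: moves.
have [sE|s_t] := eqVneq s t; first by rewrite -sE in tt'; exact: moves.
have t_s : t != s by rewrite eq_sym.
apply: trans (Qt _ pa ds) _.
have -> : move a s t' d = move (move a s t d) t t' d.
  apply/funext => x; rewrite /move; have [->|xs] := eqVneq x s.
    by rewrite (negbTE s_t) (negbTE st).
  have [->|xt] := eqVneq x t; first by rewrite (negbTE tt) addrK.
  by [].
apply: moves => //; first exact: move_pos.
have [d0 _] := andP ds; rewrite d0 /move (negbTE t_s) eqxx ltrDr.
exact: pa.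
Qed.

(** Induction on the number of points where [a] and [b] differ: transferring the smaller of one
    excess and one deficit settles at least one of the two points and spoils no other. *)
Lemma transfer_all a b : pos a -> pos b -> \sum_(s <- S) a s = \sum_(s <- S) b s -> Rel a b.
Proof.
move: {2}_.+1 (ltnSn #|` [fset s in S | a s != b s]%fset|) => m.
elim: m a => // m IH a; rewrite ltnS => am pa pb ab.
have [e|/existsNP[s0 /not_implyP[s0S /eqP ns0]]] :=
  pselect (forall s, s \in S -> a s = b s); first exact: eqS.
have key a' b' : \sum_(s <- S) a' s = \sum_(s <- S) b' s -> (exists2 s, s \in S & a' s != b' s) ->
    exists2 s, s \in S & b' s < a' s.
  move=> e [s sS ns]; apply: contrapT => h.
  have le x : x \in S -> a' x <= b' x.
    by move=> xS; rewrite leNgt; apply/negP => ?; apply: h; exists x.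
  have : \sum_(s <- S) (b' s - a' s) == 0 by rewrite sumrB e subrr.
  rewrite big_seq psumr_eq0 => [|x xS]; last by rewrite subr_ge0 le.
  move=> /allP/(_ s sS); rewrite sS subr_eq0 eq_sym => /eqP e'.
  by rewrite e' eqxx in ns.
have [s sS bas] := key a b ab (ex_intro2 _ _ s0 s0S ns0).
have [t tS abt] : exists2 t, t \in S & a t < b t.
  by apply: key; [exact: esym|exists s0 => //; rewrite eq_sym].
have st : s != t by apply: contraTneq bas => ->; rewrite -leNgt ltW.
have ts : t != s by rewrite eq_sym.
pose d := Num.min (a s - b s) (b t - a t).
have d0 : 0 < d by rewrite lt_min !subr_gt0 bas abt.
have d1 : d <= a s - b s by rewrite ge_min lexx.
have ds : d < a s by have := pb _ sS; lra.
apply: trans (transfer sS tS st pa (_ : 0 < d < a s)) _; first by rewrite d0.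
have tSs : t \in (S `\ s)%fset by rewrite !inE ts.
apply: IH => //; [|by apply: move_pos => //; rewrite d0|]; last first.
  rewrite -ab (big_fsetD1 s) // [RHS](big_fsetD1 s) //= (big_fsetD1 t) // [in RHS](big_fsetD1 t) //=.
  rewrite {1 2}/move eqxx (negbTE ts) eqxx.
  rewrite (eq_big_seq a); first by ring.
  by move=> x; rewrite !inE => /and3P[/negbTE xt /negbTE xs _]; rewrite /move xt xs.
apply: leq_trans am; apply: fproper_ltn_card; rewrite fproperE; apply/andP; split.
  apply/fsubsetP => x; rewrite !inE /= => /andP[-> /=]; rewrite /move.
  case: (x =P s) => [->|_]; first by move=> _; rewrite gt_eqF.
  by case: (x =P t) => [->|_ //] _; rewrite lt_eqF.
apply/fsubsetPn; have [e|e] := leP (a s - b s) (b t - a t).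
  exists s; first by rewrite !inE sS /= gt_eqF.
  by rewrite !inE sS /= negbK /move eqxx /d (min_idPl e) subKr.
exists t; first by rewrite !inE tS /= lt_eqF.
by rewrite !inE tS /= negbK /move (negbTE ts) eqxx /d (min_idPr (ltW e)) addrC subrK.
Qed.

End Transfer.

(** * Orientations *)

Section Orientation.
Context (R : realType) (N n : nat) (P : set 'rV[R]_N).
Local Notation T := 'rV[R]_N.
Implicit Types (s t r f g : {fset T}) (x u v z : T) (K L : set {fset T}).
Implicit Types (o : {fset T} -> 'M[R]_(n.+1, N) -> R).

Lemma ordered_fset m r (X : 'M[R]_(m, N)) : ordered r X -> [fset row i X | i in 'I_m]%fset = r.
Proof.
move=> [e _]; apply/fsetP => v; apply/imfsetP/idP => [[i _ ->]|/e[i <-]]; last by exists i.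
by apply/e; exists i.
Qed.

Lemma orientation_sign o s M : pl_orientation P o -> simplex_in n.+1 P s ->
  frame (tangent s) M -> o s M = 1 \/ o s M = -1.
Proof. by move=> oP sP /(orientation_simplex oP sP)[]. Qed.

Lemma simplex_frame s (Q : 'M[R]_(n.+2, N)) : is_simplex n.+1 s -> ordered s Q ->
  frame (tangent s) (edges Q).
Proof. by move=> [/affinely_indepP sI _]; exact: edges_frame. Qed.

Lemma orientation_across o r a b (X : 'M[R]_(n.+1, N)) : pl_orientation P o -> ordered r X ->
  simplex_in n.+1 P (a |` r)%fset -> simplex_in n.+1 P (b |` r)%fset ->
  hull (a |` r)%fset `&` hull (b |` r)%fset = hull r ->
  o (a |` r)%fset (edges (cons_mx a X)) = - o (b |` r)%fset (edges (cons_mx b X)).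
Proof.
move=> oP rX sa sb ab; rewrite !edges_cons.
have := orientation_coherent oP (a := a) (b := b) (X := X) (ltn0Sn n).
by rewrite (ordered_fset rX); exact.
Qed.

Section Complex.
Context (K : set {fset T}).
Hypotheses (gK : geo K) (bK : body K = P).

Lemma geo_simplex_in s m : K s -> #|` s| = m.+1 -> simplex_in m P s.
Proof.
move=> Ks sm; split; last by rewrite -bK => x sx; exists s.
by split=> //; apply/affinely_indepP; exact: geo_indep gK Ks.
Qed.

Lemma hull_cofaces r a b : a \notin r -> b \notin r -> a != b -> K (a |` r)%fset -> K (b |` r)%fset ->
  hull (a |` r)%fset `&` hull (b |` r)%fset = hull r.
Proof.
move=> ar br ab Ka Kb; have rE : ((a |` r) `&` (b |` r))%fset = r.
  apply/fsetP => v; rewrite !inE; case: (boolP (v \in r)) => vr; rewrite ?orbT //= !orbF.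
  by apply/negP => /andP[/eqP -> /eqP e]; rewrite e eqxx in ab.
apply/seteqP; split=> x.
  by move=> [xa xb]; have := geo_meet gK Ka Kb xa xb; rewrite rE.
by move=> xr; split; apply: hull_sub xr; exact: fsubsetUr.
Qed.

(* Three n-simplices on a common facet would induce pairwise opposite signs. *)
Lemma no_three_cofaces o r a b c : pl_orientation P o -> #|` r| = n.+1 ->
  a \notin r -> b \notin r -> c \notin r -> a != b -> b != c -> a != c ->
  K (a |` r)%fset -> K (b |` r)%fset -> K (c |` r)%fset -> False.
Proof.
move=> oP rn ar br cr ab bc ac Ka Kb Kc.
have rX := ordered_nth rn; set X := \matrix_i _ in rX.
have sim v : v \notin r -> K (v |` r)%fset -> simplex_in n.+1 P (v |` r)%fset.
  by move=> vr Kv; apply: geo_simplex_in => //; rewrite cardfsU1 vr rn.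
have sa := sim _ ar Ka; have sb := sim _ br Kb; have sc := sim _ cr Kc.
have e1 := orientation_across oP rX sa sb (hull_cofaces ar br ab Ka Kb).
have e2 := orientation_across oP rX sb sc (hull_cofaces br cr bc Kb Kc).
have e3 := orientation_across oP rX sa sc (hull_cofaces ar cr ac Ka Kc).
have := orientation_sign oP sa (simplex_frame sa.1 (ordered_cons ar rX)).
rewrite e1 e2 in e3 *.
by case: (orientation_sign oP sc (simplex_frame sc.1 (ordered_cons cr rX))) => h;
  rewrite h in e3 *; lra.
Qed.

End Complex.

Lemma subset_card s m : (m <= #|` s|)%N -> exists2 r, (r `<=` s)%fset & #|` r| = m.
Proof.
move=> ms; exists [fset x in take m s]%fset.
  by apply/fsubsetP => x; rewrite !inE /=; exact: mem_take.
rewrite card_fseq undup_id; first by rewrite size_take_min; apply/minn_idPl.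
by apply: take_uniq; exact: fset_uniq.
Qed.

(** A simplex with n+3 vertices splits into an edge [[a, b]] and a complementary face [r] with n+1
    vertices. After starring the edge at its midpoint [c], the apexes [a], [b] and [c] give three
    oriented simplices on the facet [r]. *)
Lemma orientation_dim o K : pl_orientation P o -> geo K -> body K = P -> dim_le n.+1 K.
Proof.
move=> oP gK bK s Ks; rewrite leqNgt; apply/negP => sn.
have [s' ss' s'n] := subset_card sn.
have Ks' : K s' by apply: (geo_face gK Ks) => //; rewrite -cardfs_eq0 s'n.
have /fset0Pn[a as'] : s' != fset0 by rewrite -cardfs_eq0 s'n.
have s1n : #|` (s' `\ a)%fset| = n.+2 by have := s'n; rewrite (cardfsD1 a) as' add1n => -[].
have /fset0Pn[b bs1] : (s' `\ a)%fset != fset0 by rewrite -cardfs_eq0 s1n.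
set r := (s' `\ a `\ b)%fset.
have rn : #|` r| = n.+1 by have := s1n; rewrite (cardfsD1 b) bs1 add1n => -[].
have ab : a != b by move: bs1; rewrite !inE eq_sym => /andP[].
have ar : a \notin r by rewrite !inE eqxx andbF.
have br : b \notin r by rewrite !inE eqxx.
have s'E : s' = (a |` (b |` r))%fset by rewrite /r fsetD1K // fsetD1K.
clearbody r.
set e := [fset a; b]%fset.
have es' : (e `<=` s')%fset.
  by rewrite s'E; apply/fsubsetP => v; rewrite !inE => /orP[] ->; rewrite ?orbT.
have Ke : K e by apply: (geo_face gK Ks') => //; apply/fset0Pn; exists a; rewrite !inE eqxx.
have h0 : (0 : R) < 2^-1 by rewrite invr_gt0.
have h1 : (2^-1 : R) < 1 by rewrite invf_lt1 // ltr1n.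
have ew := inner2 h0 h1 ab; set c := _ + _ in ew.
have e2 : (1 < #|` e|)%N by rewrite cardfs2 ab.
have cK := star_new gK Ke ew e2.
have cs' := cK _ Ks'.
have cr : c \notin r by apply: contra cs'; apply/fsubsetP; rewrite s'E fsetUA fsubsetUr.
have ca : a != c by apply: contraNneq cs' => <-.
have cb : b != c by apply: contraNneq cs' => <-; rewrite s'E !inE eqxx orbT.
have sube t : (e `<=` t)%fset = (a \in t) && (b \in t) by rewrite fsubUset !fsub1set.
have ba : b != a by rewrite eq_sym.
have gS := geo_star gK Ke ew e2; have bS := body_star gK Ke ew e2.
have nE (v : T) : (v |` r)%fset != fset0 by apply/fset0Pn; exists v; rewrite !inE eqxx.
apply: (no_three_cofaces gS _ oP rn ar br cr ab cb ca); first by rewrite bS.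
- split; first by rewrite sube !inE (negbTE ba) (negbTE br) andbF.
  left; apply: (geo_face gK Ks') => //; rewrite s'E; apply: fsetUS; exact: fsubsetUr.
- split; first by rewrite sube !inE (negbTE ab) (negbTE ar).
  left; apply: (geo_face gK Ks') => //; rewrite s'E; exact: fsubsetUr.
- split; first by rewrite sube !inE (negbTE ca) (negbTE ar).
  right; rewrite !inE eqxx fsetU1K //; split=> //.
  suff -> : (r `|` e)%fset = s' by [].
  by rewrite s'E; apply/fsetP => v; rewrite !inE orbC -orbA.
Qed.

Lemma orientation_two_cofaces o K r a b : pl_orientation P o -> geo K -> body K = P ->
  #|` r| = n.+1 -> a \notin r -> b \notin r -> a != b ->
  K (a |` r)%fset -> K (b |` r)%fset -> two_cofaces K r a b.
Proof.
move=> oP gK bK rn ar br ab Ka Kb; split=> //; split=> // t Kt rt.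
have tn := orientation_dim oP gK bK Kt.
have [tr|] := boolP (t `<=` r)%fset.
  by left; apply: fsubset_trans tr _; exact: fsubsetUr.
case/fsubsetPn => c ct cr.
have tE : t = (c |` r)%fset.
  by apply/esym/eqP; rewrite eqEfcard fsubUset fsub1set ct rt cardfsU1 cr rn.
rewrite tE; have [->|ca] := eqVneq c a; first by left; exact: fsubset_refl.
have [->|cb] := eqVneq c b; first by right; exact: fsubset_refl.
rewrite tE in Kt; case: (no_three_cofaces gK bK oP rn ar br cr ab _ _ Ka Kb Kt); by rewrite eq_sym.
Qed.

Definition std_edges s : 'M[R]_(n.+1, N) := edges (ord_mx s n.+2).
Local Notation E := std_edges.

Lemma ordE s : #|` s| = n.+2 -> ordered s (ord_mx s n.+2).
Proof. exact: ordered_nth. Qed.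

Definition rel_sign o o' s : R := o s (E s) * o' s (E s).

Lemma rel_signE o o' s (Q : 'M[R]_(n.+2, N)) : pl_orientation P o -> pl_orientation P o' ->
  simplex_in n.+1 P s -> ordered s Q -> o s (edges Q) * o' s (edges Q) = rel_sign o o' s.
Proof.
move=> oP oP' sP sQ; have sN := ordE sP.1.2.
have [A QE] := rows_tangent sN (edges_tangent sQ).
have fN := simplex_frame sP.1 sN.
have Au : A \in unitmx.
  rewrite -row_free_unit; apply: inj_row_free => u uA.
  apply: (indep_edges_free ((affinely_indepP _).1 sP.1.1) sQ).
  by rewrite QE mulmxA uA mul0mx.
have [_ h] := orientation_simplex oP sP fN; have [_ h'] := orientation_simplex oP' sP fN.
rewrite QE h // h' // mulrACA -expr2 sqr_sg -unitfE -unitmxE Au mul1r.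
by [].
Qed.

(** Both orientations change sign across the common facet, so their product does not. *)
Lemma rel_sign_adj o o' K s t : pl_orientation P o -> pl_orientation P o' ->
  geo K -> body K = P -> K s -> K t -> #|` s| = n.+2 -> #|` t| = n.+2 ->
  #|` (s `&` t)%fset| = n.+1 -> rel_sign o o' s = rel_sign o o' t.
Proof.
move=> oP oP' gK bK Ks Kt sn tn stn.
have [r [a [b [rn ar br ab [sE tE]]]]] : exists r a b, [/\ #|` r| = n.+1,
    a \notin r, b \notin r, a != b & s = (a |` r)%fset /\ t = (b |` r)%fset].
  have ex (u : {fset T}) : (s `&` t `<=` u)%fset -> #|` u| = n.+2 -> exists2 a, a \notin (s `&` t)%fset & u = (a |` (s `&` t))%fset.
    move=> su un; have /fsubsetPn[a au ast] : ~~ (u `<=` s `&` t)%fset.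
      by apply/negP => /fsubset_leq_card; rewrite un stn ltnn.
    by exists a => //; apply/esym/eqP; rewrite eqEfcard fsubUset fsub1set au su cardfsU1 ast stn un add1n leqnn.
  have [a ast sE] := ex _ (fsubsetIl s t) sn; have [b bst tE] := ex _ (fsubsetIr s t) tn.
  exists (s `&` t)%fset, a, b; split=> //; apply: contraNneq ast => e.
  by rewrite inE {1}sE !inE eqxx /= tE e !inE eqxx.
have rX := ordered_nth rn; set X := \matrix_i _ in rX.
have sP := geo_simplex_in gK bK Ks sn; have tP := geo_simplex_in gK bK Kt tn.
have oa := ordered_cons ar rX; have ob := ordered_cons br rX.
rewrite sE in Ks sP *; rewrite tE in Kt tP *.
rewrite -(rel_signE oP oP' sP oa) -(rel_signE oP oP' tP ob).
have hr := hull_cofaces gK ar br ab Ks Kt.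
rewrite (orientation_across oP rX sP tP hr) (orientation_across oP' rX sP tP hr).
by rewrite mulrNN.
Qed.

(** * Forms on a refinement and their total volume *)

Section Forms.
Context (W : pc_form R N n.+1) (o1 : {fset T} -> 'M[R]_(n.+1, N) -> R) (K : set {fset T}).
Let K1 := support_complex W.
Hypotheses (g1 : geo K1) (b1 : body K1 = P) (gK : geo K) (bK : body K = P).
Hypotheses (rK : refines K K1) (o1P : pl_orientation P o1) (o1W : induces_orientation W o1).
Hypothesis W_forms : forall s, n_simplices n.+1 K1 s ->
  nform_on (tangent s) (form_on W s) /\ nonzero_on (tangent s) (form_on W s).

Definition pulled s : 'M[R]_(n.+1, N) -> R := form_on W (carrier n.+1 K1 s).

Let d1 : dim_le n.+1 K1. Proof. exact: orientation_dim o1P g1 b1. Qed.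

Lemma carrier_spec s : K s -> #|` s| = n.+2 ->
  [/\ K1 (carrier n.+1 K1 s), is_simplex n.+1 (carrier n.+1 K1 s),
      hull s `<=` hull (carrier n.+1 K1 s) & tangent s = tangent (carrier n.+1 K1 s)].
Proof.
move=> Ks sn; have [sS _] := geo_simplex_in gK bK Ks sn.
have [t Kt st] := rK Ks; rewrite (carrierE g1 d1 sS Kt st).
have [_ tS] := hull_simplex_uniq g1 d1 sS Kt Kt st st.
by split=> //; exact: (tangent_eq_hull tS sS st).
Qed.

Lemma pulled_form s : K s -> #|` s| = n.+2 -> nform_on (tangent s) (pulled s).
Proof.
by move=> Ks sn; have [Kc cS _ ->] := carrier_spec Ks sn; exact: (W_forms (conj Kc cS)).1.
Qed.

Lemma pulled_sign s (Q : 'M[R]_(n.+2, N)) : K s -> ordered s Q ->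
  o1 s (edges Q) = Num.sg (pulled s (edges Q)).
Proof.
move=> Ks sQ; have sn := ordered_card sQ; have [Kc cS sc te] := carrier_spec Ks sn.
have sP := geo_simplex_in gK bK Ks sn.
have cP := geo_simplex_in g1 b1 Kc cS.2.
have fr := simplex_frame sP.1 sQ.
rewrite (orientation_sub o1P sP cP sc fr); apply: o1W; first by split.
by rewrite -te.
Qed.

Lemma pulled_neq0 s (Q : 'M[R]_(n.+2, N)) : K s -> ordered s Q -> pulled s (edges Q) != 0.
Proof.
move=> Ks sQ; have sn := ordered_card sQ; have sP := geo_simplex_in gK bK Ks sn.
have := orientation_sign o1P sP (simplex_frame sP.1 sQ).
rewrite (pulled_sign Ks sQ) -sgr_eq0 => -[] ->; first exact: oner_neq0.
by rewrite oppr_eq0 oner_neq0.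
Qed.

(** The simplices of [K] are grouped by their carrier [t]: those inside [t] triangulate it, and
    their relative volumes add up to 1. *)
Lemma volume_refine :
  \sum_(s <- tops K1 n.+2) `|form_on W s (E s)| = \sum_(s <- tops K n.+2) `|pulled s (E s)|.
Proof.
have car s : s \in tops K n.+2 -> carrier n.+1 K1 s \in tops K1 n.+2.
  move=> /(in_tops _ _ gK)[Ks sn]; have [Kc cS _ _] := carrier_spec Ks sn.
  by apply/in_tops => //; split=> //; exact: cS.2.
transitivity (\sum_(t <- tops K1 n.+2) \sum_(s <- tops K n.+2 | carrier n.+1 K1 s == t) `|pulled s (E s)|); last first.
  rewrite (exchange_big_dep xpredT) //=; apply: eq_big_seq => s sK.
  rewrite (eq_bigl (fun t => t == carrier n.+1 K1 s)); last by move=> t; rewrite eq_sym.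
  rewrite -big_filter; have -> : [seq i <- tops K1 n.+2 | i == carrier n.+1 K1 s] = [:: carrier n.+1 K1 s].
    by rewrite filter_pred1_uniq ?car // fset_uniq.
  by rewrite big_seq1.
apply: eq_big_seq => t /(in_tops _ _ g1)[Kt tn].
have tP := geo_simplex_in g1 b1 Kt tn; have tI := (affinely_indepP _).1 tP.1.1.
have tQ := ordE tn.
pose L : set {fset T} := [set s | K s /\ hull s `<=` hull t].
have gL : geo L.
  split.
  - by apply: sub_finite_set (geo_fin gK) => s [].
  - by move=> s [Ls _]; exact: geo_neq0 gK _ Ls.
  - move=> s s' [Ls sp] ss s0; split; first exact: geo_face gK _ _ Ls ss s0.
    exact: subset_trans (hull_sub ss) sp.
  - by move=> s s' a b x [Ls _] [Ls' _]; exact: geo_uniq gK _ _ _ _ _ Ls Ls'.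
have bL : body L = hull t.
  apply/seteqP; split=> x; first by move=> [s [_ sp] /sp].
  move=> tx; have [s Ks sx] : body K x by rewrite bK -b1; exists t.
  have [s' [Ks' _ s'x]] := geo_support gK Ks sx.
  have s'h : hull s' x by case: s'x => a ? _; apply/hull_bary; exists a.
  exists s' => //; split=> //; have [t' Kt' st'] := rK Ks'.
  apply: subset_trans (hull_sub (fsubsetIl t t')).
  apply: (hull_face (geo_indep g1 Kt') (fsubsetIr t t') st' s'x).
  by apply: (geo_meet g1) => //; exact: st'.
rewrite -[LHS]mul1r -(rel_vol_additive tQ tI gL bL) mulr_suml.
rewrite [RHS]big_fset_condE /=.
have eS : tops L n.+2 =i [fset s in tops K n.+2 | carrier n.+1 K1 s == t]%fset.
  move=> s; rewrite !inE /=; apply/idP/andP.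
    move=> /(in_tops _ _ gL)[[Ks st] sn]; split; first exact/in_tops.
    by apply/eqP; apply: carrierE => //; exact: (geo_simplex_in gK bK Ks sn).1.
  move=> [/(in_tops _ _ gK)[Ks sn] /eqP ct]; apply/in_tops => //; split=> //; split=> //.
  by have [_ _ h _] := carrier_spec Ks sn; rewrite -ct.
apply: eq_fbig => [s|s]; first by rewrite eS.
move=> /(in_tops _ _ gL)[[Ks st] sn].
have sS := (geo_simplex_in gK bK Ks sn).1.
have pE : pulled s = form_on W t by rewrite /pulled (carrierE g1 d1 sS Kt st).
have sN := ordE sn.
have hs i : hull t (row i (ord_mx s n.+2)) by apply/st/hull_vertex; exact: ordered_mem sN.
have wt := (W_forms (conj Kt tP.1)).1.
rewrite pE /std_edges {1}(coord_mx_mul tQ hs) (form_stochastic (edges_tangent tQ) wt); last first.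
  by move=> i; exact: coord_mx_sum tQ hs i.
by rewrite normrM.
Qed.

(** For the orientation induced by the form every simplex counts with the absolute value of its
    volume; [e] compares that orientation with the given one. *)
Lemma total_volume_refine o : pl_orientation P o ->
  forall e, (forall s, K1 s -> #|` s| = n.+2 -> rel_sign o o1 s = e) ->
  total_volume o W = e * (\sum_(s <- tops K n.+2) `|pulled s (E s)|) / n.+1`!%:R.
Proof.
move=> oP e e1; rewrite -volume_refine /total_volume.
have fin : finite_set (n_simplices n.+1 K1).
  by apply: sub_finite_set (geo_fin g1) => s [].
rewrite fsbig_finite //= mulr_sumr mulr_suml.
have eS : fset_set (n_simplices n.+1 (support_complex W)) =i tops K1 n.+2.
  move=> s; rewrite in_fset_set //; apply/idP/idP.
    by move=> /set_mem[Ks sS]; apply/in_tops => //; split=> //; exact: sS.2.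
  move=> /(in_tops _ _ g1)[Ks sn]; apply/mem_set; split=> //.
  exact: (geo_simplex_in g1 b1 Ks sn).1.
apply: eq_fbig => [s|s]; first exact: eS.
rewrite eS => /(in_tops _ _ g1)[Ks sn].
rewrite /simplex_integral; have -> : \matrix_(i < n.+1) (nth 0 s i.+1 - nth 0 s 0) = E s.
  by apply/row_matrixP => i; rewrite row_edges !rowK.
have sP := geo_simplex_in g1 b1 Ks sn; have fr := simplex_frame sP.1 (ordE sn).
congr (_ / _); rewrite -(e1 _ Ks sn) /rel_sign (o1W (conj Ks sP.1) fr).
by rewrite -mulrA -numEsg.
Qed.

End Forms.
End Orientation.

(** * Conclusion *)

Section Assembly.
Context (R : realType) (N : nat).
Local Notation T := 'rV[R]_N.
Implicit Types (s t r f g : {fset T}) (x u v z : T) (K L : set {fset T}).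

(** Neighbourhoods that meet only finitely many simplices have a finite subcover, and every simplex
    meets one of its members. *)
Lemma compact_geo (P : set T) K : compact P -> triangulation P K -> geo K.
Proof.
move=> cP [cK bK]; apply: complex_geo => //.
have /choice[U UE] : forall x, exists U : set T, P x ->
    nbhs x U /\ finite_set [set s | K s /\ hull s `&` U !=set0].
  move=> x; have [Px|?] := pselect (P x); last by exists setT.
  have [|V nV fV] := complex_locally_finite cK (x := x); first by rewrite bK.
  by exists V.
have cov : cover_compact P by rewrite -compact_cover.
have [||D DP Dcov] := cov T P (fun x => interior (U x)).
- by move=> x _; exact: open_interior.
- by move=> x Px; exists x => //; exact: (UE _ Px).1.
apply: (@sub_finite_set _ _ (\bigcup_(x in [set` D]) [set s | K s /\ hull s `&` U x !=set0])).
  move=> s Ks; have s0 : s != fset0.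
    by have [m [_ sm]] := complex_simplex cK Ks; rewrite -cardfs_eq0 sm.
  have [y sy] := hull_neq0 s0.
  have Py : P y by rewrite -bK; exists s.
  have [x Dx /interior_subset Ux] := Dcov _ Py.
  by exists x => //; split=> //; exists y.
apply: bigcup_finite; first exact: finite_fset.
by move=> x /DP /set_mem Px; exact: (UE _ Px).2.
Qed.

Lemma pc_equiv_refl n K (F G : {fset T} -> 'M[R]_(n, N) -> R) : geo K -> dim_le n K ->
  (forall s, n_simplices n K s -> forall M, rows_in (tangent s) M -> F s M = G s M) ->
  pc_equiv K F G.
Proof.
move=> gK dK FG; have [ps [ps1 ps2]] := finite_polys gK.
exists id, ps; split; first by split=> // y Py; exists y.
split=> [x [s Ks sx]|p /ps2[s Ks pE]].
  by have [p pps pE] := ps1 _ Ks; exists p => //; rewrite pE.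
exists 1%:M, 0, s, s; rewrite pE; split=> //; first by move=> x sx; rewrite mulmx1 addr0.
move=> u un us M Mu; rewrite mulmx1.
have [_ sn] := hull_simplex_uniq gK dK un Ks Ks us us.
by apply: FG => //; rewrite -(tangent_eq_hull sn un us).
Qed.

(** * Positive dimension *)

Section Positive.
Context (n : nat) (P : set T) (o : {fset T} -> 'M[R]_(n.+1, N) -> R) (W1 W2 : pc_form R N n.+1).
Local Notation E := (std_edges n).
Hypotheses (bP : pl_boundary n.+1 P = set0) (cP : connected P) (oP : pl_orientation P o).

Lemma rel_sign_sub o1 s t : pl_orientation P o1 -> simplex_in n.+1 P s -> simplex_in n.+1 P t ->
  hull t `<=` hull s -> rel_sign o o1 t = rel_sign o o1 s.
Proof.
move=> o1P sP tP ts; have sN := ordE sP.1.2; have tN := ordE tP.1.2.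
have te := tangent_eq_hull sP.1 tP.1 ts.
have [|A AE] := rows_tangent (M := E t) sN; first by rewrite -te; exact: edges_tangent.
have fs := simplex_frame sP.1 sN; have ft := simplex_frame tP.1 tN.
have Au : A \in unitmx.
  rewrite -row_free_unit; apply: inj_row_free => u uA.
  apply: (indep_edges_free ((affinely_indepP _).1 tP.1.1) tN).
  by rewrite -/(E t) AE mulmxA uA mul0mx.
have [_ h] := orientation_simplex oP sP fs; have [_ h1] := orientation_simplex o1P sP fs.
rewrite /rel_sign (orientation_sub oP tP sP ts ft) (orientation_sub o1P tP sP ts ft).
rewrite -!/(E t) AE h // h1 // mulrACA -expr2 sqr_sg -unitfE -unitmxE Au mul1r.
by [].
Qed.

Lemma rel_sign_const o1 K s t : pl_orientation P o1 -> geo K -> body K = P ->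
  K s -> K t -> #|` s| = n.+2 -> #|` t| = n.+2 -> rel_sign o o1 t = rel_sign o o1 s.
Proof.
move=> o1P gK bK Ks Kt sn tn.
apply: (dual_connected (Q := fun t => rel_sign o o1 t = rel_sign o o1 s) _ bP cP gK bK) => //.
- exact: orientation_dim oP gK bK.
- by move=> s' t' Ks' Kt' s'n t'n st <-; apply/esym; exact: (rel_sign_adj oP o1P gK bK Ks' Kt' s'n t'n st).
- by exists s.
Qed.

Lemma rel_sign_pm o1 s : pl_orientation P o1 -> simplex_in n.+1 P s ->
  rel_sign o o1 s = 1 \/ rel_sign o o1 s = -1.
Proof.
move=> o1P sP; have fr := simplex_frame sP.1 (ordE sP.1.2); rewrite /rel_sign.
by case: (orientation_sign oP sP fr) => ->; case: (orientation_sign o1P sP fr) => ->;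
  rewrite ?mulr1 ?mul1r ?mulrN1 ?opprK; [left|right|right|left].
Qed.

(** If [V u] is the volume of [u] under [w], up to a common factor, then the weight [a u / V u]
    gives [u] the volume [a u], and [move] becomes an exchange of densities. Coherence of [o1] on
    the common facet supplies the sign in the balance that [facet_move] asks for. *)
Lemma facet_transfer o1 K (w : {fset T} -> 'M[R]_(n.+1, N) -> R) (V a : {fset T} -> R) s t (d : R) :
  pl_orientation P o1 -> geo K -> body K = P -> K s -> K t -> #|` s| = n.+2 -> #|` t| = n.+2 ->
  s != t -> #|` (s `&` t)%fset| = n.+1 -> forms_on K w ->
  (forall s (Q : 'M[R]_(n.+2, N)), K s -> ordered s Q -> o1 s (edges Q) = Num.sg (w s (edges Q))) ->
  (forall s (Q : 'M[R]_(n.+2, N)), K s -> ordered s Q -> `|w s (edges Q)| = V s) ->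
  (forall s, K s -> #|` s| = n.+2 -> 0 < V s) -> 0 < d < a s -> 0 < a t ->
  pc_equiv K (fun (u : {fset T}) M => a u / V u * w u M) (fun (u : {fset T}) M => move a s t d u / V u * w u M).
Proof.
move=> o1P gK bK Ks Kt sn tn st stn wf sgE VE V0 /andP[d0 da] pa.
have ex (u : {fset T}) : (s `&` t `<=` u)%fset -> #|` u| = n.+2 ->
    exists2 a, a \notin (s `&` t)%fset & u = (a |` (s `&` t))%fset.
  move=> su un; have /fsubsetPn[v vu vst] : ~~ (u `<=` s `&` t)%fset.
    by apply/negP => /fsubset_leq_card; rewrite un stn ltnn.
  by exists v => //; apply/esym/eqP; rewrite eqEfcard fsubUset fsub1set vu su cardfsU1 vst stn un add1n leqnn.
have [p pr sE] := ex _ (fsubsetIl s t) sn; have [q qr tE] := ex _ (fsubsetIr s t) tn.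
move: stn pr qr sE tE {ex}; set r := (s `&` t)%fset; move: r => r rn pr qr sE tE.
have pq : p != q by apply: contraNneq st => e; rewrite sE tE e.
have Kp : K (p |` r)%fset by rewrite -sE.
have Kq : K (q |` r)%fset by rewrite -tE.
have co := orientation_two_cofaces o1P gK bK rn pr qr pq Kp Kq.
have dK := orientation_dim o1P gK bK.
have Vs := V0 _ Ks sn; have Vt := V0 _ Kt tn.
have ts : t != s by rewrite eq_sym.
pose l (x : {fset T}) := a x / V x; pose l' (x : {fset T}) := move a s t d x / V x.
have ls : l' s = (a s - d) / V s by rewrite /l' move_src.
have lt : l' t = (a t + d) / V t by rewrite /l' move_tgt.
have lo (x : {fset T}) : x != s -> x != t -> l x = l' x by move=> xs xt; rewrite /l' move_off.
have l1 : 0 < l' s < l s.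
  rewrite ls /l divr_gt0 ?subr_gt0 //= ltr_pM2r ?invr_gt0 //.
  by rewrite gtrDl oppr_lt0.
have l2 : 0 < l t < l' t.
  rewrite lt /l divr_gt0 //= ltr_pM2r ?invr_gt0 //.
  by rewrite ltrDl.
have vol (X : 'M[R]_(n.+1, N)) : ordered r X ->
    (l t - l' t) * w t (edges (cons_mx q X)) = (l s - l' s) * w s (edges (cons_mx p X)).
  move=> rX; rewrite ls lt /l -!mulrBl.
  have oX : ordered s (cons_mx p X) by rewrite sE; exact: ordered_cons.
  have oX' : ordered t (cons_mx q X) by rewrite tE; exact: ordered_cons.
  have sP := geo_simplex_in gK bK Ks sn; have tP := geo_simplex_in gK bK Kt tn.
  have ac : o1 s (edges (cons_mx p X)) = - o1 t (edges (cons_mx q X)).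
    rewrite sE tE; apply: (orientation_across o1P rX); rewrite -?sE -?tE //.
    by rewrite sE tE; exact: (hull_cofaces gK).
  rewrite (sgE _ _ Ks oX) (sgE _ _ Kt oX') in ac.
  rewrite [w t _]numEsg [w s _]numEsg (VE _ _ Ks oX) (VE _ _ Kt oX') ac.
  have cancel (x c v e : R) : v != 0 -> (x - (x + c)) / v * (e * v) = - (c * e).
    by move=> v0; field.
  have cancel' (x c v e : R) : v != 0 -> (x - (x - c)) / v * (- e * v) = - (c * e).
    by move=> v0; field.
  by rewrite cancel ?cancel' // gt_eqF.
rewrite sE in lo l1 vol; rewrite tE in lo l2 vol.
exact: (facet_move gK dK rn co wf lo l1 l2 vol).
Qed.

Lemma pl_equivalent_pos : compact P -> pc_volume_form P W1 -> pc_volume_form P W2 ->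
  total_volume o W1 = total_volume o W2 -> pl_equivalent W1 W2.
Proof.
move=> kP [t1 f1 [ o1 [ o1P o1W]]] [t2 f2 [ o2 [ o2P o2W]]] vol.
have g1 := compact_geo kP t1; have g2 := compact_geo kP t2.
have b1 := t1.2; have b2 := t2.2.
have [K [gK bK r1 r2]] := common_refinement g1 g2 (etrans b1 (esym b2)).
rewrite b1 in bK.
have d1 := orientation_dim oP g1 b1; have d2 := orientation_dim oP g2 b2.
have dK := orientation_dim oP gK bK.
pose w1 := pulled W1; pose w2 := pulled W2.
suff [F [G [FE GE FG]]] : exists F G, [/\
    forall s, n_simplices n.+1 K s -> forall M, rows_in (tangent s) M -> F s M = w1 s M,
    forall s, n_simplices n.+1 K s -> forall M, rows_in (tangent s) M -> G s M = w2 s M &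
    pc_equiv K F G].
  by apply: (pc_equiv_pl g1 d1 g2 d2 gK dK _ _ r1 r2 FE GE FG); rewrite ?b1 ?b2 bK.
(* Without top simplices there are no forms to compare, and the identity is an equivalence. *)
have [[t0 [Kt0 t0n]]|none] := pselect (exists t, K t /\ #|` t| = n.+2); last first.
  exists w1, w2; split=> //; apply: pc_equiv_refl => // s [Ks [_ sn]].
  by case: none; exists s.
have nf1 s (Q : 'M[R]_(n.+2, N)) : K s -> ordered s Q -> w1 s (edges Q) != 0.
  exact: (pulled_neq0 g1 b1 gK bK r1 o1P o1W).
have nf2 s (Q : 'M[R]_(n.+2, N)) : K s -> ordered s Q -> w2 s (edges Q) != 0.
  exact: (pulled_neq0 g2 b2 gK bK r2 o2P o2W).
have sg1 s (Q : 'M[R]_(n.+2, N)) : K s -> ordered s Q ->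
    o1 s (edges Q) = Num.sg (w1 s (edges Q)).
  exact: (pulled_sign g1 b1 gK bK r1 o1P o1W).
have sg2 s (Q : 'M[R]_(n.+2, N)) : K s -> ordered s Q ->
    o2 s (edges Q) = Num.sg (w2 s (edges Q)).
  exact: (pulled_sign g2 b2 gK bK r2 o2P o2W).
have fm1 s : K s -> #|` s| = n.+2 -> nform_on (tangent s) (w1 s).
  exact: (pulled_form g1 b1 gK bK r1 o1P f1).
have fm2 s : K s -> #|` s| = n.+2 -> nform_on (tangent s) (w2 s).
  exact: (pulled_form g2 b2 gK bK r2 o2P f2).
have t0P := geo_simplex_in gK bK Kt0 t0n.
pose S := tops K n.+2.
have SK s : s \in S -> K s /\ #|` s| = n.+2 by move=> /(in_tops _ _ gK).
have t0S : t0 \in S by apply/in_tops.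
pose V s := `|w1 s (E s)|; pose U s := `|w2 s (E s)|.
have V0 s : s \in S -> 0 < V s.
  by move=> /SK[Ks sn]; rewrite normr_gt0; apply: nf1 => //; exact: ordE.
have U0 s : s \in S -> 0 < U s.
  by move=> /SK[Ks sn]; rewrite normr_gt0; apply: nf2 => //; exact: ordE.
(* The relative sign is constant on each triangulation and unchanged on passing to a carrier, so for
   both forms it can be read off at the single simplex [t0]. *)
have tv o' W (o'P : pl_orientation P o') (o'W : induces_orientation W o')
    (g : geo (support_complex W)) (b : body (support_complex W) = P)
    (r : refines K (support_complex W))
    (f : forall s, n_simplices n.+1 (support_complex W) s ->
      nform_on (tangent s) (form_on W s) /\ nonzero_on (tangent s) (form_on W s)) :
    total_volume o W = rel_sign o o' t0 * (\sum_(s <- S) `|pulled W s (E s)|) / n.+1`!%:R.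
  apply: (total_volume_refine g b gK bK r o'P o'W f oP) => s Ks sn.
  have [Kc cS tc _] := carrier_spec g b gK bK r o'P Kt0 t0n.
  have cP' := geo_simplex_in g b Kc cS.2.
  rewrite (rel_sign_sub o'P cP' t0P tc).
  exact: (rel_sign_const o'P g b Kc Ks cS.2 sn).
have sumpos (h : {fset T} -> R) : (forall s, s \in S -> 0 < h s) -> 0 < \sum_(s <- S) h s.
  move=> h0; rewrite (big_fsetD1 t0) //= ltr_pwDl ?h0 // big_seq sumr_ge0 // => s.
  by rewrite !inE => /andP[_ sS]; rewrite ltW // h0.
have VS := sumpos _ V0; have US := sumpos _ U0.
(* Both sums are positive, so equality of the total volumes first forces the relative signs to agree
   and then gives equal sums. *)
have [e12 VU] : rel_sign o o1 t0 = rel_sign o o2 t0 /\ \sum_(s <- S) V s = \sum_(s <- S) U s.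
  have f0 : (n.+1`!%:R : R)^-1 != 0 by rewrite invr_eq0 pnatr_eq0 -lt0n fact_gt0.
  have := vol; rewrite (tv _ _ o1P o1W g1 b1 r1 f1) (tv _ _ o2P o2W g2 b2 r2 f2) => /(mulIf f0).
  rewrite -[\sum_(s <- S) _]/(\sum_(s <- S) V s) -[X in _ = _ * X]/(\sum_(s <- S) U s).
  case: (rel_sign_pm o1P t0P) => ->; case: (rel_sign_pm o2P t0P) => ->; rewrite ?mul1r ?mulN1r => e; split=> //; lra.
have osame s : s \in S -> o1 s (E s) = o2 s (E s).
  move=> /SK[Ks sn]; have sP := geo_simplex_in gK bK Ks sn.
  have := rel_sign_const o1P gK bK Kt0 Ks t0n sn; have := rel_sign_const o2P gK bK Kt0 Ks t0n sn.
  rewrite e12 => <-; rewrite /rel_sign => /mulfI; apply.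
  by case: (orientation_sign oP sP (simplex_frame sP.1 (ordE sn))) => ->; rewrite ?oppr_eq0 oner_neq0.
have VE s (Q : 'M[R]_(n.+2, N)) : s \in S -> ordered s Q -> `|w1 s (edges Q)| = V s.
  move=> /SK[Ks sn] sQ; have [p ->] := ordered_row_perm (ordE sn) sQ.
  rewrite (form_edges_perm p (edges_tangent (ordE sn)) (fm1 _ Ks sn)).
  by rewrite normrM normrX normrN1 expr1n mul1r.
have w1f : forms_on K w1 by move=> s [Ks [_ sn]]; exact: fm1.
pose Rel a b := pc_equiv K (fun s M => a s / V s * w1 s M) (fun s M => b s / V s * w1 s M).
have inS s : n_simplices n.+1 K s -> s \in S by move=> [Ks [_ sn]]; apply/in_tops.
(* Both forms are written as weights times [w1], the shape that [Rel] requires. The second is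
   [U s / V s] times the first because the two induced orientations agree. *)
exists (fun s M => V s / V s * w1 s M), (fun s M => U s / V s * w1 s M); split.
- by move=> s /inS sS M _; rewrite divff ?mul1r // gt_eqF // V0.
- move=> s sK M Ms; have sS := inS _ sK; have [Ks sn] := SK _ sS.
  have [B ->] := rows_tangent (ordE sn) Ms; have et := edges_tangent (ordE sn).
  rewrite (form_mulmx (fm1 _ Ks sn) _ et) (form_mulmx (fm2 _ Ks sn) _ et) -/(E s).
  have := osame _ sS; rewrite (sg1 _ _ Ks (ordE sn)) (sg2 _ _ Ks (ordE sn)) => sgE.
  rewrite -/(w2 s) -/(w1 s) mulrCA; congr (_ * _).
  have e1 : w1 s (E s) = Num.sg (w2 s (E s)) * V s by rewrite {1}[w1 _ _]numEsg -sgE.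
  have e2 : w2 s (E s) = Num.sg (w2 s (E s)) * U s by exact: numEsg.
  rewrite e1 [RHS]e2 mulrCA; congr (_ * _).
  by rewrite divfK // gt_eqF // V0.
apply: (transfer_all (S := S) (Rel := Rel) (adj := fun s t => #|` (s `&` t)%fset| = n.+1)) => //.
- move=> Q s0 s0S Qs0 adj t /SK[Kt tn].
  apply: (dual_connected (Q := Q) _ bP cP gK bK dK) => //.
    by move=> s' t' Ks' Kt' s'n t'n; apply: adj; apply/in_tops.
  by have [Ks0 s0n] := SK _ s0S; exists s0.
- by move=> a b c; exact: pc_equiv_trans.
- by move=> a b ab; apply: pc_equiv_refl => // s /inS sS M _; rewrite ab.
move=> a s t d sS tS st stn pa dd.
have [Ks sn] := SK _ sS; have [Kt tn] := SK _ tS.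
apply: (facet_transfer o1P gK bK Ks Kt sn tn st stn w1f sg1 _ _ dd (pa _ tS)).
- by move=> s' Q Ks' sQ; apply: VE => //; apply/in_tops => //; split=> //; exact: ordered_card sQ.
- by move=> s' Ks' sn'; apply: V0; apply/in_tops.
Qed.

End Positive.
End Assembly.

(** * Dimension zero *)

Lemma zero_manifold_point (R : realType) (N : nat) (P : set 'rV[R]_N) x :
  pl_boundary 0 P = set0 -> connected P -> P x -> P = [set x].
Proof.
move=> bP cP Px; have [y [e [g [cs [e0 _ _ [U nU UE]]]]]] := local_chart bP Px.
(* The chart takes values in a space with a single point, so [x] is isolated in [P]. *)
have Ux x' : U x' -> P x' -> x' = x.
  move=> Ux' Px'; have [z' _ <-] := UE _ Ux' Px'.
  have [z _ <-] := UE _ (nbhs_singleton nU) Px.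
  by congr g; apply/rowP => -[].
apply/esym/cP.
- by exists x.
- exists (interior U); first exact: open_interior.
  apply/seteqP; split=> [_ ->|x' [Px' Ux']]; first by split=> //; exact: nU.
  exact: Ux (interior_subset Ux') Px'.
- exists [set x].
    have -> : [set x] = hull [fset x]%fset; last first.
      apply: hull_closed => a b z [_ a0 a1 _] [_ b0 b1 _]; apply/funext => v.
      move: a1 b1; rewrite !big_seq_fset1 => a1 b1.
      by have [->|vx] := eqVneq v x; [rewrite a1 b1|rewrite a0 ?b0 // inE].
    apply/seteqP; split=> [_ ->|z].
      by apply: hull_vertex; rewrite inE.
    by move=> /hull_bary[a [_ _ + ->]]; rewrite !big_seq_fset1 => ->; rewrite scale1r.
  by apply/seteqP; split=> [_ ->|x' []].
Qed.

(** [P] has at most one point, so the two complexes coincide and the identity works: the total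
    volume is the value of the form multiplied by a sign common to both. *)
Lemma pl_equivalent_zero (R : realType) (N : nat) (P : set 'rV[R]_N)
    (o : {fset 'rV[R]_N} -> 'M[R]_(0, N) -> R) (W1 W2 : pc_form R N 0) :
  pl_boundary 0 P = set0 -> connected P -> compact P -> pl_orientation P o ->
  pc_volume_form P W1 -> pc_volume_form P W2 ->
  total_volume o W1 = total_volume o W2 -> pl_equivalent W1 W2.
Proof.
move=> bP cP kP oP [t1 f1 _] [t2 f2 _] vol.
have g1 := compact_geo kP t1; have g2 := compact_geo kP t2.
have [b1 b2] := (t1.2, t2.2).
have one K s : geo K -> body K = P -> K s -> exists2 x, s = [fset x]%fset & P = [set x].
  move=> gK bK Ks; have /fset0Pn[x xs] := geo_neq0 gK Ks.
  have sP v : v \in s -> P v by move=> vs; rewrite -bK; exists s => //; exact: hull_vertex.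
  have Pe := zero_manifold_point bP cP (sP _ xs); exists x => //.
  apply/eqP; rewrite eqEfsubset fsub1set xs andbT; apply/fsubsetP => v /sP.
  by rewrite Pe inE => ->.
have dim K : geo K -> body K = P -> dim_le 0 K.
  by move=> gK bK s /(one _ _ gK bK)[x -> _]; rewrite cardfs1.
set K1 := support_complex W1 in g1 b1; set K2 := support_complex W2 in g2 b2.
have K12 s : K1 s -> K2 s.
  move=> Ks; have [x -> Px] := one _ _ g1 b1 Ks.
  have [s' Ks' _] : body K2 x by rewrite b2 Px.
  have [x' s'E Px'] := one _ _ g2 b2 Ks'.
  have : [set x] x' by rewrite -Px Px'.
  by move=> <-; rewrite -s'E.
have r12 : refines K1 K2 by move=> s /K12 Ks; exists s.
pose F s := form_on W1 (carrier 0 K1 s); pose G s := form_on W2 (carrier 0 K2 s).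
apply: (@pc_equiv_pl _ _ _ W1 W2 K1 F G) => //; try by [exact: dim|exact: refines_refl|rewrite b1 b2].
rewrite /F /G.
apply: pc_equiv_refl => // [|s [Ks sS] M _]; first exact: dim.
have Ks2 := K12 _ Ks.
rewrite (carrierE g1 (dim _ g1 b1) sS Ks (fun _ h => h)) (carrierE g2 (dim _ g2 b2) sS Ks2 (fun _ h => h)).
have sI : simplex_in 0 P s by split=> //; rewrite -b1 => x sx; exists s.
have sQ := ordered_nth sS.2.
have fr := edges_frame ((affinely_indepP _).1 sS.1) sQ.
have tv W : geo (support_complex W) -> body (support_complex W) = P -> support_complex W s ->
    total_volume o W = o s M * form_on W s M.
  move=> g b Ws; rewrite /total_volume (_ : n_simplices 0 _ = [set s]).
    rewrite fsbig_set1 /simplex_integral fact0 invr1 mulr1.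
    by rewrite [X in o s X](flatmx0 _) [X in form_on W s X](flatmx0 _) -(flatmx0 M).
  apply/seteqP; split=> [s' [Ws' _]|_ ->]; last by split.
  have [x -> Px] := one _ _ g b Ws; have [x' -> Px'] := one _ _ g b Ws'.
  have : [set x] x' by rewrite -Px Px'.
  by move=> ->.
have := vol; rewrite !tv // => /mulfI; apply.
have [h _] := orientation_simplex oP sI fr; move: h; rewrite [edges _]flatmx0 -(flatmx0 M).
by case=> ->; rewrite ?oppr_eq0 oner_neq0.
Qed.

Theorem theorem3p1 (R : realType) (N n : nat) (P : set 'rV[R]_N)
    (o : {fset 'rV[R]_N} -> 'M[R]_(n, N) -> R) (Omega1 Omega2 : pc_form R N n)
    (P_closed : closed_pl_manifold n P) (P_connected : connected P)
    (o_orientation : pl_orientation P o)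
    (Omega1_volume : pc_volume_form P Omega1)
    (Omega2_volume : pc_volume_form P Omega2)
    (same_volume : total_volume o Omega1 = total_volume o Omega2) :
  pl_equivalent Omega1 Omega2.
Proof.
have [_ kP bP] := P_closed.
case: n => [|n] in o Omega1 Omega2 P_closed o_orientation Omega1_volume Omega2_volume same_volume bP *.
  exact: (pl_equivalent_zero bP P_connected kP o_orientation).
exact: (pl_equivalent_pos bP P_connected o_orientation).
Qed.
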